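(* Let $\phi:\mathbb D\to\mathbb D$ be holomorphic, where $\mathbb D$ is the open unit disk, and let $C_\phi:H(\mathbb D)\to H(\mathbb D)$, $C_\phi f=f\circ\phi$, where $H(\mathbb D)$ is the Fréchet space of holomorphic functions on $\mathbb D$ with the topology of uniform convergence on compact subsets. Then $C_\phi$ is recurrent if and only if either $\phi$ is univalent (holomorphic and one-to-one) and has no fixed point in $\mathbb D$, or $\phi$ is an elliptic automorphism of $\mathbb D$.
   Context: A continuous linear operator $T$ on a Fréchet space $Y$ is recurrent if for every non-empty open $U\subset Y$ there is a positive integer $k$ with $U\cap T^{-k}(U)\neq\emptyset$. A conformal automorphism of $\mathbb D$ is a linear fractional map $z\mapsto(az+b)/(cz+d)$ ($ad-bc\neq0$) mapping $\mathbb D$ onto $\mathbb D$; it is an elliptic automorphism if it has a fixed point $\alpha\in\mathbb D$ (its second fixed point then lies in $\hat{\mathbb C}\setminus\overline{\mathbb D}$). *)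

(* Defs.v *)
From Stdlib Require Import Reals.
From Coquelicot Require Import Coquelicot.
Open Scope R_scope.

Definition in_disk (z : C) : Prop := Cmod z < 1.

Definition holo_D (f : C -> C) : Prop :=
  forall z : C, in_disk z -> ex_derive (K := C_AbsRing) (V := C_NormedModule) f z.

Definition self_map_D (phi : C -> C) : Prop :=
  holo_D phi /\ forall z, in_disk z -> in_disk (phi z).

(* Elements of H(D) are represented by functions C -> C holomorphic on D
   (values outside D are irrelevant). A set U of such functions is open in the
   topology of uniform convergence on compact subsets of D iff around each
   f in U it contains a basic neighbourhood
   { g in H(D) | sup_{|z| <= r} |g z - f z| < eps }, 0 <= r < 1, eps > 0
   (every compact subset of D lies in some closed disk |z| <= r, r < 1). *)
Definition open_HD (U : (C -> C) -> Prop) : Prop :=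
  forall f, U f ->
    holo_D f /\
    exists r eps : R, 0 <= r /\ r < 1 /\ 0 < eps /\
      forall g, holo_D g ->
        (forall z, Cmod z <= r -> Cmod (g z - f z) < eps) -> U g.

Definition comp_op (phi : C -> C) (f : C -> C) : C -> C := fun z => f (phi z).

Definition recurrent_comp_op (phi : C -> C) : Prop :=
  forall U : (C -> C) -> Prop, open_HD U -> (exists f, U f) ->
    exists k : nat, (1 <= k)%nat /\
      exists f, U f /\ U (Nat.iter k (comp_op phi) f).

Definition univalent_D (phi : C -> C) : Prop :=
  holo_D phi /\ forall z w, in_disk z -> in_disk w -> phi z = phi w -> z = w.

Definition has_fixed_point_D (phi : C -> C) : Prop :=
  exists a, in_disk a /\ phi a = a.

Definition conformal_aut_D (phi : C -> C) : Prop :=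
  exists a b c d : C,
    (a * d - b * c)%C <> 0%C /\
    (forall z, in_disk z -> (c * z + d)%C <> 0%C /\
                            phi z = ((a * z + b) / (c * z + d))%C) /\
    (forall z, in_disk z -> in_disk (phi z)) /\
    (forall w, in_disk w -> exists z, in_disk z /\ phi z = w).

Definition elliptic_aut_D (phi : C -> C) : Prop :=
  conformal_aut_D phi /\ has_fixed_point_D phi.

(* Main.v *)
(** Necessity.  If [phi a = phi b], a function close to [0] at [a] and to [1] at [b]
    cannot return, so [phi] is injective.  If [phi] fixes [a], recurrence near the
    identity function shows that [phi] preserves the hyperbolic distance to [a]
    (by Schwarz-Pick it can only decrease it), so [phi] is conjugate to a rotation.

    Sufficiency.  Rotations have iterates close to the identity.  If [phi] is univalent
    without fixed points, some iterate [psi] carries the closed disk [K] of radius [r]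
    off itself: otherwise the orbit of [0] stays in a compact set and [phi] preserves
    a bounded star-shaped set, in which the maps [s * phi], [s < 1], have fixed points
    that subconverge to a fixed point of [phi].  It then suffices to find [g]
    holomorphic on the disk with [g] close to [f] on [K] and [g o psi] close to [f] on
    [K].  For [chi = id] and [chi = psi], the average over [|x| = R] of
    [f(x) chi'(x) x / (chi(x) - w)] is [f(z)] at [w = chi(z)] and [0] on the other
    compact set, because [chi] is injective; its Riemann sums have poles on
    [chi(|x| = R)], which can be pushed out of the disk as the complement of the two
    compact sets is connected. *)
Require Import Defs.
From Stdlib Require Import Reals Lra Lia Classical ClassicalEpsilon.
From Coquelicot Require Import Coquelicot.
Open Scope C_scope.

(** * Continuity and complex differentiability *)

(** All complex analysis here rests on circle averages. Goursat's theorem on rectangles, pulled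
    through the exponential, shows that averages over concentric circles agree across annuli;
    Cauchy's formula, the maximum principle and Schwarz-Pick follow. The average integrates against
    [dz / (2 pi i z)], which accounts for the extra factor [x] in the kernels. Three topological
    obstacles are met by injectivity and hyperbolic estimates. Fixed points: [s * phi] contracts the
    pseudo-hyperbolic distance by a uniform factor, which stands in for Brouwer or Denjoy-Wolff.
    Connectedness of the complement of the two compact sets is never stated: instead,
    approximability of a pole is extended across them to a locally constant predicate on the plane,
    which the open mapping property makes possible. Critical points of [chi], where the Cauchy
    kernel argument would divide by zero, are not excluded; noncritical points are shown to be dense
    and continuity does the rest. The iterate has to clear a disk larger than [K], because contours
    and poles live in an annulus around [K]. *)

Lemma Cminus_0_r (z : C) : z - 0 = z.
Proof. ring. Qed.

Lemma Cmod_sub_comm (z w : C) : Cmod (z - w) = Cmod (w - z).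
Proof. rewrite <- Cmod_opp. f_equal. ring. Qed.

Lemma Cmod_sub_triangle (x y z : C) : Cmod (x - z) <= Cmod (x - y) + Cmod (y - z).
Proof. replace (x - z) with ((x - y) + (y - z)) by ring. apply Cmod_triangle. Qed.

Lemma Cmod_triangle_rev (x y : C) : Cmod x - Cmod y <= Cmod (x - y).
Proof.
  assert (H := Cmod_triangle (x - y) y).
  replace (x - y + y) with x in H by ring. lra.
Qed.

Lemma Cmod_RtoC_pos (x : R) : 0 <= x -> Cmod (RtoC x) = x.
Proof. intros H. rewrite Cmod_R. now apply Rabs_pos_eq. Qed.

Lemma Cmod_sub_zero (z w : C) : Cmod (z - w) = 0 -> z = w.
Proof.
  intros H. apply Cmod_eq_0 in H. replace z with (z - w + w) by ring. rewrite H. ring.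
Qed.

Lemma Csub_neq_0 (z w : C) : z <> w -> z - w <> 0.
Proof. intros H E. apply H. apply Cmod_sub_zero. rewrite E. apply Cmod_0. Qed.

Lemma Cmod_neq (z w : C) : Cmod z <> Cmod w -> z <> w.
Proof. congruence. Qed.

(** Relative to an arbitrary [d], so that one set of rules serves functions of a complex variable
    ([cdist]) and of a real parameter ([rdist]). *)
Definition cont_at {X : Type} (d : X -> X -> R) (f : X -> C) (x : X) : Prop :=
  forall e : R, 0 < e -> exists dl : R, 0 < dl /\
    forall y, d y x < dl -> Cmod (f y - f x) < e.

Definition cdist (w z : C) : R := Cmod (w - z).
Definition rdist (s t : R) : R := Rabs (s - t).

Notation ccont := (cont_at cdist).
Notation rcont := (cont_at rdist).

Section ContinuityRules.
Context {X : Type} (d : X -> X -> R).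
Implicit Types f g : X -> C.

Lemma cont_at_const (c : C) (x : X) : cont_at d (fun _ => c) x.
Proof.
  intros e He. exists 1. split; [lra|]. intros y _.
  replace (c - c) with (RtoC 0) by ring. now rewrite Cmod_0.
Qed.

Lemma cont_at_plus f g x : cont_at d f x -> cont_at d g x -> cont_at d (fun y => f y + g y) x.
Proof.
  intros Hf Hg e He.
  destruct (Hf (e / 2)%R) as [d1 [Hd1 H1]]; [lra|].
  destruct (Hg (e / 2)%R) as [d2 [Hd2 H2]]; [lra|].
  exists (Rmin d1 d2). split; [now apply Rmin_pos|]. intros y Hy.
  replace (f y + g y - (f x + g x)) with ((f y - f x) + (g y - g x)) by ring.
  eapply Rle_lt_trans; [apply Cmod_triangle|].
  assert (Cmod (f y - f x) < e / 2) by (apply H1; eapply Rlt_le_trans; [apply Hy|apply Rmin_l]).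
  assert (Cmod (g y - g x) < e / 2) by (apply H2; eapply Rlt_le_trans; [apply Hy|apply Rmin_r]).
  lra.
Qed.

Lemma cont_at_mult f g x : cont_at d f x -> cont_at d g x -> cont_at d (fun y => f y * g y) x.
Proof.
  intros Hf Hg e He.
  set (A := (1 + Cmod (f x) + Cmod (g x))%R).
  assert (HA : 1 <= A) by (unfold A; generalize (Cmod_ge_0 (f x)) (Cmod_ge_0 (g x)); lra).
  set (e' := Rmin 1 (e / (2 * A))).
  assert (He' : 0 < e').
  { apply Rmin_pos; [lra|]. apply Rdiv_lt_0_compat; lra. }
  assert (HeA : (e' * A <= e / 2)%R).
  { apply Rle_trans with (e / (2 * A) * A)%R.
    - apply Rmult_le_compat_r; [lra|apply Rmin_r].
    - right. field. lra. }
  assert (He1 : e' <= 1) by apply Rmin_l.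
  destruct (Hf e') as [d1 [Hd1 H1]]; [lra|].
  destruct (Hg e') as [d2 [Hd2 H2]]; [lra|].
  exists (Rmin d1 d2). split; [now apply Rmin_pos|]. intros y Hy.
  assert (K1 : Cmod (f y - f x) < e') by (apply H1; eapply Rlt_le_trans; [apply Hy|apply Rmin_l]).
  assert (K2 : Cmod (g y - g x) < e') by (apply H2; eapply Rlt_le_trans; [apply Hy|apply Rmin_r]).
  replace (f y * g y - f x * g x)
    with ((f y - f x) * (g y - g x) + (f x * (g y - g x) + g x * (f y - f x))) by ring.
  eapply Rle_lt_trans; [apply Cmod_triangle|].
  eapply Rle_lt_trans; [apply Rplus_le_compat_l, Cmod_triangle|].
  rewrite !Cmod_mult.
  generalize (Cmod_ge_0 (f x)) (Cmod_ge_0 (g x)) (Cmod_ge_0 (f y - f x)) (Cmod_ge_0 (g y - g x)).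
  intros P1 P2 P3 P4.
  assert (Cmod (f y - f x) * Cmod (g y - g x) <= e' * 1)%R by (apply Rmult_le_compat; lra).
  assert (Cmod (f x) * Cmod (g y - g x) <= Cmod (f x) * e')%R by (apply Rmult_le_compat_l; lra).
  assert (Cmod (g x) * Cmod (f y - f x) <= Cmod (g x) * e')%R by (apply Rmult_le_compat_l; lra).
  replace (e' * A)%R with (e' * 1 + Cmod (f x) * e' + Cmod (g x) * e')%R in HeA by (unfold A; ring).
  lra.
Qed.

Lemma cont_at_opp f x : cont_at d f x -> cont_at d (fun y => - f y) x.
Proof.
  intros Hf e He. destruct (Hf e He) as [dl [Hd H]]. exists dl. split; [easy|]. intros y Hy.
  replace (- f y - - f x) with (- (f y - f x)) by ring. rewrite Cmod_opp. auto.
Qed.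

Lemma cont_at_minus f g x : cont_at d f x -> cont_at d g x -> cont_at d (fun y => f y - g y) x.
Proof. intros Hf Hg. apply cont_at_plus; [easy|now apply cont_at_opp]. Qed.

Lemma cont_at_inv f x : f x <> 0 -> cont_at d f x -> cont_at d (fun y => / f y) x.
Proof.
  intros H0 Hf e He.
  assert (Hm : 0 < Cmod (f x)) by now apply Cmod_gt_0.
  set (m := Cmod (f x)) in *.
  destruct (Hf (Rmin (m / 2) (e * (m * m) / 2))%R) as [dl [Hd H]].
  { apply Rmin_pos; [lra|]. apply Rdiv_lt_0_compat; [|lra].
    apply Rmult_lt_0_compat; [lra|]. now apply Rmult_lt_0_compat. }
  exists dl. split; [easy|]. intros y Hy. specialize (H y Hy).
  assert (H1 : Cmod (f y - f x) < m / 2) by (eapply Rlt_le_trans; [apply H|apply Rmin_l]).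
  assert (H2 : Cmod (f y - f x) < e * (m * m) / 2) by (eapply Rlt_le_trans; [apply H|apply Rmin_r]).
  assert (H3 : m / 2 < Cmod (f y)).
  { rewrite Cmod_sub_comm in H1. generalize (Cmod_triangle_rev (f x) (f y)). fold m. lra. }
  assert (H4 : f y <> 0) by (apply Cmod_gt_0; lra).
  replace (/ f y - / f x) with (- (f y - f x) / (f y * f x)) by (field; auto).
  rewrite Cmod_div by (now apply Cmult_neq_0).
  rewrite Cmod_opp, Cmod_mult. fold m.
  apply Rmult_lt_reg_r with (Cmod (f y) * m)%R; [apply Rmult_lt_0_compat; lra|].
  unfold Rdiv. rewrite Rmult_assoc, Rinv_l, Rmult_1_r
    by (apply Rgt_not_eq, Rmult_lt_0_compat; lra).
  eapply Rlt_trans; [apply H2|].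
  assert (m / 2 * m < Cmod (f y) * m)%R by (apply Rmult_lt_compat_r; lra).
  assert (e * (m / 2 * m) < e * (Cmod (f y) * m))%R by (apply Rmult_lt_compat_l; lra).
  lra.
Qed.

Lemma cont_at_div f g x : g x <> 0 -> cont_at d f x -> cont_at d g x -> cont_at d (fun y => f y / g y) x.
Proof. intros H Hf Hg. apply cont_at_mult; [easy|now apply cont_at_inv]. Qed.

Lemma cont_at_comp (h : C -> C) f x : ccont h (f x) -> cont_at d f x -> cont_at d (fun y => h (f y)) x.
Proof.
  intros Hh Hf e He. destruct (Hh e He) as [d1 [Hd1 H1]].
  destruct (Hf d1 Hd1) as [d2 [Hd2 H2]]. exists d2. split; [easy|]. intros y Hy.
  apply H1. now apply H2.
Qed.

Lemma cont_at_pow f x n : cont_at d f x -> cont_at d (fun y => f y ^ n) x.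
Proof.
  intros Hf. induction n as [|n IH]; simpl; [apply cont_at_const|now apply cont_at_mult].
Qed.

End ContinuityRules.

Lemma ccont_id (z : C) : ccont (fun w => w) z.
Proof. intros e He. exists e. split; [easy|]. intros y Hy. exact Hy. Qed.

Lemma ccont_ext_loc (f g : C -> C) (z : C) (r : R) : 0 < r ->
  (forall w, Cmod (w - z) < r -> f w = g w) -> ccont f z -> ccont g z.
Proof.
  intros Hr He Hf e Hpe. destruct (Hf e Hpe) as [d [Hd H]].
  exists (Rmin d r). split; [now apply Rmin_pos|]. intros y Hy. unfold cdist in *.
  rewrite <- !He.
  - apply H. eapply Rlt_le_trans; [apply Hy|apply Rmin_l].
  - replace (z - z) with (RtoC 0) by ring. now rewrite Cmod_0.
  - eapply Rlt_le_trans; [apply Hy|apply Rmin_r].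
Qed.

Section Derivative.
Implicit Types (f g : C -> C) (z w l m a c : C) (r : R).

(* Caratheodory's form of differentiability; the slope function [q] is global since nothing is required of it away from [z]. *)
Definition cderiv (f : C -> C) (z l : C) : Prop :=
  exists q : C -> C, q z = l /\ ccont q z /\ forall w, f w = f z + q w * (w - z).

Definition cdiff (f : C -> C) (z : C) : Prop := exists l, cderiv f z l.

Definition slope (f : C -> C) (z l : C) (w : C) : C :=
  if excluded_middle_informative (w = z) then l else (f w - f z) / (w - z).

Lemma slope_same f z l : slope f z l z = l.
Proof. unfold slope. now destruct excluded_middle_informative. Qed.

Lemma slope_other f z l w : w <> z -> slope f z l w = (f w - f z) / (w - z).
Proof. intros H. unfold slope. now destruct excluded_middle_informative. Qed.

Lemma slope_spec f z l w : f w = f z + slope f z l w * (w - z).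
Proof.
  unfold slope. destruct excluded_middle_informative as [->|H].
  - ring.
  - field. now apply Csub_neq_0.
Qed.

(** Off [z] the slope is forced, so every Caratheodory function equals [slope]. Derivative
    statements thereby become continuity statements at one point. *)
Lemma cderiv_slope f z l : cderiv f z l <-> ccont (slope f z l) z.
Proof.
  split.
  - intros [q [Hq [Hc H]]]. apply (ccont_ext_loc q) with (r := 1%R); [lra| |easy].
    intros w _. destruct (classic (w = z)) as [->|Hw].
    + now rewrite slope_same.
    + rewrite slope_other, H by easy. field. now apply Csub_neq_0.
  - intros H. exists (slope f z l). split; [apply slope_same|]. split; [easy|]. apply slope_spec.
Qed.

Lemma is_derive_cderiv (f : C -> C) (z l : C) :
  is_derive (K := C_AbsRing) (V := C_NormedModule) f z l <-> cderiv f z l.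
Proof.
  split.
  - intros [_ H]. specialize (H z (fun P HP => HP)).
    apply cderiv_slope. intros e He. assert (He2 : 0 < e / 2) by lra.
    destruct (H (mkposreal _ He2)) as [dl Hd]. simpl in Hd.
    exists dl. split; [apply cond_pos|]. intros w Hw. unfold cdist in Hw.
    destruct (classic (w = z)) as [->|Hn].
    + replace (slope f z l z - slope f z l z) with (RtoC 0) by ring. now rewrite Cmod_0.
    + specialize (Hd w Hw). rewrite slope_same, slope_other by easy.
      assert (Hm : 0 < Cmod (w - z)) by now apply Cmod_gt_0, Csub_neq_0.
      replace ((f w - f z) / (w - z) - l) with ((f w - f z - (w - z) * l) / (w - z))
        by (field; now apply Csub_neq_0).
      rewrite Cmod_div by now apply Csub_neq_0.
      apply Rle_lt_trans with (e / 2)%R; [|lra].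
      apply Rmult_le_reg_r with (Cmod (w - z)); [easy|].
      unfold Rdiv at 1. rewrite Rmult_assoc, Rinv_l, Rmult_1_r by lra. exact Hd.
  - intros Hq. split; [apply is_linear_scal_l|].
    intros x Hx e. assert (x = z) as ->.
    { symmetry. apply (is_filter_lim_locally_unique (K := C_AbsRing) (V := AbsRing_NormedModule C_AbsRing)). exact Hx. }
    destruct Hq as [q [Hq [Hc H]]].
    destruct (Hc e (cond_pos e)) as [d [Hd K]].
    exists (mkposreal d Hd). intros w Hw. specialize (K w Hw).
    change (Cmod (f w - f z - (w - z) * l) <= e * Cmod (w - z))%R.
    rewrite H. rewrite <- Hq.
    replace (f z + q w * (w - z) - f z - (w - z) * q z) with ((q w - q z) * (w - z)) by ring.
    rewrite Cmod_mult. apply Rmult_le_compat_r; [apply Cmod_ge_0|lra].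
Qed.

Lemma ex_derive_cdiff (f : C -> C) (z : C) :
  ex_derive (K := C_AbsRing) (V := C_NormedModule) f z <-> cdiff f z.
Proof. split; intros [l H]; exists l; now apply is_derive_cderiv. Qed.

Lemma cderiv_cont f z l : cderiv f z l -> ccont f z.
Proof.
  intros [q [Hq [Hc H]]].
  apply (ccont_ext_loc (fun w => f z + q w * (w - z))) with (r := 1%R); [lra|now intros; rewrite <- H|].
  apply cont_at_plus; [apply cont_at_const|]. apply cont_at_mult; [easy|].
  apply cont_at_minus; [apply ccont_id|apply cont_at_const].
Qed.

Lemma cdiff_cont f z : cdiff f z -> ccont f z.
Proof. intros [l H]. eapply cderiv_cont; eauto. Qed.

Lemma cderiv_const c z : cderiv (fun _ => c) z 0.
Proof. exists (fun _ => RtoC 0). split; [easy|]. split; [apply cont_at_const|]. intros; ring. Qed.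

Lemma cderiv_id z : cderiv (fun w => w) z 1.
Proof. exists (fun _ => RtoC 1). split; [easy|]. split; [apply cont_at_const|]. intros; ring. Qed.

Lemma cderiv_plus f g z l m : cderiv f z l -> cderiv g z m -> cderiv (fun w => f w + g w) z (l + m).
Proof.
  intros [q [Hq [Hc H]]] [p [Hp [Kc K]]]. exists (fun w => q w + p w).
  split; [now rewrite Hq, Hp|]. split; [now apply cont_at_plus|].
  intros w. rewrite (H w), (K w). ring.
Qed.

Lemma cderiv_mult f g z l m : cderiv f z l -> cderiv g z m ->
  cderiv (fun w => f w * g w) z (l * g z + f z * m).
Proof.
  intros [q [Hq [Hc H]]] Hg. assert (Kg := cderiv_cont _ _ _ Hg). destruct Hg as [p [Hp [Kc K]]].
  exists (fun w => q w * g w + f z * p w).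
  split; [now rewrite Hq, Hp|]. split.
  - apply cont_at_plus; apply cont_at_mult; try easy. apply cont_at_const.
  - intros w. rewrite (H w), (K w). ring.
Qed.

Lemma cderiv_comp f g z l m : cderiv f (g z) l -> cderiv g z m -> cderiv (fun w => f (g w)) z (l * m).
Proof.
  intros [q [Hq [Hc H]]] Hg. assert (Kg := cderiv_cont _ _ _ Hg). destruct Hg as [p [Hp [Kc K]]].
  exists (fun w => q (g w) * p w). split; [now rewrite Hq, Hp|]. split.
  - apply cont_at_mult; [|easy]. now apply cont_at_comp.
  - intros w. rewrite (H (g w)). rewrite (K w) at 2. ring.
Qed.

Lemma cderiv_ext_loc f g z l r : 0 < r ->
  (forall w, Cmod (w - z) < r -> f w = g w) -> cderiv f z l -> cderiv g z l.
Proof.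
  intros Hr He Hf. apply cderiv_slope. apply cderiv_slope in Hf.
  assert (E : f z = g z).
  { apply He. replace (z - z) with (RtoC 0) by ring. now rewrite Cmod_0. }
  apply (ccont_ext_loc (slope f z l)) with (r := r); [easy| |easy].
  intros w Hw. unfold slope. destruct excluded_middle_informative; [easy|].
  now rewrite E, (He w Hw).
Qed.

Lemma cderiv_inv_id z : z <> 0 -> cderiv (fun w => / w) z (- / (z * z)).
Proof.
  intros Hz. assert (Hm : 0 < Cmod z) by now apply Cmod_gt_0.
  apply cderiv_slope.
  apply (ccont_ext_loc (fun w => - / (w * z))) with (r := Cmod z); [easy| |].
  - intros w Hw. assert (w <> 0).
    { intros ->. replace (0 - z) with (- z) in Hw by ring. rewrite Cmod_opp in Hw. lra. }
    unfold slope. destruct excluded_middle_informative as [->|Hn]; [easy|].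
    field. repeat split; auto. now apply Csub_neq_0.
  - apply cont_at_opp. apply cont_at_inv; [now apply Cmult_neq_0|].
    apply cont_at_mult; [apply ccont_id|apply cont_at_const].
Qed.

Lemma cdiff_const c z : cdiff (fun _ => c) z.
Proof. eexists; apply cderiv_const. Qed.
Lemma cdiff_id z : cdiff (fun w => w) z.
Proof. eexists; apply cderiv_id. Qed.
Lemma cdiff_plus f g z : cdiff f z -> cdiff g z -> cdiff (fun w => f w + g w) z.
Proof. intros [l H] [m K]. eexists; apply cderiv_plus; eauto. Qed.
Lemma cdiff_mult f g z : cdiff f z -> cdiff g z -> cdiff (fun w => f w * g w) z.
Proof. intros [l H] [m K]. eexists; apply cderiv_mult; eauto. Qed.
Lemma cdiff_comp f g z : cdiff f (g z) -> cdiff g z -> cdiff (fun w => f (g w)) z.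
Proof. intros [l H] [m K]. eexists; apply (cderiv_comp f); eauto. Qed.
Lemma cdiff_ext_loc f g z r : 0 < r ->
  (forall w, Cmod (w - z) < r -> f w = g w) -> cdiff f z -> cdiff g z.
Proof. intros Hr H [l K]. exists l. now apply (cderiv_ext_loc f g z l r). Qed.
Lemma cdiff_ext f g z : (forall w, f w = g w) -> cdiff f z -> cdiff g z.
Proof. intros H. apply cdiff_ext_loc with (r := 1%R); auto. lra. Qed.
Lemma cdiff_opp f z : cdiff f z -> cdiff (fun w => - f w) z.
Proof.
  intros H. apply (cdiff_ext (fun w => - (1) * f w)); [intros; ring|].
  apply cdiff_mult; [apply cdiff_const|easy].
Qed.
Lemma cdiff_minus f g z : cdiff f z -> cdiff g z -> cdiff (fun w => f w - g w) z.
Proof. intros H K. apply cdiff_plus; [easy|now apply cdiff_opp]. Qed.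
Lemma cdiff_inv f z : f z <> 0 -> cdiff f z -> cdiff (fun w => / f w) z.
Proof.
  intros H0 H. apply (cdiff_comp Cinv f); [|easy]. eexists; now apply cderiv_inv_id.
Qed.
Lemma cdiff_div f g z : g z <> 0 -> cdiff f z -> cdiff g z -> cdiff (fun w => f w / g w) z.
Proof. intros H0 H K. apply cdiff_mult; [easy|now apply cdiff_inv]. Qed.
Lemma cdiff_pow f z n : cdiff f z -> cdiff (fun w => f w ^ n) z.
Proof. intros H. induction n; simpl; [apply cdiff_const|now apply cdiff_mult]. Qed.
Lemma cdiff_slope_other f a l z : z <> a -> cdiff f z -> cdiff (slope f a l) z.
Proof.
  intros Hz Hf. assert (Hm : 0 < Cmod (z - a)) by now apply Cmod_gt_0, Csub_neq_0.
  apply (cdiff_ext_loc (fun w => (f w - f a) / (w - a))) with (r := Cmod (z - a)); [easy| |].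
  - intros w Hw. rewrite slope_other; [easy|]. intros ->. rewrite Cmod_sub_comm in Hw. lra.
  - apply cdiff_div; [now apply Csub_neq_0| |].
    + apply cdiff_minus; [easy|apply cdiff_const].
    + apply cdiff_minus; [apply cdiff_id|apply cdiff_const].
Qed.

End Derivative.

(** * Compactness, polar coordinates and the exponential *)

Lemma Cmod_le_Rabs (z : C) : Cmod z <= Rabs (fst z) + Rabs (snd z).
Proof.
  destruct z as [x y]. simpl. unfold Cmod. simpl.
  rewrite <- (sqrt_Rsqr (Rabs x + Rabs y)) by (generalize (Rabs_pos x) (Rabs_pos y); lra).
  apply sqrt_le_1_alt. unfold Rsqr.
  generalize (Rabs_pos x) (Rabs_pos y) (Rsqr_abs x) (Rsqr_abs y). unfold Rsqr. nra.
Qed.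

Lemma Rabs_fst_le (z : C) : Rabs (fst z) <= Cmod z.
Proof. eapply Rle_trans; [apply Rmax_l|apply Rmax_Cmod]. Qed.
Lemma Rabs_snd_le (z : C) : Rabs (snd z) <= Cmod z.
Proof. eapply Rle_trans; [apply Rmax_r|apply Rmax_Cmod]. Qed.

Lemma inv_INR_small (e : R) : 0 < e -> exists N : nat, forall n, (N <= n)%nat -> / (INR n + 1) < e.
Proof.
  intros He. destruct (archimed_cor1 e He) as [N [HN HN0]].
  exists N. intros n Hn. eapply Rle_lt_trans; [|apply HN].
  apply Rinv_le_contravar; [now apply lt_0_INR|]. apply le_INR in Hn. lra.
Qed.

Lemma bounded_adherent_R (u : nat -> R) (M : R) : (forall n, Rabs (u n) <= M) ->
  exists l : R, forall e N, 0 < e -> exists n, (N <= n)%nat /\ Rabs (u n - l) < e.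
Proof.
  intros H. destruct (Bolzano_Weierstrass u (fun x => - M <= x <= M)) as [l Hl].
  - apply compact_P3.
  - intros n. apply Rabs_le_between, H.
  - exists l. intros e N He. destruct (Hl (disc l (mkposreal e He)) N) as [p [Hp K]].
    + exists (mkposreal e He). intros x Hx. exact Hx.
    + exists p. split; [exact Hp|exact K].
Qed.

(** Two passes: choose indices [S n] at which the real parts are within [1/(n+1)] of a cluster value
    [x], then take a cluster value [y] of the imaginary parts along these indices. *)
Lemma bounded_adherent (u : nat -> C) (M : R) : (forall n, Cmod (u n) <= M) ->
  exists l : C, forall e N, 0 < e -> exists n, (N <= n)%nat /\ Cmod (u n - l) < e.
Proof.
  intros H. destruct (bounded_adherent_R (fun n => fst (u n)) M) as [x Hx].
  { intros n. eapply Rle_trans; [apply Rabs_fst_le|apply H]. }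
  assert (S : forall n : nat, {p : nat | (n <= p)%nat /\ Rabs (fst (u p) - x) < / (INR n + 1)}).
  { intros n. apply constructive_indefinite_description. apply Hx.
    apply Rinv_0_lt_compat. generalize (pos_INR n). lra. }
  destruct (bounded_adherent_R (fun n => snd (u (proj1_sig (S n)))) M) as [y Hy].
  { intros n. eapply Rle_trans; [apply Rabs_snd_le|apply H]. }
  exists (x, y). intros e N He.
  destruct (inv_INR_small (e / 2)%R) as [N1 HN1]; [lra|].
  destruct (Hy (e / 2)%R (Nat.max N N1)) as [n [Hn K]]; [lra|].
  destruct (S n) as [p [Hp Kp]]. simpl in K. exists p. split; [lia|].
  eapply Rle_lt_trans; [apply Cmod_le_Rabs|]. simpl.
  specialize (HN1 n ltac:(lia)). unfold Rminus in *. lra.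
Qed.

Definition compact_C (K : C -> Prop) : Prop :=
  (exists M, forall z, K z -> Cmod z <= M) /\
  (forall z, (forall e, 0 < e -> exists w, K w /\ Cmod (w - z) < e) -> K z).

(** Stands in for finite subcovers: points of [K] where [Q] fails at radius [1/(n+1)] would cluster
    at a point of [K], whose own radius refutes them. Uniform continuity, boundedness and distance
    from [0] are instances. *)
Lemma compact_uniform (K : C -> Prop) (Q : R -> C -> Prop) : compact_C K ->
  (forall d1 d2 z, d1 <= d2 -> Q d2 z -> Q d1 z) ->
  (forall z, K z -> exists dl, 0 < dl /\ forall w, K w -> Cmod (w - z) < dl -> Q dl w) ->
  exists dl, 0 < dl /\ forall w, K w -> Q dl w.
Proof.
  intros [[M HM] Hcl] Hmon Hloc. apply NNPP. intros Hno.
  assert (S : forall n : nat, {w : C | K w /\ ~ Q (/ (INR n + 1))%R w}).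
  { intros n. apply constructive_indefinite_description. apply NNPP. intros Hn.
    apply Hno. exists (/ (INR n + 1))%R. split.
    - apply Rinv_0_lt_compat. generalize (pos_INR n). lra.
    - intros w Hw. apply NNPP. intros Hq. apply Hn. now exists w. }
  destruct (bounded_adherent (fun n => proj1_sig (S n)) M) as [z Hz].
  { intros n. destruct (S n) as [w [Hw Hnq]]. now apply HM. }
  assert (Kz : K z).
  { apply Hcl. intros e He. destruct (Hz e O He) as [n [_ Hn]].
    destruct (S n) as [w [Hw Hnq]]. simpl in Hn. now exists w. }
  destruct (Hloc z Kz) as [dl [Hd Hq]].
  destruct (inv_INR_small dl Hd) as [N HN].
  destruct (Hz dl N Hd) as [n [Hn Hc]].
  specialize (HN n Hn). destruct (S n) as [w [Hw Hnq]]. simpl in Hc.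
  apply Hnq. apply Hmon with dl; [lra|]. now apply Hq.
Qed.

Lemma compact_uniform_cont (K : C -> Prop) (h : C -> C) : compact_C K ->
  (forall z, K z -> ccont h z) -> forall e, 0 < e -> exists dl, 0 < dl /\
  forall z w, K z -> Cmod (w - z) < dl -> Cmod (h w - h z) < e.
Proof.
  intros HK Hh e He.
  destruct (compact_uniform K (fun dl z => forall w, Cmod (w - z) < dl -> Cmod (h w - h z) < e))
    as [dl [Hd H]]; [easy| | |].
  - intros d1 d2 z Hle Hq w Hw. apply Hq. lra.
  - intros z Kz. destruct (Hh z Kz (e / 2)%R) as [d [Hd H]]; [lra|].
    exists (d / 2)%R. split; [lra|]. intros w _ Hw v Hv.
    assert (Cmod (h w - h z) < e / 2) by (apply H; unfold cdist; lra).
    assert (Cmod (h v - h z) < e / 2).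
    { apply H. unfold cdist. generalize (Cmod_sub_triangle v w z). lra. }
    generalize (Cmod_sub_triangle (h v) (h z) (h w)). rewrite (Cmod_sub_comm (h z) (h w)). lra.
  - exists dl. split; [easy|]. intros z w Kz. now apply H.
Qed.

Lemma compact_bounded (K : C -> Prop) (h : C -> C) : compact_C K ->
  (forall z, K z -> ccont h z) -> exists M, 0 < M /\ forall z, K z -> Cmod (h z) <= M.
Proof.
  intros HK Hh.
  (* The radius doubles as the reciprocal of the bound, which makes the property monotone in
     [dl]. *)
  destruct (compact_uniform K (fun dl z => dl * Cmod (h z) <= 1)%R) as [dl [Hd H]]; [easy| | |].
  - intros d1 d2 z Hle Hq. eapply Rle_trans; [|apply Hq].
    apply Rmult_le_compat_r; [apply Cmod_ge_0|easy].
  - intros z Kz. destruct (Hh z Kz 1%R) as [d [Hd H]]; [lra|].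
    assert (P := Cmod_ge_0 (h z)).
    exists (Rmin d (/ (Cmod (h z) + 1))). split.
    { apply Rmin_pos; [easy|]. apply Rinv_0_lt_compat. lra. }
    intros w _ Hw.
    assert (Cmod (h w - h z) < 1) by (apply H; unfold cdist; eapply Rlt_le_trans; [apply Hw|apply Rmin_l]).
    assert (T := Cmod_triangle_rev (h w) (h z)).
    apply Rle_trans with (/ (Cmod (h z) + 1) * (Cmod (h z) + 1))%R.
    + apply Rmult_le_compat; [|apply Cmod_ge_0|apply Rmin_r|lra].
      apply Rmin_glb; [lra|]. left. apply Rinv_0_lt_compat. lra.
    + right. field. lra.
  - exists (/ dl)%R. split; [now apply Rinv_0_lt_compat|]. intros z Kz.
    apply Rmult_le_reg_l with dl; [easy|]. rewrite Rinv_r by lra. now apply H.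
Qed.

Lemma compact_away_from_0 (K : C -> Prop) (h : C -> C) : compact_C K ->
  (forall z, K z -> ccont h z /\ h z <> 0) -> exists m, 0 < m /\ forall z, K z -> m <= Cmod (h z).
Proof.
  intros HK Hh.
  apply (compact_uniform K (fun dl z => dl <= Cmod (h z))); [easy| |].
  - intros d1 d2 z. lra.
  - intros z Kz. destruct (Hh z Kz) as [Hc H0].
    assert (Hm : 0 < Cmod (h z)) by now apply Cmod_gt_0.
    destruct (Hc (Cmod (h z) / 2)%R) as [d [Hd H]]; [lra|].
    exists (Rmin d (Cmod (h z) / 2)). split; [apply Rmin_pos; lra|].
    intros w _ Hw.
    assert (Cmod (h w - h z) < Cmod (h z) / 2)
      by (apply H; unfold cdist; eapply Rlt_le_trans; [apply Hw|apply Rmin_l]).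
    rewrite Cmod_sub_comm in H1. generalize (Cmod_triangle_rev (h z) (h w)) (Rmin_r d (Cmod (h z) / 2)). lra.
Qed.

Lemma Cmod_adherent (z : C) (e : R) (w : C) : Cmod (w - z) < e -> Rabs (Cmod w - Cmod z) < e.
Proof.
  intros H. apply Rabs_lt_between.
  generalize (Cmod_triangle_rev w z) (Cmod_triangle_rev z w). rewrite (Cmod_sub_comm z w). lra.
Qed.

Lemma compact_disk (r : R) : compact_C (fun z => Cmod z <= r).
Proof.
  split; [now exists r|]. intros z H. apply le_epsilon. intros e He.
  destruct (H e He) as [w [Hw K]]. apply Cmod_adherent, Rabs_lt_between in K. lra.
Qed.

Lemma compact_circle (c : C) (r : R) : compact_C (fun z => Cmod (z - c) = r).
Proof.
  split.
  - exists (r + Cmod c)%R. intros z Hz. generalize (Cmod_triangle_rev z c). lra.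
  - intros z H. apply Rle_antisym; apply le_epsilon; intros e He;
    destruct (H e He) as [w [Hw K]];
    replace (w - z) with ((w - c) - (z - c)) in K by ring;
    apply Cmod_adherent, Rabs_lt_between in K; lra.
Qed.

Definition cis (t : R) : C := (cos t, sin t).

Lemma Cmod_cis t : Cmod (cis t) = 1%R.
Proof.
  unfold Cmod, cis. simpl. transitivity (sqrt 1); [|apply sqrt_1]. f_equal.
  generalize (sin2_cos2 t). unfold Rsqr. lra.
Qed.

Lemma Cmod_scal_cis r t : 0 <= r -> Cmod (r * cis t) = r.
Proof. intros H. rewrite Cmod_mult, Cmod_cis, Cmod_RtoC_pos by easy. ring. Qed.

Lemma unit_circle_cis (x y : R) : (x * x + y * y = 1)%R -> exists t, cos t = x /\ sin t = y.
Proof.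
  intros H. assert (Hx : -1 <= x <= 1) by nra.
  assert (Hs : sin (acos x) = Rabs y).
  { rewrite sin_acos by easy. rewrite <- sqrt_Rsqr_abs. f_equal. unfold Rsqr. lra. }
  destruct (Rle_dec 0 y) as [Hy|Hy].
  - exists (acos x). split; [now apply cos_acos|]. now rewrite Hs, Rabs_pos_eq.
  - exists (- acos x)%R. rewrite cos_neg, sin_neg, Hs, Rabs_left by lra.
    split; [now apply cos_acos|ring].
Qed.

Lemma polar (z : C) : exists t, z = Cmod z * cis t.
Proof.
  destruct (classic (z = 0)) as [->|H].
  - exists 0%R. rewrite Cmod_0. ring.
  - assert (Hm : 0 < Cmod z) by now apply Cmod_gt_0.
    destruct (unit_circle_cis (fst z / Cmod z) (snd z / Cmod z)) as [t [Hc Hs]].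
    + generalize (Cmod2_alt z). unfold Re, Im. intros E.
      apply Rmult_eq_reg_r with (Cmod z ^ 2)%R; [|apply pow_nonzero; lra].
      rewrite Rmult_1_l.
      transitivity (fst z ^ 2 + snd z ^ 2)%R; [field; lra|now symmetry].
    + exists t. unfold cis. rewrite Hc, Hs. destruct z as [x y]. set (m := Cmod (x, y)) in *.
      unfold RtoC, Cmult. simpl. f_equal; field; lra.
Qed.

Definition cexp (s : C) : C := exp (fst s) * cis (snd s).

Lemma cexp_plus s t : cexp (s + t) = cexp s * cexp t.
Proof.
  unfold cexp, cis. destruct s as [a b], t as [c d]. simpl.
  rewrite exp_plus, cos_plus, sin_plus. unfold RtoC, Cmult. simpl. f_equal; ring.
Qed.

Lemma is_derive_small (f : R -> R) (l : R) : is_derive f 0 l -> forall e, 0 < e ->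
  exists d, 0 < d /\ forall x, Rabs x < d -> (Rabs (f x - f 0 - x * l) <= e * Rabs x)%R.
Proof.
  intros [_ H] e He. specialize (H 0%R (fun P HP => HP) (mkposreal e He)).
  destruct H as [d Hd]. exists d. split; [apply cond_pos|]. intros x Hx.
  assert (B : ball (0%R : R_UniformSpace) d x).
  { unfold ball; simpl. unfold AbsRing_ball, abs, minus, plus, opp; simpl. now rewrite Ropp_0, Rplus_0_r. }
  specialize (Hd x B). simpl in Hd.
  unfold norm, scal, minus, plus, opp in Hd; simpl in Hd. unfold abs, mult in Hd; simpl in Hd.
  rewrite Ropp_0, Rplus_0_r in Hd. exact Hd.
Qed.

Lemma cderiv_cexp_0 : cderiv cexp 0 1.
Proof.
  assert (E1 := is_derive_small exp 1). assert (E2 := is_derive_small cos 0).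
  assert (E3 := is_derive_small sin 1).
  specialize (E1 ltac:(replace 1%R with (exp 0) by apply exp_0; apply is_derive_Reals, derivable_pt_lim_exp)).
  specialize (E2 ltac:(replace 0%R with (- sin 0)%R at 2 by (rewrite sin_0; ring); apply is_derive_Reals, derivable_pt_lim_cos)).
  specialize (E3 ltac:(replace 1%R with (cos 0) by apply cos_0; apply is_derive_Reals, derivable_pt_lim_sin)).
  assert (C0 : cexp 0 = 1).
  { unfold cexp, cis. simpl. rewrite exp_0, cos_0, sin_0. unfold RtoC, Cmult; simpl. f_equal; ring. }
  apply cderiv_slope. intros e He. rewrite slope_same.
  destruct (E1 (Rmin 1 (e / 16))) as [d1 [Hd1 H1]]; [apply Rmin_pos; lra|].
  destruct (E2 (Rmin 1 (e / 16))) as [d2 [Hd2 H2]]; [apply Rmin_pos; lra|].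
  destruct (E3 (Rmin 1 (e / 16))) as [d3 [Hd3 H3]]; [apply Rmin_pos; lra|].
  exists (Rmin (Rmin 1 (e / 16)) (Rmin d1 (Rmin d2 d3))).
  assert (Hd0 : 0 < Rmin 1 (e / 16)) by (apply Rmin_pos; lra).
  split; [repeat apply Rmin_pos; lra|]. intros w Hw. unfold cdist in Hw.
  replace (w - 0) with w in Hw by ring.
  destruct (classic (w = 0)) as [->|Hn].
  { rewrite slope_same. replace (1 - 1) with (RtoC 0) by ring. now rewrite Cmod_0. }
  rewrite slope_other by easy. rewrite C0.
  assert (Hm : 0 < Cmod w) by now apply Cmod_gt_0.
  replace ((cexp w - 1) / (w - 0) - 1) with ((cexp w - 1 - w) / w) by (field; auto).
  rewrite Cmod_div by easy. apply Rle_lt_trans with (e / 2)%R; [|lra].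
  apply Rmult_le_reg_r with (Cmod w); [easy|].
  unfold Rdiv at 1. rewrite Rmult_assoc, Rinv_l, Rmult_1_r by lra.
  eapply Rle_trans; [apply Cmod_le_Rabs|].
  destruct w as [x y].
  assert (X := Rabs_fst_le (x, y)). assert (Y := Rabs_snd_le (x, y)). simpl in X, Y.
  set (m := Cmod (x, y)) in *.
  assert (M0 := Rmin_l (Rmin 1 (e / 16)) (Rmin d1 (Rmin d2 d3))).
  assert (M1 := Rmin_r (Rmin 1 (e / 16)) (Rmin d1 (Rmin d2 d3))).
  assert (M2 := Rmin_l d1 (Rmin d2 d3)). assert (M3 := Rmin_r d1 (Rmin d2 d3)).
  assert (M4 := Rmin_l d2 d3). assert (M5 := Rmin_r d2 d3).
  specialize (H1 x ltac:(lra)). specialize (H2 y ltac:(lra)). specialize (H3 y ltac:(lra)).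
  rewrite exp_0 in H1. rewrite cos_0 in H2. rewrite sin_0 in H3.
  assert (L1 := Rmin_l 1 (e / 16)). assert (L2 := Rmin_r 1 (e / 16)).
  set (k := Rmin 1 (e / 16)) in *.
  simpl.
  (* The real and imaginary parts of [cexp w - 1 - w] are regrouped around the first-order
     remainders of [exp], [cos] and [sin]. Seven terms result, each at most [k * m] with
     [k <= e / 16], and [7/16 < 1/2]. *)
  replace (exp x * cos y - 0 * sin y + - (1) + - x)%R with
    ((exp x - 1 - x * 1) * cos y + x * (cos y - 1 - y * 0) + (cos y - 1 - y * 0))%R by ring.
  replace (exp x * sin y + 0 * cos y + - 0 + - y)%R with
    ((exp x - 1 - x * 1) * sin y + x * (sin y - 0 - y * 1) + x * y + (sin y - 0 - y * 1))%R by ring.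
  set (A := (exp x - 1 - x * 1)%R) in *. set (B := (cos y - 1 - y * 0)%R) in *.
  set (D := (sin y - 0 - y * 1)%R) in *.
  assert (Pm : 0 <= m) by lra.
  assert (KA : Rabs A <= k * m) by (eapply Rle_trans; [apply H1|]; apply Rmult_le_compat_l; lra).
  assert (KB : Rabs B <= k * m) by (eapply Rle_trans; [apply H2|]; apply Rmult_le_compat_l; lra).
  assert (KD : Rabs D <= k * m) by (eapply Rle_trans; [apply H3|]; apply Rmult_le_compat_l; lra).
  assert (Kx : Rabs x <= 1) by lra.
  assert (T1 : Rabs (A * cos y) <= k * m).
  { rewrite Rabs_mult. rewrite <- (Rmult_1_r (k * m)).
    apply Rmult_le_compat; try apply Rabs_pos; [easy|]. apply Rabs_le, COS_bound. }
  assert (T2 : Rabs (x * B) <= k * m).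
  { rewrite Rabs_mult. rewrite <- (Rmult_1_l (k * m)). apply Rmult_le_compat; try apply Rabs_pos; easy. }
  assert (T3 : Rabs (A * sin y) <= k * m).
  { rewrite Rabs_mult. rewrite <- (Rmult_1_r (k * m)).
    apply Rmult_le_compat; try apply Rabs_pos; [easy|]. apply Rabs_le, SIN_bound. }
  assert (T4 : Rabs (x * D) <= k * m).
  { rewrite Rabs_mult. rewrite <- (Rmult_1_l (k * m)). apply Rmult_le_compat; try apply Rabs_pos; easy. }
  assert (T5 : Rabs (x * y) <= k * m).
  { rewrite Rabs_mult. apply Rmult_le_compat; try apply Rabs_pos; lra. }
  assert (U1 := Rabs_triang (A * cos y + x * B) B). assert (U2 := Rabs_triang (A * cos y) (x * B)).
  assert (U3 := Rabs_triang (A * sin y + x * D + x * y) D).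
  assert (U4 := Rabs_triang (A * sin y + x * D) (x * y)).
  assert (U5 := Rabs_triang (A * sin y) (x * D)).
  assert (k * m <= e / 16 * m)%R by (apply Rmult_le_compat_r; lra).
  assert (0 <= e * m)%R by (apply Rmult_le_pos; lra). lra.
Qed.

Lemma cdiff_cexp (s : C) : cdiff cexp s.
Proof.
  apply (cdiff_ext (fun w => cexp s * cexp (w - s))).
  { intros w. rewrite <- cexp_plus. f_equal. ring. }
  apply cdiff_mult; [apply cdiff_const|].
  apply (cdiff_comp cexp (fun w => w - s)).
  - replace (s - s) with (RtoC 0) by ring. eexists; apply cderiv_cexp_0.
  - apply cdiff_minus; [apply cdiff_id|apply cdiff_const].
Qed.

(** * Integrals over rectangles *)

Definition cint (F : R -> C) (a b : R) : C :=
  (RInt (fun t => fst (F t)) a b, RInt (fun t => snd (F t)) a b).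

Lemma rcont_components (F : R -> C) (t : R) : rcont F t ->
  continuous (fun s => fst (F s)) t /\ continuous (fun s => snd (F s)) t.
Proof.
  intros H. split; apply continuity_pt_filterlim; apply continuity_pt_locally; intros e;
  destruct (H e (cond_pos e)) as [d [Hd K]]; exists (mkposreal d Hd); intros s Hs;
  specialize (K s Hs).
  - eapply Rle_lt_trans; [|apply K]. apply (Rabs_fst_le (F s - F t)).
  - eapply Rle_lt_trans; [|apply K]. apply (Rabs_snd_le (F s - F t)).
Qed.

Section Integral.
Variables (a b : R).
Hypothesis (Hab : a <= b).
Implicit Types F G : R -> C.

Lemma rcont_ex_RInt F : (forall t, a <= t <= b -> rcont F t) ->
  ex_RInt (fun s => fst (F s)) a b /\ ex_RInt (fun s => snd (F s)) a b.
Proof.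
  intros H. split; apply (ex_RInt_continuous (V := R_CompleteNormedModule));
  rewrite Rmin_left, Rmax_right by easy; intros t Ht; now apply rcont_components, H.
Qed.

Lemma cint_ext F G : (forall t, a <= t <= b -> F t = G t) -> cint F a b = cint G a b.
Proof.
  intros H. unfold cint. f_equal; apply RInt_ext; rewrite Rmin_left, Rmax_right by easy;
  intros t Ht; rewrite H; auto; lra.
Qed.

Lemma cint_plus F G : (forall t, a <= t <= b -> rcont F t) -> (forall t, a <= t <= b -> rcont G t) ->
  cint (fun t => F t + G t) a b = cint F a b + cint G a b.
Proof.
  intros HF HG. destruct (rcont_ex_RInt F HF) as [F1 F2]. destruct (rcont_ex_RInt G HG) as [G1 G2].
  unfold cint, Cplus. simpl.
  f_equal; now apply (RInt_plus (V := R_CompleteNormedModule)).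
Qed.

Lemma cint_scal F (c : C) : (forall t, a <= t <= b -> rcont F t) ->
  cint (fun t => c * F t) a b = c * cint F a b.
Proof.
  intros HF. destruct (rcont_ex_RInt F HF) as [F1 F2]. destruct c as [x y].
  unfold cint, Cmult. simpl. f_equal; apply is_RInt_unique.
  - apply (is_RInt_minus (V := R_NormedModule)); apply (is_RInt_scal (V := R_NormedModule));
    now apply (RInt_correct (V := R_CompleteNormedModule)).
  - apply (is_RInt_plus (V := R_NormedModule)); apply (is_RInt_scal (V := R_NormedModule));
    now apply (RInt_correct (V := R_CompleteNormedModule)).
Qed.

Lemma cint_minus F G : (forall t, a <= t <= b -> rcont F t) -> (forall t, a <= t <= b -> rcont G t) ->
  cint (fun t => F t - G t) a b = cint F a b - cint G a b.
Proof.
  intros HF HG. rewrite (cint_ext _ (fun t => F t + (- (1)) * G t)) by (intros; ring).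
  rewrite cint_plus, cint_scal; try easy; [ring|].
  intros t Ht. apply cont_at_mult; [apply cont_at_const|auto].
Qed.

Lemma cint_affine (c0 c1 : C) :
  cint (fun t => c0 + c1 * t) a b = c0 * (b - a) + c1 * ((b * b - a * a) / 2).
Proof.
  assert (E : forall x y : R, RInt (fun t => x + y * t)%R a b = (x * (b - a) + y * ((b * b - a * a) / 2))%R).
  { intros x y. apply is_RInt_unique.
    replace (x * (b - a) + y * ((b * b - a * a) / 2))%R
      with (minus (x * b + y * (b * b) / 2) (x * a + y * (a * a) / 2))%R
      by (unfold minus, plus, opp; simpl; field).
    apply (is_RInt_derive (V := R_CompleteNormedModule) (fun t => x * t + y * (t * t) / 2)%R).
    - intros t _. auto_derive; [easy|field].
    - intros t _. apply continuity_pt_filterlim. apply continuity_pt_plus.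
      + now apply continuity_pt_const.
      + apply continuity_pt_mult; [now apply continuity_pt_const|apply derivable_continuous_pt, derivable_pt_id]. }
  destruct c0 as [x y], c1 as [u v]. unfold cint.
  replace (RInt (fun t => fst ((x, y) + (u, v) * t)) a b) with (RInt (fun t => x + u * t)%R a b)
    by (apply RInt_ext; intros; simpl; ring).
  replace (RInt (fun t => snd ((x, y) + (u, v) * t)) a b) with (RInt (fun t => y + v * t)%R a b)
    by (apply RInt_ext; intros; simpl; ring).
  rewrite !E. unfold RtoC, Cmult, Cplus, Cminus, Copp, Cdiv, Cinv. simpl. f_equal; field; try lra.
Qed.

Lemma cint_const (c : C) : cint (fun _ => c) a b = c * (b - a).
Proof.
  rewrite (cint_ext _ (fun t => c + 0 * t)) by (intros; ring). rewrite cint_affine. ring.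
Qed.

(** The factor 2 comes from bounding the real and imaginary parts separately. Later estimates
    tolerate it, and the maximum principle removes it by taking powers. *)
Lemma cint_bound F (M : R) : (forall t, a <= t <= b -> rcont F t) ->
  (forall t, a <= t <= b -> Cmod (F t) <= M) -> Cmod (cint F a b) <= 2 * M * (b - a).
Proof.
  intros HF HM. destruct (rcont_ex_RInt F HF) as [F1 F2].
  eapply Rle_trans; [apply Cmod_le_Rabs|]. simpl.
  assert (Rabs (RInt (fun t => fst (F t)) a b) <= (b - a) * M).
  { apply abs_RInt_le_const; try easy. intros t Ht. eapply Rle_trans; [apply Rabs_fst_le|auto]. }
  assert (Rabs (RInt (fun t => snd (F t)) a b) <= (b - a) * M).
  { apply abs_RInt_le_const; try easy. intros t Ht. eapply Rle_trans; [apply Rabs_snd_le|auto]. }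
  lra.
Qed.

End Integral.

Lemma cint_chasles (F : R -> C) (a b c : R) : a <= b -> b <= c ->
  (forall t, a <= t <= c -> rcont F t) -> cint F a c = cint F a b + cint F b c.
Proof.
  intros H1 H2 HF.
  destruct (rcont_ex_RInt a b H1 F) as [F1 F2]; [intros; apply HF; lra|].
  destruct (rcont_ex_RInt b c H2 F) as [G1 G2]; [intros; apply HF; lra|].
  unfold cint, Cplus. simpl.
  f_equal; symmetry; now apply (RInt_Chasles (V := R_CompleteNormedModule)).
Qed.

(* The integral of [h dz] around the boundary of [[a,b] x [c,d]]. *)
Definition rect_int (h : C -> C) (a b c d : R) : C :=
  cint (fun x => h (x, c)) a b - cint (fun x => h (x, d)) a b
  + Ci * (cint (fun y => h (b, y)) c d - cint (fun y => h (a, y)) c d).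

Definition in_rect (a b c d : R) (z : C) : Prop := a <= fst z <= b /\ c <= snd z <= d.

Lemma rcont_horizontal (h : C -> C) (x y : R) : ccont h (x, y) -> rcont (fun t => h (t, y)) x.
Proof.
  intros H. apply (cont_at_comp _ h (fun t => (t, y))); [easy|].
  intros e He. exists e. split; [easy|]. intros t Ht.
  eapply Rle_lt_trans; [apply Cmod_le_Rabs|]. simpl. unfold rdist in Ht.
  replace (y + - y)%R with 0%R by ring. rewrite Rabs_R0. unfold Rminus in Ht. lra.
Qed.

Lemma rcont_vertical (h : C -> C) (x y : R) : ccont h (x, y) -> rcont (fun t => h (x, t)) y.
Proof.
  intros H. apply (cont_at_comp _ h (fun t => (x, t))); [easy|].
  intros e He. exists e. split; [easy|]. intros t Ht.
  eapply Rle_lt_trans; [apply Cmod_le_Rabs|]. simpl. unfold rdist in Ht.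
  replace (x + - x)%R with 0%R by ring. rewrite Rabs_R0. unfold Rminus in Ht. lra.
Qed.

Ltac rect_cont :=
  intros; first [apply rcont_horizontal | apply rcont_vertical];
  match goal with H : _ |- _ => apply H; split; simpl; lra end.

Lemma rect_int_split_x (h : C -> C) (a b c d m : R) : a <= m <= b -> c <= d ->
  (forall z, in_rect a b c d z -> ccont h z) ->
  rect_int h a b c d = rect_int h a m c d + rect_int h m b c d.
Proof.
  intros Hm Hcd H. unfold rect_int.
  rewrite (cint_chasles (fun x => h (x, c)) a m b), (cint_chasles (fun x => h (x, d)) a m b);
    try lra; try rect_cont. ring.
Qed.

Lemma rect_int_split_y (h : C -> C) (a b c d m : R) : a <= b -> c <= m <= d ->
  (forall z, in_rect a b c d z -> ccont h z) ->
  rect_int h a b c d = rect_int h a b c m + rect_int h a b m d.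
Proof.
  intros Hm Hcd H. unfold rect_int.
  rewrite (cint_chasles (fun x => h (a, x)) c m d), (cint_chasles (fun x => h (b, x)) c m d);
    try lra; try rect_cont. ring.
Qed.

(** The case of Goursat's theorem that is computed by hand; it allows the tangent map to be
    subtracted from [h] without changing the integral. *)
Lemma rect_int_affine (c0 c1 : C) (a b c d : R) : a <= b -> c <= d ->
  rect_int (fun z => c0 + c1 * z) a b c d = 0.
Proof.
  intros Hab Hcd. unfold rect_int.
  assert (E : forall x y : R, (x, y) = x + Ci * y).
  { intros x y. unfold Ci, RtoC, Cmult, Cplus. simpl. f_equal; ring. }
  rewrite (cint_ext a b Hab (fun x => c0 + c1 * (x, c)) (fun x => (c0 + c1 * (Ci * c)) + c1 * x))
    by (intros; rewrite E; ring).
  rewrite (cint_ext a b Hab (fun x => c0 + c1 * (x, d)) (fun x => (c0 + c1 * (Ci * d)) + c1 * x))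
    by (intros; rewrite E; ring).
  rewrite (cint_ext c d Hcd (fun y => c0 + c1 * (b, y)) (fun y => (c0 + c1 * b) + (c1 * Ci) * y))
    by (intros; rewrite E; ring).
  rewrite (cint_ext c d Hcd (fun y => c0 + c1 * (a, y)) (fun y => (c0 + c1 * a) + (c1 * Ci) * y))
    by (intros; rewrite E; ring).
  rewrite !cint_affine by easy. field.
Qed.

Lemma rect_int_ext (g h : C -> C) (a b c d : R) : a <= b -> c <= d ->
  (forall z, g z = h z) -> rect_int g a b c d = rect_int h a b c d.
Proof.
  intros Hab Hcd E. unfold rect_int.
  rewrite (cint_ext a b Hab (fun x => g (x, c)) (fun x => h (x, c))) by auto.
  rewrite (cint_ext a b Hab (fun x => g (x, d)) (fun x => h (x, d))) by auto.
  rewrite (cint_ext c d Hcd (fun y => g (a, y)) (fun y => h (a, y))) by auto.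
  rewrite (cint_ext c d Hcd (fun y => g (b, y)) (fun y => h (b, y))) by auto.
  reflexivity.
Qed.

Lemma rect_int_plus (g h : C -> C) (a b c d : R) : a <= b -> c <= d ->
  (forall z, in_rect a b c d z -> ccont g z) -> (forall z, in_rect a b c d z -> ccont h z) ->
  rect_int (fun z => g z + h z) a b c d = rect_int g a b c d + rect_int h a b c d.
Proof.
  intros Hab Hcd Hg Hh. unfold rect_int.
  rewrite 2!(cint_plus a b), 2!(cint_plus c d); try easy; try rect_cont. ring.
Qed.

Lemma rect_int_bound (h : C -> C) (a b c d M : R) : a <= b -> c <= d ->
  (forall z, in_rect a b c d z -> ccont h z) ->
  (forall z, in_rect a b c d z -> Cmod (h z) <= M) ->
  Cmod (rect_int h a b c d) <= 4 * M * ((b - a) + (d - c)).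
Proof.
  intros Hab Hcd H HM. unfold rect_int.
  assert (B1 : Cmod (cint (fun x => h (x, c)) a b) <= 2 * M * (b - a)).
  { apply cint_bound; [lra|rect_cont|]. intros; apply HM; split; simpl; lra. }
  assert (B2 : Cmod (cint (fun x => h (x, d)) a b) <= 2 * M * (b - a)).
  { apply cint_bound; [lra|rect_cont|]. intros; apply HM; split; simpl; lra. }
  assert (B3 : Cmod (cint (fun x => h (b, x)) c d) <= 2 * M * (d - c)).
  { apply cint_bound; [lra|rect_cont|]. intros; apply HM; split; simpl; lra. }
  assert (B4 : Cmod (cint (fun x => h (a, x)) c d) <= 2 * M * (d - c)).
  { apply cint_bound; [lra|rect_cont|]. intros; apply HM; split; simpl; lra. }
  eapply Rle_trans; [apply Cmod_triangle|].
  rewrite Cmod_mult, Cmod_Ci, Rmult_1_l.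
  assert (T : forall u v, Cmod (u - v) <= Cmod u + Cmod v).
  { intros u v. unfold Cminus. rewrite <- (Cmod_opp v). apply Cmod_triangle. }
  eapply Rle_trans; [apply Rplus_le_compat; apply T|]. lra.
Qed.

(** * Goursat's theorem *)

Lemma half_pow_pos (n : nat) : 0 < (/ 2) ^ n.
Proof. apply pow_lt. lra. Qed.

Lemma half_pow_small (e : R) : 0 < e -> exists n, (/ 2) ^ n < e.
Proof.
  intros He. destruct (pow_lt_1_zero (/ 2)) with (y := e) as [N HN]; [rewrite Rabs_pos_eq; lra|lra|].
  exists N. specialize (HN N (Nat.le_refl N)). rewrite Rabs_pos_eq in HN; [easy|].
  left. apply half_pow_pos.
Qed.

Section Goursat.
Variables (h : C -> C) (a b c d : R).
Hypothesis (Hab : a <= b) (Hcd : c <= d).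
Hypothesis (Hh : forall z, in_rect a b c d z -> cdiff h z).

Let L := (b - a)%R.
Let M := (d - c)%R.
(** A rectangle of the [n]-th bisection is coded by its lower left corner [p] alone, since its sides
    are [L / 2^n] and [M / 2^n]. *)
Let sub (n : nat) (p : C) (z : C) : Prop :=
  in_rect (fst p) (fst p + L * (/ 2) ^ n) (snd p) (snd p + M * (/ 2) ^ n) z.
Let J (n : nat) (p : C) : C :=
  rect_int h (fst p) (fst p + L * (/ 2) ^ n) (snd p) (snd p + M * (/ 2) ^ n).
Let inside (n : nat) (p : C) : Prop := forall z, sub n p z -> in_rect a b c d z.

(** The shared edges cancel, so the integrals over the four quarters add up to the whole, and one
    quarter carries at least a fourth of the modulus. *)
Local Lemma goursat_quarter (n : nat) (p : C) (eta : R) :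
  inside n p -> eta <= Cmod (J n p) ->
  exists p', (forall z, sub (S n) p' z -> sub n p z) /\ eta / 4 <= Cmod (J (S n) p').
Proof.
  intros Hin He. destruct p as [x y]. simpl in *.
  assert (P := half_pow_pos n).
  set (u := (L * (/ 2) ^ n)%R) in *. set (v := (M * (/ 2) ^ n)%R) in *.
  assert (Hu : 0 <= u) by (apply Rmult_le_pos; unfold L; lra).
  assert (Hv : 0 <= v) by (apply Rmult_le_pos; unfold M; lra).
  assert (Eu : (L * (/ 2) ^ S n)%R = (u / 2)%R) by (unfold u; simpl; field).
  assert (Ev : (M * (/ 2) ^ S n)%R = (v / 2)%R) by (unfold v; simpl; field).
  assert (Hc : forall z, sub n (x, y) z -> ccont h z).
  { intros z Hz. now apply cdiff_cont, Hh, Hin. }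
  assert (D : J n (x, y) = (J (S n) (x, y) + J (S n) (x, (y + v / 2)%R)) +
     (J (S n) ((x + u / 2)%R, y) + J (S n) ((x + u / 2)%R, (y + v / 2)%R))).
  { unfold J, fst, snd. rewrite Eu, Ev. fold u v.
    replace (x + u / 2 + u / 2)%R with (x + u)%R by field.
    replace (y + v / 2 + v / 2)%R with (y + v)%R by field.
    rewrite (rect_int_split_x h x (x + u) y (y + v) (x + u / 2)).
    - rewrite (rect_int_split_y h x (x + u / 2) y (y + v) (y + v / 2)).
      + rewrite (rect_int_split_y h (x + u / 2) (x + u) y (y + v) (y + v / 2)); [easy|lra|lra|].
        intros z [Z1 Z2]. apply Hc. split; simpl; fold u v; lra.
      + lra.
      + lra.
      + intros z [Z1 Z2]. apply Hc. split; simpl; fold u v; lra.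
    - lra.
    - lra.
    - exact Hc. }
  assert (T : forall z1 z2 z3 z4, Cmod ((z1 + z2) + (z3 + z4)) <= (Cmod z1 + Cmod z2) + (Cmod z3 + Cmod z4)).
  { intros. eapply Rle_trans; [apply Cmod_triangle|]. apply Rplus_le_compat; apply Cmod_triangle. }
  rewrite D in He. assert (K := Rle_trans _ _ _ He (T _ _ _ _)).
  assert (I : forall x' y', (x' = x \/ x' = x + u / 2)%R -> (y' = y \/ y' = y + v / 2)%R ->
     forall z, sub (S n) (x', y') z -> sub n (x, y) z).
  { intros x' y' Hx Hy z [Z1 Z2].
    rewrite Eu in Z1. rewrite Ev in Z2. cbn [fst snd] in Z1, Z2.
    split; simpl; fold u v; lra. }
  destruct (Rle_dec (eta / 4) (Cmod (J (S n) (x, y)))) as [W|W1]; [eexists; split; [|exact W]; apply I; auto|].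
  destruct (Rle_dec (eta / 4) (Cmod (J (S n) (x, (y + v / 2)%R)))) as [W|W2]; [eexists; split; [|exact W]; apply I; auto|].
  destruct (Rle_dec (eta / 4) (Cmod (J (S n) ((x + u / 2)%R, y)))) as [W|W3]; [eexists; split; [|exact W]; apply I; auto|].
  destruct (Rle_dec (eta / 4) (Cmod (J (S n) ((x + u / 2)%R, (y + v / 2)%R)))) as [W|W4]; [eexists; split; [|exact W]; apply I; auto|].
  lra.
Qed.

Lemma goursat_rect : rect_int h a b c d = 0.
Proof.
  apply NNPP. intros Hne. apply Cmod_gt_0 in Hne. set (eta := Cmod (rect_int h a b c d)) in *.
  (* Each state carries its invariants, so the choice of a quarter can be iterated by a plain
     [fix]. *)
  set (St := fun n => {p : C | inside n p /\ eta * (/ 4) ^ n <= Cmod (J n p)}).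
  assert (E0 : J 0 (a, c) = rect_int h a b c d).
  { unfold J, L, M. simpl. f_equal; ring. }
  assert (s0 : St O).
  { exists (a, c). split.
    - intros z. unfold sub, L, M. simpl. unfold in_rect. lra.
    - rewrite E0. fold eta. simpl. lra. }
  assert (next : forall n (s : St n), {s' : St (S n) | forall z, sub (S n) (proj1_sig s') z -> sub n (proj1_sig s) z}).
  { intros n [p [Hin He]]. apply constructive_indefinite_description.
    destruct (goursat_quarter n p _ Hin He) as [p' [Hs Hp]].
    unshelve eexists (exist _ p' _); [|exact Hs]. split.
    - intros z Hz. apply Hin, Hs, Hz.
    - simpl. lra. }
  set (s := fix s n : St n := match n with O => s0 | S k => proj1_sig (next k (s k)) end).
  set (p := fun n => proj1_sig (s n)).
  assert (Hnest1 : forall n z, sub (S n) (p (S n)) z -> sub n (p n) z).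
  { intros n z. unfold p. simpl. apply (proj2_sig (next n (s n))). }
  assert (Hnest : forall k n z, sub (k + n) (p (k + n)%nat) z -> sub n (p n) z).
  { induction k as [|k IH]; intros n z Hz; [exact Hz|]. apply IH. now apply Hnest1. }
  assert (Hcorner : forall n, sub n (p n) (p n)).
  { intros n. assert (P := half_pow_pos n).
    assert (0 <= L * (/ 2) ^ n)%R by (apply Rmult_le_pos; unfold L; lra).
    assert (0 <= M * (/ 2) ^ n)%R by (apply Rmult_le_pos; unfold M; lra).
    split; lra. }
  assert (Hpm : forall n m, (n <= m)%nat -> sub n (p n) (p m)).
  { intros n m Hm. replace m with ((m - n) + n)%nat by lia. apply (Hnest (m - n)%nat). apply Hcorner. }
  destruct (bounded_adherent p (Rabs a + Rabs b + (Rabs c + Rabs d))) as [z Hz].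
  { intros n. assert (Q : in_rect a b c d (p n)) by (apply (proj1 (proj2_sig (s n))), Hcorner).
    destruct Q as [Q1 Q2]. eapply Rle_trans; [apply Cmod_le_Rabs|].
    generalize (Rle_abs a) (Rle_abs b) (Rle_abs c) (Rle_abs d) (Rle_abs (- a)) (Rle_abs (- b)) (Rle_abs (- c)) (Rle_abs (- d)).
    rewrite !Rabs_Ropp. intros. apply Rplus_le_compat; apply Rabs_le; lra. }
  assert (Hzs : forall n, sub n (p n) z).
  { intros n.
    assert (K : forall e, 0 < e -> exists w, sub n (p n) w /\ Rabs (fst w - fst z) < e /\ Rabs (snd w - snd z) < e).
    { intros e He. destruct (Hz e n He) as [m [Hm Km]]. exists (p m). split; [now apply Hpm|].
      split; eapply Rle_lt_trans; [apply (Rabs_fst_le (p m - z))|easy|apply (Rabs_snd_le (p m - z))|easy]. }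
    split; split; apply le_epsilon; intros e He; destruct (K e He) as [w [[W1 W2] [K1 K2]]];
    apply Rabs_lt_between in K1; apply Rabs_lt_between in K2; lra. }
  assert (Hzin : in_rect a b c d z) by (apply (proj1 (proj2_sig (s O))), Hzs).
  destruct (Hh z Hzin) as [l [q [Hql [Hqc Hq]]]].
  (* The estimate below reads [eta <= 4 e (L + M)^2], while this [e] makes the right side at most
     [eta / 2]. The [+ 1] covers degenerate rectangles. *)
  set (e := (eta / (8 * ((L + M) * (L + M) + 1)))%R).
  assert (Hpos : 0 <= ((L + M) * (L + M))%R) by apply Rle_0_sqr.
  assert (He : 0 < e) by (apply Rdiv_lt_0_compat; lra).
  destruct (Hqc e He) as [dl [Hdl Hqd]].
  assert (HLM : 0 <= L + M) by (unfold L, M; lra).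
  destruct (half_pow_small (dl / (L + M + 1))) as [n Hn]; [apply Rdiv_lt_0_compat; lra|].
  assert (P := half_pow_pos n).
  assert (Hd : ((L + M) * (/ 2) ^ n < dl)%R).
  { apply Rmult_lt_compat_r with (r := (L + M + 1)%R) in Hn; [|lra].
    unfold Rdiv in Hn. rewrite Rmult_assoc, Rinv_l in Hn by lra. lra. }
  assert (Q := proj2_sig (s n)). fold (p n) in Q. destruct Q as [Q1 Q2].
  assert (Hle1 : (fst (p n) <= fst (p n) + L * (/ 2) ^ n)%R).
  { assert (0 <= L * (/ 2) ^ n)%R by (apply Rmult_le_pos; unfold L; lra). lra. }
  assert (Hle2 : (snd (p n) <= snd (p n) + M * (/ 2) ^ n)%R).
  { assert (0 <= M * (/ 2) ^ n)%R by (apply Rmult_le_pos; unfold M; lra). lra. }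
  (* Subtracting the tangent map at the limit point [z] keeps the integral and leaves a function at
     most [e] times the size of the small rectangle. *)
  set (g := fun w => h w - ((h z - l * z) + l * w)).
  assert (Haff : forall w, ccont (fun w => (h z - l * z) + l * w) w).
  { intros w. apply cont_at_plus; [apply cont_at_const|].
    apply cont_at_mult; [apply cont_at_const|apply ccont_id]. }
  assert (Hgc : forall w, sub n (p n) w -> ccont g w).
  { intros w Hw. apply cont_at_minus; [apply cdiff_cont, Hh, Q1, Hw|apply Haff]. }
  assert (Hgb : forall w, sub n (p n) w -> Cmod (g w) <= e * ((L + M) * (/ 2) ^ n)).
  { intros w Hw. unfold g. rewrite (Hq w).
    replace (h z + q w * (w - z) - (h z - l * z + l * w)) with ((q w - q z) * (w - z))
      by (rewrite Hql; ring).
    assert (Hwz : Cmod (w - z) <= (L + M) * (/ 2) ^ n).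
    { eapply Rle_trans; [apply Cmod_le_Rabs|]. simpl.
      destruct Hw as [W1 W2], (Hzs n) as [Z1 Z2].
      rewrite Rmult_plus_distr_r. apply Rplus_le_compat; apply Rabs_le; lra. }
    rewrite Cmod_mult. apply Rmult_le_compat; try apply Cmod_ge_0; [|easy].
    left. apply Hqd. unfold cdist. lra. }
  assert (HJ : J n (p n) = rect_int g (fst (p n)) (fst (p n) + L * (/ 2) ^ n) (snd (p n)) (snd (p n) + M * (/ 2) ^ n)).
  { unfold J. rewrite <- (Cplus_0_r (rect_int g _ _ _ _)).
    rewrite <- (rect_int_affine (h z - l * z) l (fst (p n)) (fst (p n) + L * (/ 2) ^ n) (snd (p n)) (snd (p n) + M * (/ 2) ^ n)) by easy.
    rewrite <- rect_int_plus; [|easy|easy|exact Hgc|intros; apply Haff].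
    apply rect_int_ext; [easy|easy|]. intros w. unfold g. ring. }
  assert (HB := rect_int_bound g _ _ _ _ _ Hle1 Hle2 Hgc Hgb). rewrite <- HJ in HB.
  assert (Q3 := Rle_trans _ _ _ Q2 HB).
  replace ((/ 4) ^ n)%R with ((/ 2) ^ n * (/ 2) ^ n)%R in Q3
    by (rewrite <- Rpow_mult_distr; f_equal; field).
  replace (4 * (e * ((L + M) * (/ 2) ^ n)) *
       (fst (p n) + L * (/ 2) ^ n - fst (p n) + (snd (p n) + M * (/ 2) ^ n - snd (p n))))%R
    with ((4 * e * ((L + M) * (L + M))) * ((/ 2) ^ n * (/ 2) ^ n))%R in Q3 by ring.
  apply Rmult_le_reg_r in Q3; [|now apply Rmult_lt_0_compat].
  assert (e * ((L + M) * (L + M) + 1) = eta / 8)%R by (unfold e; field; lra).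
  lra.
Qed.

End Goursat.

(** For [r > 0] this is the contour integral of [h(z) dz / (2 pi i z)] over [|z| = r]; as an average
    it also makes sense at [r = 0], where it is [h 0]. *)
Definition avg (r : R) (h : C -> C) : C := / (2 * PI)%R * cint (fun t => h (r * cis t)) 0 (2 * PI).

Lemma two_PI_pos : 0 < 2 * PI.
Proof. generalize PI_RGT_0. lra. Qed.

(** The exponential maps the rectangle [[ln r1, ln r2] x [0, 2 pi]] onto the annulus. In Goursat's
    identity for [h o cexp] the horizontal sides cancel by periodicity, and the vertical sides are
    the two circles. *)
Lemma avg_annulus (h : C -> C) (r1 r2 : R) : 0 < r1 -> r1 <= r2 ->
  (forall z, r1 <= Cmod z <= r2 -> cdiff h z) -> avg r1 h = avg r2 h.
Proof.
  intros H1 H12 Hh. unfold avg. f_equal.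
  assert (Hln : ln r1 <= ln r2).
  { destruct H12 as [H12|H12]; [left; now apply ln_increasing|right; now f_equal]. }
  assert (T := two_PI_pos).
  assert (K : rect_int (fun s => h (cexp s)) (ln r1) (ln r2) 0 (2 * PI) = 0).
  { apply goursat_rect; [easy|lra|]. intros z [Z1 Z2].
    apply (cdiff_comp h cexp); [|apply cdiff_cexp]. apply Hh. unfold cexp.
    rewrite Cmod_scal_cis by (left; apply exp_pos).
    rewrite <- (exp_ln r1), <- (exp_ln r2) by lra.
    split.
    - destruct (proj1 Z1) as [Z|Z]; [left; now apply exp_increasing|right; now rewrite Z].
    - destruct (proj2 Z1) as [Z|Z]; [left; now apply exp_increasing|right; now rewrite Z]. }
  unfold rect_int, cexp in K. simpl in K.
  assert (E : cis (2 * PI) = cis 0).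
  { unfold cis. now rewrite cos_2PI, sin_2PI, cos_0, sin_0. }
  rewrite E, !exp_ln in K by lra.
  set (I1 := cint (fun y => h (r1 * cis y)) 0 (2 * PI)) in *.
  set (I2 := cint (fun y => h (r2 * cis y)) 0 (2 * PI)) in *.
  set (X := cint _ _ _) in K.
  assert (K2 : Ci * (I2 - I1) = 0) by (rewrite <- K; ring).
  replace I1 with (I2 + Ci * (Ci * (I2 - I1))); [rewrite K2; ring|].
  replace (Ci * (Ci * (I2 - I1))) with ((Ci * Ci) * (I2 - I1)) by ring.
  replace (Ci * Ci) with (- (1)); [ring|].
  unfold Ci, Cmult, Copp, RtoC. simpl. f_equal; ring.
Qed.

(** * Circle averages *)

Definition circ_cont (r : R) (h : C -> C) : Prop := forall z, Cmod z = r -> ccont h z.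

Lemma rcont_cis (t : R) : rcont cis t.
Proof.
  assert (Hc : continuity_pt cos t) by apply continuity_cos.
  assert (Hs : continuity_pt sin t) by apply continuity_sin.
  intros e He. rewrite continuity_pt_locally in Hc, Hs.
  assert (He2 : 0 < e / 2) by lra.
  destruct (Hc (mkposreal _ He2)) as [d1 H1], (Hs (mkposreal _ He2)) as [d2 H2]. simpl in H1, H2.
  exists (Rmin d1 d2). split; [apply Rmin_pos; apply cond_pos|]. intros s Hs'.
  assert (K1 : Rabs (cos s - cos t) < e / 2) by (apply H1; eapply Rlt_le_trans; [apply Hs'|apply Rmin_l]).
  assert (K2 : Rabs (sin s - sin t) < e / 2) by (apply H2; eapply Rlt_le_trans; [apply Hs'|apply Rmin_r]).
  eapply Rle_lt_trans; [apply Cmod_le_Rabs|]. simpl. unfold Rminus in *. lra.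
Qed.

Lemma rcont_circle (h : C -> C) (r t : R) : 0 <= r -> circ_cont r h -> rcont (fun t => h (r * cis t)) t.
Proof.
  intros Hr Hh. apply (cont_at_comp _ h (fun t => r * cis t)).
  - apply Hh. now apply Cmod_scal_cis.
  - apply cont_at_mult; [apply cont_at_const|apply rcont_cis].
Qed.

Section AverageRules.
Variable r : R.
Hypothesis Hr : 0 <= r.

Let two_PI_neq : RtoC (2 * PI) <> 0.
Proof. intros E. apply RtoC_inj in E. generalize two_PI_pos. lra. Qed.

Let two_PI_ge : 0 <= 2 * PI.
Proof. generalize two_PI_pos. lra. Qed.

Lemma avg_ext (g h : C -> C) : (forall z, Cmod z = r -> g z = h z) -> avg r g = avg r h.
Proof.
  intros E. unfold avg. f_equal. apply cint_ext; [apply two_PI_ge|].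
  intros t _. apply E. now apply Cmod_scal_cis.
Qed.

Lemma avg_plus (g h : C -> C) : circ_cont r g -> circ_cont r h ->
  avg r (fun z => g z + h z) = avg r g + avg r h.
Proof.
  intros Hg Hh. unfold avg. rewrite cint_plus; [ring|apply two_PI_ge| |]; intros; now apply rcont_circle.
Qed.

Lemma avg_minus (g h : C -> C) : circ_cont r g -> circ_cont r h ->
  avg r (fun z => g z - h z) = avg r g - avg r h.
Proof.
  intros Hg Hh. unfold avg. rewrite cint_minus; [ring|apply two_PI_ge| |]; intros; now apply rcont_circle.
Qed.

Lemma avg_scal (h : C -> C) (c : C) : circ_cont r h -> avg r (fun z => c * h z) = c * avg r h.
Proof.
  intros Hh. unfold avg. rewrite cint_scal; [ring|apply two_PI_ge|]; intros; now apply rcont_circle.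
Qed.

Lemma avg_const (c : C) : avg r (fun _ => c) = c.
Proof.
  unfold avg. rewrite cint_const by apply two_PI_ge. rewrite Cminus_0_r. field. apply two_PI_neq.
Qed.

Lemma avg_bound (h : C -> C) (M : R) : circ_cont r h -> (forall z, Cmod z = r -> Cmod (h z) <= M) ->
  Cmod (avg r h) <= 2 * M.
Proof.
  intros Hh HM. unfold avg. assert (T := two_PI_pos).
  rewrite Cmod_mult, Cmod_inv, Cmod_RtoC_pos by (apply two_PI_ge || apply two_PI_neq).
  assert (B : Cmod (cint (fun t => h (r * cis t)) 0 (2 * PI)) <= 2 * M * (2 * PI - 0)).
  { apply cint_bound; [lra|intros; now apply rcont_circle|]. intros t _. apply HM. now apply Cmod_scal_cis. }
  apply Rmult_le_reg_l with (2 * PI)%R; [easy|].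
  rewrite <- Rmult_assoc, Rinv_r, Rmult_1_l by lra. lra.
Qed.

End AverageRules.

Lemma avg_0 (h : C -> C) : avg 0 h = h 0.
Proof.
  rewrite <- (avg_const 0 (h 0)). apply avg_ext; [lra|].
  intros z Hz. now rewrite (Cmod_eq_0 z Hz).
Qed.

Lemma avg_cont_radius (h : C -> C) (r0 : R) : 0 <= r0 -> circ_cont r0 h ->
  forall e, 0 < e -> exists dl, 0 < dl /\
    forall r, 0 <= r -> circ_cont r h -> Rabs (r - r0) < dl -> Cmod (avg r h - avg r0 h) < e.
Proof.
  intros Hr0 Hh e He. assert (T := two_PI_pos).
  destruct (compact_uniform_cont (fun z => Cmod (z - 0) = r0) h) with (e := (e / 4)%R) as [dl [Hdl H]].
  - apply compact_circle.
  - intros z Hz. apply Hh. now rewrite Cminus_0_r in Hz.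
  - lra.
  - exists dl. split; [easy|]. intros r Hr Hc Hd.
    assert (E : avg r h - avg r0 h = / (2 * PI)%R * cint (fun t => h (r * cis t) - h (r0 * cis t)) 0 (2 * PI)).
    { unfold avg. rewrite cint_minus; [ring|lra| |]; intros; now apply rcont_circle. }
    rewrite E. rewrite Cmod_mult, Cmod_inv, Cmod_RtoC_pos; [|lra|intros K; apply RtoC_inj in K; lra].
    assert (B : Cmod (cint (fun t => h (r * cis t) - h (r0 * cis t)) 0 (2 * PI)) <= 2 * (e / 4) * (2 * PI - 0)).
    { apply cint_bound; [lra| |].
      - intros t _. apply cont_at_minus; now apply rcont_circle.
      - intros t _. left. apply H.
        + rewrite Cminus_0_r. now apply Cmod_scal_cis.
        + replace (r * cis t - r0 * cis t) with ((r - r0) * cis t) by ring.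
          rewrite <- RtoC_minus, Cmod_mult, Cmod_cis, Cmod_R. lra. }
    apply Rmult_lt_reg_l with (2 * PI)%R; [easy|].
    rewrite <- Rmult_assoc, Rinv_r, Rmult_1_l by lra.
    assert (0 < e * (2 * PI))%R by now apply Rmult_lt_0_compat. lra.
Qed.

(* Isolated points where [h] is only continuous are harmless: the average is locally constant in the radius off [Cmod a], and continuous there. *)
Lemma mean_value (h : C -> C) (rho r : R) (a : C) : 0 <= r -> r < rho ->
  (forall z, Cmod z < rho -> ccont h z) ->
  (forall z, Cmod z < rho -> z <> a -> cdiff h z) ->
  avg r h = h 0.
Proof.
  intros Hr Hrho Hc Hd. rewrite <- avg_0.
  assert (Hcirc : forall s, s < rho -> circ_cont s h).
  { intros s Hs z Hz. apply Hc. lra. }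
  assert (Hann : forall r1 r2, 0 < r1 -> r1 <= r2 -> r2 < rho -> ~ (r1 <= Cmod a <= r2) -> avg r1 h = avg r2 h).
  { intros r1 r2 H1 H2 H3 H4. apply avg_annulus; [easy|easy|].
    intros z Hz. apply Hd; [lra|]. intros ->. now apply H4. }
  assert (Hlim : forall s v, 0 <= s -> s < rho ->
    (forall dl, 0 < dl -> exists r', 0 <= r' < rho /\ Rabs (r' - s) < dl /\ avg r' h = v) -> avg s h = v).
  { intros s v Hs1 Hs2 K. apply Cmod_sub_zero. apply Rle_antisym; [|apply Cmod_ge_0].
    apply le_epsilon. intros e He.
    destruct (avg_cont_radius h s Hs1 (Hcirc s Hs2) e He) as [dl [Hdl H]].
    destruct (K dl Hdl) as [r' [[P1 P2] [P3 <-]]]. rewrite Cmod_sub_comm, Rplus_0_l. left. apply H; auto. }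
  (* [HA] covers the radii below [|a|], or all positive ones if [a = 0]; [HB] reaches [|a|] from
     inside; larger radii are compared with [|a|] from outside. *)
  assert (HA : forall s, 0 < s -> s < rho -> (a = 0 \/ s < Cmod a) -> avg s h = avg 0 h).
  { intros s Hs1 Hs2 Ha. symmetry. apply Hlim; [lra|lra|]. intros dl Hdl.
    exists (Rmin s (dl / 2)). assert (P1 := Rmin_l s (dl / 2)). assert (P2 := Rmin_r s (dl / 2)).
    assert (P3 : 0 < Rmin s (dl / 2)) by (apply Rmin_pos; lra).
    split; [lra|]. split; [rewrite Rminus_0_r, Rabs_pos_eq; lra|].
    apply Hann; try lra. destruct Ha as [->|Ha]; [rewrite Cmod_0|]; lra. }
  assert (HB : 0 < Cmod a -> Cmod a < rho -> avg (Cmod a) h = avg 0 h).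
  { intros P Q. apply Hlim; [lra|lra|]. intros dl Hdl.
    exists (Rmax (Cmod a / 2) (Cmod a - dl / 2)).
    assert (P1 := Rmax_l (Cmod a / 2) (Cmod a - dl / 2)). assert (P2 := Rmax_r (Cmod a / 2) (Cmod a - dl / 2)).
    assert (P3 : Rmax (Cmod a / 2) (Cmod a - dl / 2) < Cmod a) by (apply Rmax_lub_lt; lra).
    split; [lra|]. split; [rewrite Rabs_left; lra|]. apply HA; try lra. }
  destruct Hr as [Hr|<-]; [|easy].
  destruct (classic (a = 0)) as [Ha|Ha]; [now apply HA; auto|].
  apply Cmod_gt_0 in Ha.
  destruct (Rtotal_order r (Cmod a)) as [K|[K|K]].
  - apply HA; auto.
  - rewrite K. apply HB; lra.
  - rewrite <- HB by lra. symmetry. apply Hlim; [lra|lra|]. intros dl Hdl.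
    exists (Rmin r (Cmod a + dl / 2)).
    assert (P1 := Rmin_l r (Cmod a + dl / 2)). assert (P2 := Rmin_r r (Cmod a + dl / 2)).
    assert (P3 : Cmod a < Rmin r (Cmod a + dl / 2)) by (apply Rmin_glb_lt; lra).
    split; [lra|]. split; [rewrite Rabs_pos_eq; lra|]. apply Hann; lra.
Qed.

Lemma mean_value_holo (h : C -> C) (rho r : R) : 0 <= r -> r < rho ->
  (forall z, Cmod z < rho -> cdiff h z) -> avg r h = h 0.
Proof.
  intros Hr Hrho Hd. apply mean_value with (rho := rho) (a := RtoC 0); auto.
  intros z Hz. now apply cdiff_cont, Hd.
Qed.

Lemma circle_sub_neq (r : R) (z a : C) : Cmod z = r -> Cmod a < r -> z - a <> 0.
Proof. intros H1 H2. apply Csub_neq_0, Cmod_neq. lra. Qed.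

(** Write [z / (z - a) = 1 + a / (z - a)]. Enlarging the circle does not change the average, and on
    large circles the second term is small. *)
Lemma avg_kernel (a : C) (r : R) : Cmod a < r -> avg r (fun z => z / (z - a)) = 1.
Proof.
  intros Ha. assert (Pa := Cmod_ge_0 a).
  assert (Hc : forall s, Cmod a < s -> circ_cont s (fun z => a / (z - a))).
  { intros s Hs z Hz. apply cont_at_div; [now apply (circle_sub_neq s)|apply cont_at_const|].
    apply cont_at_minus; [apply ccont_id|apply cont_at_const]. }
  assert (E : forall s, r <= s -> avg r (fun z => z / (z - a)) - 1 = avg s (fun z => a / (z - a))).
  { intros s Hs. rewrite (avg_annulus _ r s); [|lra|easy|].
    - rewrite (avg_ext s ltac:(lra) (fun z => z / (z - a)) (fun z => 1 + a / (z - a))).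
      + rewrite avg_plus, avg_const; try lra; [ring| |].
        * intros z Hz. apply cont_at_const.
        * apply Hc. lra.
      + intros z Hz. field. apply (circle_sub_neq s); lra.
    - intros z Hz. apply cdiff_div; [apply Csub_neq_0, Cmod_neq; lra|apply cdiff_id|].
      apply cdiff_minus; [apply cdiff_id|apply cdiff_const]. }
  apply Cmod_sub_zero. apply Rle_antisym; [|apply Cmod_ge_0]. apply le_epsilon. intros e He.
  (* Solves [2 |a| / (s - |a|) <= e] with [s >= r]. *)
  set (s := (r + Cmod a + 2 * Cmod a / e)%R).
  assert (0 <= 2 * Cmod a / e)%R by (apply Rmult_le_pos; [lra|left; now apply Rinv_0_lt_compat]).
  assert (Hs : r <= s) by (unfold s; lra).
  rewrite (E s Hs), Rplus_0_l.
  assert (Hse : 0 < s - Cmod a) by (unfold s; lra).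
  eapply Rle_trans; [apply (avg_bound s ltac:(lra) _ (Cmod a / (s - Cmod a)))|].
  - apply Hc. lra.
  - intros z Hz. rewrite Cmod_div by (apply (circle_sub_neq s); lra).
    apply Rmult_le_compat_l; [easy|]. apply Rinv_le_contravar; [easy|].
    generalize (Cmod_triangle_rev z a). lra.
  - apply Rmult_le_reg_r with (s - Cmod a)%R; [easy|].
    replace (2 * (Cmod a / (s - Cmod a)) * (s - Cmod a))%R with (2 * Cmod a)%R by (field; lra).
    replace (e * (s - Cmod a))%R with (e * r + 2 * Cmod a)%R by (unfold s; field; lra).
    assert (0 <= e * r)%R by (apply Rmult_le_pos; lra). lra.
Qed.

(** The function [z * slope f a l z] vanishes at [0], so its average is [0]; splitting the quotient
    and using [avg_kernel] gives the formula. So far the slope is only known to be continuous at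
    [a], hence the exceptional point in [mean_value]. *)
Lemma cauchy_formula (f : C -> C) (rho r : R) (a : C) : Cmod a < r -> r < rho ->
  (forall z, Cmod z < rho -> cdiff f z) ->
  avg r (fun z => f z * z / (z - a)) = f a.
Proof.
  intros Ha Hr Hf. assert (Pa := Cmod_ge_0 a).
  destruct (Hf a ltac:(lra)) as [l Hl]. apply cderiv_slope in Hl.
  assert (K : avg r (fun z => z * slope f a l z) = 0 * slope f a l 0).
  { apply (mean_value (fun z => z * slope f a l z) rho r a); [lra|easy| |].
    - intros z Hz. apply cont_at_mult; [apply ccont_id|].
      destruct (classic (z = a)) as [->|Hza]; [easy|].
      apply cdiff_cont, cdiff_slope_other; auto.
    - intros z Hz Hza. apply cdiff_mult; [apply cdiff_id|apply cdiff_slope_other; auto]. }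
  assert (Hk : circ_cont r (fun z => z / (z - a))).
  { intros z Hz. apply cont_at_div; [now apply (circle_sub_neq r)|apply ccont_id|].
    apply cont_at_minus; [apply ccont_id|apply cont_at_const]. }
  rewrite (avg_ext r ltac:(lra) _ (fun z => f z * (z / (z - a)) - f a * (z / (z - a)))) in K.
  - rewrite avg_minus, avg_scal, avg_kernel in K; try lra; try easy.
    + replace (f a) with (0 * slope f a l 0 + f a * 1) by ring. rewrite <- K.
      rewrite (avg_ext r ltac:(lra) (fun z => f z * z / (z - a)) (fun z => f z * (z / (z - a)))); [ring|].
      intros z Hz. field. now apply (circle_sub_neq r).
    + intros z Hz. apply cont_at_mult; [apply cdiff_cont, Hf; lra|now apply Hk].
    + intros z Hz. apply cont_at_mult; [apply cont_at_const|now apply Hk].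
  - intros z Hz. rewrite slope_other by (intros ->; lra). field. now apply (circle_sub_neq r).
Qed.

(** * Cauchy transforms and the maximum principle *)

Ltac ccont_auto :=
  repeat first
    [ assumption | apply cont_at_const | apply ccont_id | apply cont_at_plus | apply cont_at_minus
    | apply cont_at_div | apply cont_at_mult | apply cont_at_opp | apply cont_at_pow ].

(** For differentiation under an average: algebra produces the difference quotient exactly as [G w],
    and only a Lipschitz estimate at [z] remains. *)
Lemma cderiv_of_lipschitz (F G : C -> C) (z : C) (r B : R) : 0 < r ->
  (forall w, Cmod (w - z) < r -> F w - F z = (w - z) * G w) ->
  (forall w, Cmod (w - z) < r -> Cmod (G w - G z) <= B * Cmod (w - z)) ->
  cderiv F z (G z).
Proof.
  intros Hr HF HG. apply cderiv_slope.
  apply (ccont_ext_loc G) with (r := r); [easy| |].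
  - intros w Hw. destruct (classic (w = z)) as [->|Hn].
    + now rewrite slope_same.
    + rewrite slope_other by easy. rewrite HF by easy. field. now apply Csub_neq_0.
  - intros e He. exists (Rmin r (e / (Rabs B + 1))).
    assert (PB := Rabs_pos B).
    split; [apply Rmin_pos; [easy|apply Rdiv_lt_0_compat; lra]|].
    intros w Hw. unfold cdist in Hw.
    assert (W1 := Rlt_le_trans _ _ _ Hw (Rmin_l _ _)). assert (W2 := Rlt_le_trans _ _ _ Hw (Rmin_r _ _)).
    eapply Rle_lt_trans; [apply HG; easy|].
    apply Rmult_lt_compat_r with (r := (Rabs B + 1)%R) in W2; [|lra].
    unfold Rdiv in W2. rewrite Rmult_assoc, Rinv_l, Rmult_1_r in W2 by lra.
    assert (P := Cmod_ge_0 (w - z)).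
    assert (B * Cmod (w - z) <= Rabs B * Cmod (w - z))%R by (apply Rmult_le_compat_r; [easy|apply Rle_abs]).
    lra.
Qed.

Section CauchyTransform.
Variables (r : R) (u : C -> C).
Hypothesis (Hu : circ_cont r u).

Local Lemma circle_far (z w x : C) : Cmod z < r -> Cmod (w - z) < (r - Cmod z) / 2 -> Cmod x = r ->
  (r - Cmod z) / 2 <= Cmod (x - w) /\ (r - Cmod z) / 2 <= Cmod (x - z) /\ Cmod w < r.
Proof.
  intros Hz Hw Hx.
  assert (T1 := Cmod_triangle_rev w z). assert (T2 := Cmod_triangle_rev x z).
  assert (T3 := Cmod_triangle_rev x w). lra.
Qed.

Local Lemma inv_le (m d : R) : 0 < d -> d <= m -> / m <= / d.
Proof. intros; now apply Rinv_le_contravar. Qed.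

Lemma cauchy_transform_deriv (z : C) : Cmod z < r ->
  cderiv (fun w => avg r (fun x => u x / (x - w))) z (avg r (fun x => u x / ((x - z) * (x - z)))).
Proof.
  intros Hz. assert (Pz := Cmod_ge_0 z). assert (Hr : 0 <= r) by lra.
  destruct (compact_bounded (fun x => Cmod (x - 0) = r) u) as [M [HM0 HM]].
  { apply compact_circle. }
  { intros x Hx. apply Hu. now rewrite Cminus_0_r in Hx. }
  set (d := ((r - Cmod z) / 2)%R). assert (Hd : 0 < d) by (unfold d; lra).
  apply (cderiv_of_lipschitz _ (fun w => avg r (fun x => u x / ((x - w) * (x - z)))) z d (2 * (M * / d * / d * / d))%R Hd).
  - intros w Hw. rewrite <- avg_minus, <- avg_scal; try easy.
    + apply avg_ext; [easy|]. intros x Hx.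
      destruct (circle_far z w x Hz Hw Hx) as [F1 [F2 F3]].
      field. split; now apply (circle_sub_neq r).
    + intros x Hx. destruct (circle_far z w x Hz Hw Hx) as [F1 [F2 F3]]. assert (Hux := Hu x Hx).
      ccont_auto. apply Cmult_neq_0; now apply (circle_sub_neq r).
    + intros x Hx. destruct (circle_far z w x Hz Hw Hx) as [F1 [F2 F3]]. assert (Hux := Hu x Hx).
      ccont_auto. now apply (circle_sub_neq r).
    + intros x Hx. assert (Hux := Hu x Hx). ccont_auto. now apply (circle_sub_neq r).
  - intros w Hw. rewrite <- avg_minus; try easy.
    + rewrite (avg_ext r Hr _ (fun x => (w - z) * (u x / ((x - w) * (x - z) * (x - z))))).
      * rewrite avg_scal; try easy.
        -- rewrite Cmod_mult, Rmult_comm. apply Rmult_le_compat_r; [apply Cmod_ge_0|].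
           apply avg_bound; [easy| |].
           ++ intros x Hx. destruct (circle_far z w x Hz Hw Hx) as [F1 [F2 F3]]. assert (Hux := Hu x Hx).
              ccont_auto. repeat apply Cmult_neq_0; now apply (circle_sub_neq r).
           ++ intros x Hx. destruct (circle_far z w x Hz Hw Hx) as [F1 [F2 F3]].
              assert (N1 := circle_sub_neq r x w Hx F3). assert (N2 := circle_sub_neq r x z Hx Hz).
              replace (u x / ((x - w) * (x - z) * (x - z))) with (u x * / (x - w) * / (x - z) * / (x - z)) by (field; auto).
              rewrite !Cmod_mult, !Cmod_inv by easy.
              assert (G1 := inv_le _ _ Hd F1). assert (G2 := inv_le _ _ Hd F2).
              assert (0 <= / Cmod (x - w)) by (left; apply Rinv_0_lt_compat; fold d in F1; lra).
              assert (0 <= / Cmod (x - z)) by (left; apply Rinv_0_lt_compat; fold d in F2; lra).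
              assert (Cmod (u x) <= M) by (apply HM; now rewrite Cminus_0_r).
              assert (0 <= Cmod (u x)) by apply Cmod_ge_0.
              repeat apply Rmult_le_compat; try easy; repeat apply Rmult_le_pos; easy.
        -- intros x Hx. destruct (circle_far z w x Hz Hw Hx) as [F1 [F2 F3]]. assert (Hux := Hu x Hx).
           ccont_auto. repeat apply Cmult_neq_0; now apply (circle_sub_neq r).
      * intros x Hx. destruct (circle_far z w x Hz Hw Hx) as [F1 [F2 F3]].
        field. split; now apply (circle_sub_neq r).
    + intros x Hx. destruct (circle_far z w x Hz Hw Hx) as [F1 [F2 F3]]. assert (Hux := Hu x Hx).
      ccont_auto. repeat apply Cmult_neq_0; now apply (circle_sub_neq r).
    + intros x Hx. assert (Hux := Hu x Hx).
      ccont_auto. repeat apply Cmult_neq_0; now apply (circle_sub_neq r).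
Qed.

(** One more derivative of the Cauchy transform, so that the derivative of a holomorphic function is
    itself holomorphic. *)
Lemma cauchy_transform2_cdiff (z : C) : Cmod z < r ->
  cdiff (fun w => avg r (fun x => u x / ((x - w) * (x - w)))) z.
Proof.
  intros Hz. assert (Pz := Cmod_ge_0 z). assert (Hr : 0 <= r) by lra.
  destruct (compact_bounded (fun x => Cmod (x - 0) = r) u) as [M [HM0 HM]].
  { apply compact_circle. }
  { intros x Hx. apply Hu. now rewrite Cminus_0_r in Hx. }
  set (d := ((r - Cmod z) / 2)%R). assert (Hd : 0 < d) by (unfold d; lra).
  eexists.
  apply (cderiv_of_lipschitz _
    (fun w => avg r (fun x => u x * ((x - z) + (x - w)) / ((x - w) * (x - w) * ((x - z) * (x - z)))))
    z d (2 * (M * (6 * r) * (/ d * / d) * (/ d * / d * / d)))%R Hd).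
  - intros w Hw. rewrite <- avg_minus, <- avg_scal; try easy.
    + apply avg_ext; [easy|]. intros x Hx.
      destruct (circle_far z w x Hz Hw Hx) as [F1 [F2 F3]].
      field. split; now apply (circle_sub_neq r).
    + intros x Hx. destruct (circle_far z w x Hz Hw Hx) as [F1 [F2 F3]]. assert (Hux := Hu x Hx).
      ccont_auto. repeat apply Cmult_neq_0; now apply (circle_sub_neq r).
    + intros x Hx. destruct (circle_far z w x Hz Hw Hx) as [F1 [F2 F3]]. assert (Hux := Hu x Hx).
      ccont_auto. repeat apply Cmult_neq_0; now apply (circle_sub_neq r).
    + intros x Hx. assert (Hux := Hu x Hx). ccont_auto. repeat apply Cmult_neq_0; now apply (circle_sub_neq r).
  - intros w Hw. rewrite <- avg_minus; try easy.
    + rewrite (avg_ext r Hr _ (fun x => (w - z) *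
        (u x * ((x - z) + 2 * (x - w)) / ((x - w) * (x - w) * ((x - z) * (x - z) * (x - z)))))).
      * rewrite avg_scal; try easy.
        -- rewrite Cmod_mult, Rmult_comm. apply Rmult_le_compat_r; [apply Cmod_ge_0|].
           apply avg_bound; [easy| |].
           ++ intros x Hx. destruct (circle_far z w x Hz Hw Hx) as [F1 [F2 F3]]. assert (Hux := Hu x Hx).
              ccont_auto. repeat apply Cmult_neq_0; now apply (circle_sub_neq r).
           ++ intros x Hx. destruct (circle_far z w x Hz Hw Hx) as [F1 [F2 F3]].
              assert (N1 := circle_sub_neq r x w Hx F3). assert (N2 := circle_sub_neq r x z Hx Hz).
              replace (u x * (x - z + 2 * (x - w)) / ((x - w) * (x - w) * ((x - z) * (x - z) * (x - z))))
                with (u x * (x - z + 2 * (x - w)) * (/ (x - w) * / (x - w)) * (/ (x - z) * / (x - z) * / (x - z))) by (field; auto).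
              assert (N : Cmod (x - z + 2 * (x - w)) <= 6 * r).
              { eapply Rle_trans; [apply Cmod_triangle|]. rewrite Cmod_mult, Cmod_R, Rabs_pos_eq by lra.
                assert (Q1 := Cmod_triangle x (- z)). assert (Q2 := Cmod_triangle x (- w)).
                rewrite Cmod_opp in Q1, Q2. unfold Cminus. lra. }
              rewrite !Cmod_mult, !Cmod_inv by easy.
              assert (G1 := inv_le _ _ Hd F1). assert (G2 := inv_le _ _ Hd F2).
              assert (0 <= / Cmod (x - w)) by (left; apply Rinv_0_lt_compat; fold d in F1; lra).
              assert (0 <= / Cmod (x - z)) by (left; apply Rinv_0_lt_compat; fold d in F2; lra).
              assert (Cmod (u x) <= M) by (apply HM; now rewrite Cminus_0_r).
              assert (0 <= Cmod (u x)) by apply Cmod_ge_0.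
              assert (0 <= Cmod (x - z + 2 * (x - w))) by apply Cmod_ge_0.
              repeat apply Rmult_le_compat; try easy; repeat apply Rmult_le_pos; easy.
        -- intros x Hx. destruct (circle_far z w x Hz Hw Hx) as [F1 [F2 F3]]. assert (Hux := Hu x Hx).
           ccont_auto. repeat apply Cmult_neq_0; now apply (circle_sub_neq r).
      * intros x Hx. destruct (circle_far z w x Hz Hw Hx) as [F1 [F2 F3]].
        field. split; now apply (circle_sub_neq r).
    + intros x Hx. destruct (circle_far z w x Hz Hw Hx) as [F1 [F2 F3]]. assert (Hux := Hu x Hx).
      ccont_auto. repeat apply Cmult_neq_0; now apply (circle_sub_neq r).
    + intros x Hx. assert (Hux := Hu x Hx).
      ccont_auto. repeat apply Cmult_neq_0; now apply (circle_sub_neq r).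
Qed.

End CauchyTransform.

Lemma cderiv_C_derive (f : C -> C) (z : C) : cdiff f z -> cderiv f z (C_derive f z).
Proof.
  intros H. apply is_derive_cderiv. apply C_derive_correct; [exact z|]. now apply ex_derive_cdiff.
Qed.

Lemma cderiv_unique (f : C -> C) (z l : C) : cderiv f z l -> C_derive f z = l.
Proof. intros H. apply is_C_derive_unique. now apply is_derive_cderiv. Qed.

Section Holomorphic.
Variables (f : C -> C) (rho : R).
Hypothesis Hf : forall z, Cmod z < rho -> cdiff f z.

Let circ_fz r : r < rho -> circ_cont r (fun x => f x * x).
Proof. intros Hr z Hz. apply cont_at_mult; [apply cdiff_cont, Hf; lra|apply ccont_id]. Qed.

Lemma cauchy_formula_derive (r : R) (a : C) : Cmod a < r -> r < rho ->
  C_derive f a = avg r (fun z => f z * z / ((z - a) * (z - a))).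
Proof.
  intros Ha Hr. apply cderiv_unique.
  apply (cderiv_ext_loc (fun w => avg r (fun x => (f x * x) / (x - w)))) with (r := (r - Cmod a)%R); [lra| |].
  - intros w Hw. apply (cauchy_formula f rho); auto. generalize (Cmod_triangle_rev w a). lra.
  - apply (cauchy_transform_deriv r (fun x => f x * x)); [now apply circ_fz|easy].
Qed.

Lemma cdiff_C_derive (z : C) : Cmod z < rho -> cdiff (C_derive f) z.
Proof.
  intros Hz. set (r := ((Cmod z + rho) / 2)%R).
  apply (cdiff_ext_loc (fun w => avg r (fun x => f x * x / ((x - w) * (x - w))))) with (r := (r - Cmod z)%R).
  - unfold r; lra.
  - intros w Hw. symmetry. apply cauchy_formula_derive; [|unfold r; lra].
    generalize (Cmod_triangle_rev w z). lra.
  - apply (cauchy_transform2_cdiff r (fun x => f x * x)); [apply circ_fz|]; unfold r; lra.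
Qed.

(** The difference of two Cauchy formulas. A single integral covers [w = a] and [w <> a], which
    removes the singularity of the slope at [a] and yields uniform Lipschitz bounds. *)
Lemma slope_cauchy (r : R) (a w : C) : Cmod a < r -> Cmod w < r -> r < rho ->
  slope f a (C_derive f a) w = avg r (fun x => (f x * x / (x - a)) / (x - w)).
Proof.
  intros Ha Hw Hr. assert (P := Cmod_ge_0 a).
  assert (Hc : forall b, Cmod b < r -> circ_cont r (fun x => f x * x / (x - b))).
  { intros b Hb x Hx. assert (K := circ_fz r Hr x Hx). ccont_auto. now apply (circle_sub_neq r). }
  destruct (classic (w = a)) as [->|Hwa].
  - rewrite slope_same, (cauchy_formula_derive r) by easy. apply avg_ext; [lra|].
    intros x Hx. field. now apply (circle_sub_neq r).
  - rewrite slope_other by easy.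
    rewrite <- (cauchy_formula f rho r a), <- (cauchy_formula f rho r w) by easy.
    rewrite <- avg_minus by (auto; lra). unfold Cdiv at 1. rewrite Cmult_comm, <- avg_scal; [|lra|].
    + apply avg_ext; [lra|]. intros x Hx. field.
      repeat split; try now apply (circle_sub_neq r). now apply Csub_neq_0.
    + intros x Hx. apply cont_at_minus; now apply Hc.
Qed.

Lemma cdiff_slope (a z : C) : Cmod a < rho -> Cmod z < rho -> cdiff (slope f a (C_derive f a)) z.
Proof.
  intros Ha Hz. destruct (classic (z = a)) as [->|Hza]; [|apply cdiff_slope_other; auto].
  set (r := ((Cmod a + rho) / 2)%R).
  apply (cdiff_ext_loc (fun w => avg r (fun x => (f x * x / (x - a)) / (x - w)))) with (r := (r - Cmod a)%R).
  - unfold r; lra.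
  - intros w Hw. symmetry. apply slope_cauchy; [unfold r; lra| |unfold r; lra].
    generalize (Cmod_triangle_rev w a). lra.
  - eexists. apply (cauchy_transform_deriv r (fun x => f x * x / (x - a))); [|unfold r; lra].
    intros x Hx. assert (K := circ_fz r ltac:(unfold r; lra) x Hx). ccont_auto.
    apply (circle_sub_neq r); [easy|unfold r; lra].
Qed.

Lemma holo_lipschitz (r : R) : 0 <= r -> r < rho -> exists L, 0 < L /\
  forall z w, Cmod z <= r -> Cmod w <= r -> Cmod (f z - f w) <= L * Cmod (z - w).
Proof.
  intros Hr0 Hr. set (s := ((r + rho) / 2)%R).
  destruct (compact_bounded (fun x => Cmod (x - 0) = s) (fun x => f x * x)) as [M [HM0 HM]].
  { apply compact_circle. }
  { intros x Hx. apply (circ_fz s ltac:(unfold s; lra)). now rewrite Cminus_0_r in Hx. }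
  set (d := (s - r)%R). assert (Hd : 0 < d) by (unfold d, s; lra).
  exists (2 * (M * / d * / d))%R. split.
  { repeat apply Rmult_lt_0_compat; try lra; now apply Rinv_0_lt_compat. }
  intros z w Hz Hw.
  rewrite (slope_spec f w (C_derive f w) z).
  replace (f w + slope f w (C_derive f w) z * (z - w) - f w) with (slope f w (C_derive f w) z * (z - w)) by ring.
  rewrite Cmod_mult. apply Rmult_le_compat_r; [apply Cmod_ge_0|].
  rewrite (slope_cauchy s) by (unfold s; lra).
  apply avg_bound; [unfold s; lra| |].
  - intros x Hx. assert (K := circ_fz s ltac:(unfold s; lra) x Hx).
    ccont_auto; apply (circle_sub_neq s); auto; unfold s; lra.
  - intros x Hx.
    assert (N1 : x - z <> 0) by (apply (circle_sub_neq s); auto; unfold s; lra).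
    assert (N2 : x - w <> 0) by (apply (circle_sub_neq s); auto; unfold s; lra).
    replace (f x * x / (x - w) / (x - z)) with ((f x * x) * / (x - w) * / (x - z)) by (field; auto).
    rewrite (Cmod_mult (f x * x * / (x - w))), (Cmod_mult (f x * x)), !Cmod_inv by easy.
    assert (Q1 := Cmod_triangle_rev x z). assert (Q2 := Cmod_triangle_rev x w).
    assert (G1 : / Cmod (x - z) <= / d) by (apply Rinv_le_contravar; [exact Hd|unfold d; lra]).
    assert (G2 : / Cmod (x - w) <= / d) by (apply Rinv_le_contravar; [exact Hd|unfold d; lra]).
    assert (0 <= / Cmod (x - w)) by (left; apply Rinv_0_lt_compat; unfold d in Hd; lra).
    assert (0 <= / Cmod (x - z)) by (left; apply Rinv_0_lt_compat; unfold d in Hd; lra).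
    assert (Cmod (f x * x) <= M) by (apply HM; now rewrite Cminus_0_r).
    assert (0 <= Cmod (f x * x)) by apply Cmod_ge_0.
    repeat apply Rmult_le_compat; try easy; repeat apply Rmult_le_pos; easy.
Qed.

End Holomorphic.

Lemma pow_bounded_le_1 (t K : R) : 0 <= t -> (forall n, t ^ n <= K) -> t <= 1.
Proof.
  intros Ht H. apply Rnot_lt_le. intros Hlt.
  destruct (Pow_x_infinity t) with (b := (K + 1)%R) as [N HN]; [rewrite Rabs_pos_eq; lra|].
  specialize (HN N (Nat.le_refl N)). rewrite Rabs_pos_eq in HN by now apply pow_le.
  specialize (H N). lra.
Qed.

(* Landau's trick: Cauchy's formula bounds [f a ^ n] by a constant times [M ^ n], and the constant disappears after taking n-th roots. *)
Lemma maximum_principle (f : C -> C) (rho r M : R) (a : C) : Cmod a < r -> r < rho -> 0 < M ->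
  (forall z, Cmod z < rho -> cdiff f z) ->
  (forall z, Cmod z = r -> Cmod (f z) <= M) -> Cmod (f a) <= M.
Proof.
  intros Ha Hr HM Hf Hb. assert (P := Cmod_ge_0 a).
  assert (K : Cmod (f a) / M <= 1).
  { apply pow_bounded_le_1 with (K := (2 * (r / (r - Cmod a)))%R).
    - apply Rmult_le_pos; [apply Cmod_ge_0|left; now apply Rinv_0_lt_compat].
    - intros n.
      assert (Hfn : forall z, Cmod z < rho -> cdiff (fun z => f z ^ n) z).
      { intros z Hz. now apply cdiff_pow, Hf. }
      assert (E := cauchy_formula (fun z => f z ^ n) rho r a Ha Hr Hfn). simpl in E.
      unfold Rdiv at 1. rewrite Rpow_mult_distr, pow_inv.
      apply Rmult_le_reg_r with (M ^ n)%R; [now apply pow_lt|].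
      rewrite Rmult_assoc, Rinv_l, Rmult_1_r by (apply pow_nonzero; lra).
      rewrite <- Cmod_pow, <- E.
      replace (2 * (r / (r - Cmod a)) * M ^ n)%R with (2 * (M ^ n * (r * / (r - Cmod a))))%R
        by (unfold Rdiv; ring).
      apply avg_bound; [lra| |].
      + intros x Hx. assert (G := cdiff_cont _ _ (Hfn x ltac:(lra))). ccont_auto.
        now apply (circle_sub_neq r).
      + intros x Hx.
        assert (N := circle_sub_neq r x a Hx Ha).
        rewrite Cmod_div, Cmod_mult by easy. unfold Rdiv. rewrite Rmult_assoc.
        rewrite Cmod_pow, Hx.
        apply Rmult_le_compat.
        * apply pow_le, Cmod_ge_0.
        * apply Rmult_le_pos; [lra|]. left. apply Rinv_0_lt_compat. now apply Cmod_gt_0.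
        * apply pow_incr. split; [apply Cmod_ge_0|now apply Hb].
        * apply Rmult_le_compat_l; [lra|]. apply Rinv_le_contravar; [lra|].
          generalize (Cmod_triangle_rev x a). lra. }
  apply Rmult_le_compat_r with (r := M) in K; [|lra].
  unfold Rdiv in K. rewrite Rmult_assoc, Rinv_l, Rmult_1_r in K by lra. lra.
Qed.

Lemma schwarz_lemma (f : C -> C) (z : C) :
  (forall z, Cmod z < 1 -> cdiff f z) -> (forall z, Cmod z < 1 -> Cmod (f z) < 1) ->
  f 0 = 0 -> Cmod z < 1 -> Cmod (f z) <= Cmod z.
Proof.
  intros Hf Hb H0 Hz. apply Rnot_lt_le. intros Hlt.
  assert (P := Cmod_ge_0 z). assert (Hfz := Hb z Hz).
  set (x := Cmod z) in *. set (y := Cmod (f z)) in *.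
  (* If [y > x] then [x < r < 1] and [r * y = (x + y) / 2 > x], while the maximum principle on
     [|w| = r] gives [y * r <= x]. This one radius replaces the limit [r -> 1]. *)
  set (r := ((x + y) / (2 * y))%R).
  assert (Er : (r * y = (x + y) / 2)%R) by (unfold r; field; lra).
  assert (Hr1 : r < 1) by (apply Rmult_lt_reg_r with y; lra).
  assert (Hxr : x < r).
  { apply Rmult_lt_reg_r with y; [lra|]. rewrite Er.
    assert (x * y <= x * 1)%R by (apply Rmult_le_compat_l; lra). lra. }
  set (q := slope f 0 (C_derive f 0)).
  assert (Hc0 : Cmod 0 < 1) by (rewrite Cmod_0; lra).
  assert (K : Cmod (q z) <= / r).
  { apply (maximum_principle q 1 r); auto.
    - apply Rinv_0_lt_compat. lra.
    - intros w Hw. now apply (cdiff_slope f 1).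
    - intros w Hw. unfold q. rewrite slope_other.
      + rewrite H0, !Cminus_0_r, Cmod_div.
        * rewrite Hw. rewrite <- (Rmult_1_l (/ r)). apply Rmult_le_compat_r.
          -- left. apply Rinv_0_lt_compat. lra.
          -- left. apply Hb. lra.
        * intros ->. rewrite Cmod_0 in Hw. lra.
      + intros ->. rewrite Cmod_0 in Hw. lra. }
  assert (E : y = (Cmod (q z) * x)%R).
  { unfold y. rewrite (slope_spec f 0 (C_derive f 0) z) at 1. fold q.
    rewrite H0, Cminus_0_r, Cplus_0_l. apply Cmod_mult. }
  assert (y * r <= x)%R.
  { rewrite E. apply Rmult_le_compat_r with (r := (x * r)%R) in K; [|apply Rmult_le_pos; lra].
    replace (/ r * (x * r))%R with x in K by (field; lra). lra. }
  lra.
Qed.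

(** * Disk automorphisms and the Schwarz-Pick lemma *)

Lemma Cconj_R (x : R) : Cconj x = x.
Proof. unfold Cconj, RtoC. simpl. f_equal. ring. Qed.

(** The involutive disk automorphism exchanging [0] and [a]. Its modulus is the pseudo-hyperbolic
    distance of [a] and [z], the form in which hyperbolic distance is used everywhere. *)
Definition tau (a z : C) : C := (a - z) / (1 - Cconj a * z).

Lemma Cmod_lt_1_sub (c : C) : Cmod c < 1 -> 1 - c <> 0.
Proof. intros H. apply Csub_neq_0, Cmod_neq. rewrite Cmod_1. lra. Qed.

Lemma Cmod_conj_mult_lt_1 (a z : C) : Cmod a < 1 -> Cmod z < 1 -> Cmod (Cconj a * z) < 1.
Proof.
  intros Ha Hz. rewrite Cmod_mult, Cmod_conj.
  generalize (Cmod_ge_0 a) (Cmod_ge_0 z). intros. nra.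
Qed.

Lemma tau_denom (a z : C) : Cmod a < 1 -> Cmod z < 1 -> 1 - Cconj a * z <> 0.
Proof. intros. now apply Cmod_lt_1_sub, Cmod_conj_mult_lt_1. Qed.

Lemma tau_identity (a z : C) :
  (Cmod (1 - Cconj a * z) ^ 2 - Cmod (a - z) ^ 2 = (1 - Cmod a ^ 2) * (1 - Cmod z ^ 2))%R.
Proof.
  rewrite !Cmod2_alt. destruct a as [p q], z as [x y]. unfold Re, Im. simpl. ring.
Qed.

Lemma one_minus_sq_pos (x : R) : 0 <= x < 1 -> 0 < 1 - x ^ 2.
Proof. intros. nra. Qed.

Lemma Cmod_tau (a z : C) : Cmod a < 1 -> Cmod z < 1 ->
  Cmod (tau a z) = (Cmod (a - z) / Cmod (1 - Cconj a * z))%R.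
Proof. intros. unfold tau. apply Cmod_div. now apply tau_denom. Qed.

Lemma one_minus_tau_sq (a z : C) : Cmod a < 1 -> Cmod z < 1 ->
  (1 - Cmod (tau a z) ^ 2 = (1 - Cmod a ^ 2) * (1 - Cmod z ^ 2) / Cmod (1 - Cconj a * z) ^ 2)%R.
Proof.
  intros Ha Hz. rewrite Cmod_tau by easy. rewrite <- tau_identity. field.
  apply Rgt_not_eq. apply Cmod_gt_0. now apply tau_denom.
Qed.

Lemma tau_disk (a z : C) : Cmod a < 1 -> Cmod z < 1 -> Cmod (tau a z) < 1.
Proof.
  intros Ha Hz. assert (P := Cmod_ge_0 (tau a z)).
  assert (K := one_minus_tau_sq a z Ha Hz).
  assert (0 < (1 - Cmod a ^ 2) * (1 - Cmod z ^ 2) / Cmod (1 - Cconj a * z) ^ 2)%R.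
  { apply Rdiv_lt_0_compat.
    - apply Rmult_lt_0_compat; apply one_minus_sq_pos; split; try easy; apply Cmod_ge_0.
    - apply pow_lt, Cmod_gt_0. now apply tau_denom. }
  nra.
Qed.

Lemma tau_involutive (a z : C) : Cmod a < 1 -> Cmod z < 1 -> tau a (tau a z) = z.
Proof.
  intros Ha Hz. assert (N1 := tau_denom a z Ha Hz). assert (N2 := tau_denom a a Ha Ha).
  unfold tau. field. split; [easy|].
  replace (1 - Cconj a * z - Cconj a * (a - z)) with (1 - Cconj a * a) by ring. easy.
Qed.

Lemma tau_self (a : C) : tau a a = 0.
Proof. unfold tau, Cdiv. ring. Qed.

Lemma tau_0 (a : C) : tau a 0 = a.
Proof. unfold tau. field. Qed.

Lemma cdiff_tau (a z : C) : Cmod a < 1 -> Cmod z < 1 -> cdiff (tau a) z.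
Proof.
  intros Ha Hz. apply cdiff_div; [now apply tau_denom| |].
  - apply cdiff_minus; [apply cdiff_const|apply cdiff_id].
  - apply cdiff_minus; [apply cdiff_const|]. apply cdiff_mult; [apply cdiff_const|apply cdiff_id].
Qed.

Section SelfMap.
Variable phi : C -> C.
Hypothesis phi_holo : forall z, Cmod z < 1 -> cdiff phi z.
Hypothesis phi_disk : forall z, Cmod z < 1 -> Cmod (phi z) < 1.

Lemma schwarz_pick (a z : C) : Cmod a < 1 -> Cmod z < 1 ->
  Cmod (tau (phi a) (phi z)) <= Cmod (tau a z).
Proof.
  intros Ha Hz.
  assert (K := schwarz_lemma (fun w => tau (phi a) (phi (tau a w))) (tau a z)). simpl in K.
  rewrite tau_involutive in K by easy. apply K.
  - intros w Hw. assert (Hw' := tau_disk a w Ha Hw).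
    apply (cdiff_comp (tau (phi a)) (fun w => phi (tau a w))).
    + apply cdiff_tau; now apply phi_disk.
    + apply (cdiff_comp phi (tau a)); [now apply phi_holo|now apply cdiff_tau].
  - intros w Hw. apply tau_disk; apply phi_disk; [easy|now apply tau_disk].
  - rewrite tau_0. apply tau_self.
  - now apply tau_disk.
Qed.

End SelfMap.

(* Apply Schwarz-Pick to [s q], [s < 1], and let [s] tend to [1]: two distinct points of the unit circle are at infinite hyperbolic distance. *)
Lemma unimodular_constant (q : C -> C) (z : C) :
  (forall z, Cmod z < 1 -> cdiff q z) -> (forall z, Cmod z < 1 -> Cmod (q z) = 1%R) ->
  Cmod z < 1 -> q z = q 0.
Proof.
  intros Hq Hb Hz. assert (H0 : Cmod 0 < 1) by (rewrite Cmod_0; lra).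
  set (c := q 0). set (d := q z).
  assert (Hc : Cmod c = 1%R) by now apply Hb. assert (Hd : Cmod d = 1%R) by now apply Hb.
  assert (Pz := Cmod_ge_0 z).
  (* For unimodular [c] and [d] the numerator and denominator of [tau c d] have the same modulus.
     So, if [c <> d], the distance of [s * c] and [s * d] tends to 1, although Schwarz-Pick bounds
     it by [|z| < 1]; [K] makes this quantitative. *)
  assert (E : Cmod (1 - Cconj c * d) = Cmod (c - d)).
  { replace (1 - Cconj c * d) with (Cconj c * (c - d)).
    - rewrite Cmod_mult, Cmod_conj, Hc. ring.
    - assert (K := Cmod2_conj c). rewrite Hc in K.
      replace (RtoC (1 ^ 2)) with (RtoC 1) in K by (f_equal; ring). rewrite K. ring. }
  assert (Hcd : Cmod (c - d) <= 2).
  { unfold Cminus. eapply Rle_trans; [apply Cmod_triangle|]. rewrite Cmod_opp. lra. }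
  assert (K : forall s : R, 0 <= s -> s < 1 -> Cmod (c - d) * (1 - Cmod z) <= 4 * (1 - s)).
  { intros s Hs0 Hs1.
    assert (B : forall w, Cmod w < 1 -> Cmod (s * q w) < 1).
    { intros w Hw. rewrite Cmod_mult, Hb, Cmod_RtoC_pos by easy. lra. }
    assert (S := schwarz_pick (fun w => s * q w)
      (fun w Hw => cdiff_mult _ _ _ (cdiff_const s w) (Hq w Hw)) B 0 z H0 Hz).
    simpl in S. fold c d in S.
    rewrite !Cmod_tau in S by (try easy; now apply B).
    replace (1 - Cconj 0 * z) with (RtoC 1) in S by (rewrite Cconj_R; ring).
    replace (0 - z) with (- z) in S by ring. rewrite Cmod_opp, Cmod_1 in S.
    assert (N : 0 < Cmod (1 - Cconj (s * c) * (s * d))).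
    { apply Cmod_gt_0. apply tau_denom; now apply B. }
    apply Rmult_le_compat_r with (r := Cmod (1 - Cconj (s * c) * (s * d))) in S; [|lra].
    unfold Rdiv in S. rewrite Rmult_assoc, Rinv_l, Rmult_1_r, Rinv_1, Rmult_1_r in S by lra.
    replace (s * c - s * d) with (s * (c - d)) in S by ring.
    rewrite Cmod_mult, Cmod_RtoC_pos in S by easy.
    assert (U : Cmod (1 - Cconj (s * c) * (s * d)) <= Cmod (c - d) + 2 * (1 - s)).
    { replace (1 - Cconj (s * c) * (s * d)) with ((1 - Cconj c * d) + (1 - s * s) * (Cconj c * d)).
      - eapply Rle_trans; [apply Cmod_triangle|]. rewrite E, !Cmod_mult, Cmod_conj, Hc, Hd.
        rewrite <- RtoC_mult, <- RtoC_minus, Cmod_RtoC_pos by nra. nra.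
      - rewrite Cmult_conj, Cconj_R. ring. }
    assert (Cmod z * Cmod (1 - Cconj (s * c) * (s * d)) <= Cmod z * (Cmod (c - d) + 2 * (1 - s)))%R
      by now apply Rmult_le_compat_l.
    assert (Cmod z * (2 * (1 - s)) <= 1 * (2 * (1 - s)))%R by (apply Rmult_le_compat_r; lra).
    assert (Cmod (c - d) * (1 - s) <= 2 * (1 - s))%R by (apply Rmult_le_compat_r; lra).
    lra. }
  symmetry. apply Cmod_sub_zero.
  apply Rle_antisym; [|apply Cmod_ge_0]. apply Rnot_lt_le. intros Hpos.
  fold c d in Hpos.
  assert (Hy : 0 < Cmod (c - d) * (1 - Cmod z)) by (apply Rmult_lt_0_compat; lra).
  set (y := (Cmod (c - d) * (1 - Cmod z))%R) in *.
  specialize (K (1 - Rmin 1 (y / 8)))%R.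
  assert (M1 := Rmin_l 1 (y / 8)). assert (M2 := Rmin_r 1 (y / 8)).
  assert (0 < Rmin 1 (y / 8)) by (apply Rmin_pos; lra). lra.
Qed.

(** The quotient [phi z / z] has modulus 1 off [0], hence at [0] by continuity, and so is
    constant. *)
Lemma isometry_at_0_is_rotation (phi : C -> C) :
  (forall z, Cmod z < 1 -> cdiff phi z) -> (forall z, Cmod z < 1 -> Cmod (phi z) = Cmod z) ->
  exists l, Cmod l = 1%R /\ forall z, Cmod z < 1 -> phi z = l * z.
Proof.
  intros Hphi Hmod. set (q := slope phi 0 (C_derive phi 0)).
  assert (H0 : Cmod 0 < 1) by (rewrite Cmod_0; lra).
  assert (P0 : phi 0 = 0) by (apply Cmod_eq_0; rewrite Hmod, Cmod_0 by easy; easy).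
  assert (Hq : forall z, Cmod z < 1 -> cdiff q z) by (intros; now apply (cdiff_slope phi 1)).
  assert (Hq1 : forall z : C, z <> 0 -> Cmod z < 1 -> Cmod (q z) = 1%R).
  { intros z Hn Hz. unfold q. rewrite slope_other by easy. rewrite P0, !Cminus_0_r.
    rewrite Cmod_div by easy. rewrite Hmod by easy.
    field. now apply Rgt_not_eq, Cmod_gt_0. }
  assert (Hq0 : Cmod (q 0) = 1%R).
  { apply cond_eq. intros e He.
    destruct (cdiff_cont _ _ (Hq 0 H0) e He) as [d [Hd K]].
    set (x := Rmin (1 / 2) (d / 2)).
    assert (X1 := Rmin_l (1 / 2) (d / 2)). assert (X2 := Rmin_r (1 / 2) (d / 2)). fold x in X1, X2.
    assert (Hx : 0 < x) by (apply Rmin_pos; lra).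
    assert (Hxm : Cmod x = x) by (apply Cmod_RtoC_pos; lra).
    assert (Q : Cmod (q x) = 1%R).
    { apply Hq1; [apply Cmod_gt_0|]; rewrite Hxm; lra. }
    rewrite <- Q. rewrite Rabs_minus_sym. apply Cmod_adherent. apply K.
    unfold cdist. rewrite Cminus_0_r, Hxm. lra. }
  exists (q 0). split; [easy|]. intros z Hz.
  rewrite <- (unimodular_constant q z); auto.
  - rewrite (slope_spec phi 0 (C_derive phi 0) z). fold q. rewrite P0. ring.
  - intros w Hw. destruct (classic (w = 0)) as [->|Hn]; auto.
Qed.

Lemma isometry_at_fixed_point (phi : C -> C) (a : C) :
  (forall z, Cmod z < 1 -> cdiff phi z) -> (forall z, Cmod z < 1 -> Cmod (phi z) < 1) ->
  Cmod a < 1 -> (forall z, Cmod z < 1 -> Cmod (tau a (phi z)) = Cmod (tau a z)) ->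
  exists l, Cmod l = 1%R /\ forall z, Cmod z < 1 -> phi z = tau a (l * tau a z).
Proof.
  intros Hphi Hdisk Ha Hiso.
  destruct (isometry_at_0_is_rotation (fun w => tau a (phi (tau a w)))) as [l [Hl H]].
  - intros w Hw. assert (Hw' := tau_disk a w Ha Hw).
    apply (cdiff_comp (tau a) (fun w => phi (tau a w))).
    + apply cdiff_tau; [easy|now apply Hdisk].
    + apply (cdiff_comp phi (tau a)); [now apply Hphi|now apply cdiff_tau].
  - intros w Hw. rewrite Hiso by now apply tau_disk. now rewrite tau_involutive.
  - exists l. split; [easy|]. intros z Hz.
    rewrite <- H by now apply tau_disk. rewrite (tau_involutive a z), tau_involutive; auto.
Qed.

Lemma rotation_iter (phi : C -> C) (a l : C) : Cmod a < 1 -> Cmod l = 1%R ->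
  (forall z, Cmod z < 1 -> phi z = tau a (l * tau a z)) ->
  forall n z, Cmod z < 1 -> Nat.iter n phi z = tau a (l ^ n * tau a z).
Proof.
  intros Ha Hl H n z Hz. assert (Ht := tau_disk a z Ha Hz).
  assert (B : forall k, Cmod (l ^ k * tau a z) < 1).
  { intros k. rewrite Cmod_mult, Cmod_pow, Hl, pow1. lra. }
  induction n as [|n IH]; simpl.
  - rewrite Cmult_1_l. symmetry. now apply tau_involutive.
  - rewrite IH, H by (apply tau_disk; auto).
    rewrite (tau_involutive a (l ^ n * tau a z)) by auto. f_equal. ring.
Qed.

Lemma rotation_conformal (phi : C -> C) (a l : C) : Cmod a < 1 -> Cmod l = 1%R ->
  (forall z, Cmod z < 1 -> phi z = tau a (l * tau a z)) -> conformal_aut_D phi.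
Proof.
  intros Ha Hl H. assert (Nl : l <> 0) by (apply Cmod_gt_0; rewrite Hl; lra).
  assert (B : forall z, Cmod z < 1 -> Cmod (l * tau a z) < 1).
  { intros z Hz. rewrite Cmod_mult, Hl, Rmult_1_l. now apply tau_disk. }
  assert (Naa := tau_denom a a Ha Ha).
  assert (D : forall z, Cmod z < 1 -> Cconj a * (l - 1) * z + (1 - l * (Cconj a * a)) <> 0).
  { intros z Hz. assert (N1 := tau_denom a z Ha Hz). assert (N2 := tau_denom a _ Ha (B z Hz)).
    replace (Cconj a * (l - 1) * z + (1 - l * (Cconj a * a)))
      with ((1 - Cconj a * z) * (1 - Cconj a * (l * tau a z))); [now apply Cmult_neq_0|].
    unfold tau. field. easy. }
  (* The matrix of [tau a] followed by multiplication by [l] and again [tau a]; its determinant is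
     [l (1 - |a|^2)^2]. *)
  exists (l - Cconj a * a), (a * (1 - l)), (Cconj a * (l - 1)), (1 - l * (Cconj a * a)).
  split; [|split; [|split]].
  - replace ((l - Cconj a * a) * (1 - l * (Cconj a * a)) - a * (1 - l) * (Cconj a * (l - 1)))
      with (l * ((1 - Cconj a * a) * (1 - Cconj a * a))) by ring.
    repeat apply Cmult_neq_0; easy.
  - intros z Hz. split; [now apply D|].
    rewrite H by easy. assert (N1 := tau_denom a z Ha Hz). assert (N2 := tau_denom a _ Ha (B z Hz)).
    assert (N3 := D z Hz). unfold tau in N2 |- *. field. now split.
  - intros z Hz. unfold in_disk in *. rewrite H by easy. apply tau_disk; auto.
  - intros w Hw. exists (tau a (/ l * tau a w)).
    assert (Ht := tau_disk a w Ha Hw).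
    assert (Hm : Cmod (/ l * tau a w) < 1).
    { rewrite Cmod_mult, Cmod_inv, Hl, Rinv_1, Rmult_1_l by easy. easy. }
    split; [now apply tau_disk|]. rewrite H by now apply tau_disk.
    rewrite (tau_involutive a (/ l * tau a w)) by easy.
    replace (l * (/ l * tau a w)) with (tau a w) by (field; easy). now apply tau_involutive.
Qed.

(** * Recurrence, injectivity and fixed points *)

Lemma holo_D_cdiff (f : C -> C) : holo_D f <-> forall z, Cmod z < 1 -> cdiff f z.
Proof. split; intros H z Hz; apply ex_derive_cdiff; now apply H. Qed.

Lemma iter_comp_op (phi f : C -> C) (k : nat) (z : C) :
  Nat.iter k (comp_op phi) f z = f (Nat.iter k phi z).
Proof.
  revert z. induction k as [|k IH]; intros z; [easy|].
  change (Nat.iter k (comp_op phi) f (phi z) = f (Nat.iter (S k) phi z)).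
  rewrite Nat.iter_succ_r. apply IH.
Qed.

Lemma iter_disk (phi : C -> C) : self_map_D phi ->
  forall k z, Cmod z < 1 -> Cmod (Nat.iter k phi z) < 1.
Proof. intros [_ H] k z Hz. induction k as [|k IH]; [easy|]. now apply H. Qed.

Lemma iter_holo (phi : C -> C) : self_map_D phi ->
  forall k z, Cmod z < 1 -> cdiff (Nat.iter k phi) z.
Proof.
  intros Hphi k z Hz. induction k as [|k IH]; [apply cdiff_id|].
  apply (cdiff_comp phi (Nat.iter k phi)); [|easy].
  apply (proj1 (holo_D_cdiff phi) (proj1 Hphi)). now apply iter_disk.
Qed.

Lemma iter_comp_op_holo (phi f : C -> C) (k : nat) : self_map_D phi -> holo_D f ->
  holo_D (Nat.iter k (comp_op phi) f).
Proof.
  intros Hphi Hf. apply holo_D_cdiff. intros z Hz.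
  apply (cdiff_ext (fun z => f (Nat.iter k phi z))).
  { intros w. symmetry. apply iter_comp_op. }
  apply (cdiff_comp f (Nat.iter k phi)); [|now apply iter_holo].
  apply (proj1 (holo_D_cdiff f) Hf). now apply iter_disk.
Qed.

(** The intermediate [e' < e] says that the supremum is below [e]; with a pointwise strict
    inequality, openness would call for a compactness argument. *)
Lemma open_HD_disk_ball (f0 : C -> C) (r e : R) : 0 <= r -> r < 1 ->
  open_HD (fun f => holo_D f /\ exists e', e' < e /\ forall z, Cmod z <= r -> Cmod (f z - f0 z) <= e').
Proof.
  intros Hr0 Hr1 f [Hf [e' [He' H]]]. split; [easy|].
  exists r, ((e - e') / 2)%R. repeat split; try easy; [lra|].
  exists ((e + e') / 2)%R. split; [lra|]. intros z Hz.
  specialize (H z Hz). specialize (H1 z Hz).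
  generalize (Cmod_sub_triangle (g z) (f z) (f0 z)). lra.
Qed.

Lemma recurrent_injective (phi : C -> C) : self_map_D phi -> recurrent_comp_op phi -> univalent_D phi.
Proof.
  intros Hphi Hrec. split; [apply Hphi|]. intros a b Ha Hb E. apply NNPP. intros Hab.
  unfold in_disk in *.
  set (U := fun f : C -> C => holo_D f /\ Cmod (f a) < 1 / 2 /\ Cmod (f b - 1) < 1 / 2).
  assert (HU : open_HD U).
  { intros f [Hf [F1 F2]]. split; [easy|].
    exists (Rmax (Cmod a) (Cmod b)), (Rmin (1 / 2 - Cmod (f a)) (1 / 2 - Cmod (f b - 1))).
    split; [eapply Rle_trans; [apply (Cmod_ge_0 a)|apply Rmax_l]|].
    split; [now apply Rmax_lub_lt|]. split; [apply Rmin_pos; lra|].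
    intros g Hg H. split; [easy|].
    assert (G1 := H a (Rmax_l _ _)). assert (G2 := H b (Rmax_r _ _)).
    assert (M1 := Rmin_l (1 / 2 - Cmod (f a)) (1 / 2 - Cmod (f b - 1))).
    assert (M2 := Rmin_r (1 / 2 - Cmod (f a)) (1 / 2 - Cmod (f b - 1))).
    assert (T1 := Cmod_triangle_rev (g a) (f a)).
    assert (T2 := Cmod_sub_triangle (g b) (f b) 1). lra. }
  destruct (Hrec U HU) as [k [Hk [f [[Hf [F1 F2]] [Hg [G1 G2]]]]]].
  - assert (N : b - a <> 0) by (apply Csub_neq_0; auto).
    exists (fun z => (z - a) / (b - a)). split; [|split].
    + apply holo_D_cdiff. intros z Hz. apply cdiff_div; [easy| |apply cdiff_const].
      apply cdiff_minus; [apply cdiff_id|apply cdiff_const].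
    + replace ((a - a) / (b - a)) with (RtoC 0) by (field; easy). rewrite Cmod_0. lra.
    + replace ((b - a) / (b - a) - 1) with (RtoC 0) by (field; easy). rewrite Cmod_0. lra.
  (* As [k >= 1], the iterate factors through [phi a = phi b], so a single value [v] would lie
     within [1/2] of both [0] and [1]. *)
  - rewrite iter_comp_op in G1, G2. destruct k as [|k]; [lia|].
    rewrite Nat.iter_succ_r in G1, G2. rewrite E in G1.
    set (v := f (Nat.iter k phi (phi b))) in *.
    rewrite Cmod_sub_comm in G2. generalize (Cmod_triangle_rev 1 v). rewrite Cmod_1. lra.
Qed.

(** Hyperbolic balls of bounded radius with centres in a compact set stay in a compact set. As the
    denominator of [tau] is at most 2, [1 - |tau a u|^2 >= c], and [1 - c <= (1 - c/2)^2]. *)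
Lemma tau_ball_bounded (s t : R) : 0 <= s < 1 -> 0 <= t < 1 ->
  exists r, 0 <= r < 1 /\ forall a u, Cmod a <= t -> Cmod u <= s -> Cmod (tau a u) <= r.
Proof.
  intros Hs Ht.
  assert (P1 := one_minus_sq_pos s Hs). assert (P2 := one_minus_sq_pos t Ht).
  set (c := ((1 - t ^ 2) * (1 - s ^ 2) / 4)%R).
  assert (Hc : 0 < c) by (unfold c; apply Rdiv_lt_0_compat; [now apply Rmult_lt_0_compat|lra]).
  assert (Hc1 : c <= 1 / 4).
  { unfold c. assert ((1 - t ^ 2) * (1 - s ^ 2) <= 1 * 1)%R; [|lra].
    apply Rmult_le_compat; nra. }
  exists (1 - c / 2)%R. split; [lra|]. intros a u Ha Hu.
  assert (Pa := Cmod_ge_0 a). assert (Pu := Cmod_ge_0 u).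
  assert (E := one_minus_tau_sq a u ltac:(lra) ltac:(lra)).
  assert (N : 0 < Cmod (1 - Cconj a * u)) by (apply Cmod_gt_0, tau_denom; lra).
  assert (N2 : Cmod (1 - Cconj a * u) <= 2).
  { unfold Cminus. eapply Rle_trans; [apply Cmod_triangle|].
    rewrite Cmod_1, Cmod_opp. assert (K := Cmod_conj_mult_lt_1 a u ltac:(lra) ltac:(lra)). lra. }
  set (m := Cmod (1 - Cconj a * u)) in *.
  assert (L : c <= 1 - Cmod (tau a u) ^ 2).
  { rewrite E. apply Rmult_le_reg_r with (m ^ 2)%R; [now apply pow_lt|].
    unfold Rdiv at 1. rewrite Rmult_assoc, Rinv_l, Rmult_1_r by (apply Rgt_not_eq; now apply pow_lt).
    apply Rle_trans with (c * 4)%R; [apply Rmult_le_compat_l; nra|].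
    unfold c. replace ((1 - t ^ 2) * (1 - s ^ 2) / 4 * 4)%R with ((1 - t ^ 2) * (1 - s ^ 2))%R by field.
    apply Rmult_le_compat; nra. }
  assert (P := Cmod_ge_0 (tau a u)). apply Rnot_lt_le. intros K. nra.
Qed.

(* Recurrence applied to small neighbourhoods of the identity function brings every point back close to itself, while [phi] cannot increase the hyperbolic distance to its fixed point. *)
Lemma recurrent_fixed_point_isometry (phi : C -> C) (a : C) : self_map_D phi -> recurrent_comp_op phi ->
  Cmod a < 1 -> phi a = a -> forall z, Cmod z < 1 -> Cmod (tau a (phi z)) = Cmod (tau a z).
Proof.
  intros Hphi Hrec Ha Hfix z Hz. destruct Hphi as [Hh Hd]. assert (Hphi : self_map_D phi) by now split.
  assert (Hh' := proj1 (holo_D_cdiff phi) Hh).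
  assert (SP : forall w, Cmod w < 1 -> Cmod (tau a (phi w)) <= Cmod (tau a w)).
  { intros w Hw. rewrite <- Hfix at 1. now apply schwarz_pick. }
  assert (SPn : forall n w, Cmod w < 1 -> Cmod (tau a (Nat.iter n phi w)) <= Cmod (tau a w)).
  { induction n as [|n IH]; intros w Hw; [simpl; lra|]. simpl.
    eapply Rle_trans; [apply SP; now apply iter_disk|now apply IH]. }
  apply Rle_antisym; [now apply SP|]. apply le_epsilon. intros E HE.
  destruct (cdiff_cont _ _ (cdiff_tau a z Ha Hz) E HE) as [d [Hdp Hcont]].
  assert (Ht := tau_disk a z Ha Hz).
  (* Orbits never move away from [a], so this radius contains [z] together with its whole orbit, and
     one neighbourhood of the identity controls [f] at [z] and at its iterate. *)
  destruct (tau_ball_bounded (Cmod (tau a z)) (Cmod a)) as [r [Hr Hball]];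
    [split; [apply Cmod_ge_0|easy]|split; [apply Cmod_ge_0|easy]|].
  assert (Hin : forall w, Cmod w < 1 -> Cmod (tau a w) <= Cmod (tau a z) -> Cmod w <= r).
  { intros w Hw H. rewrite <- (tau_involutive a w Ha Hw). apply Hball; [lra|easy]. }
  destruct (Hrec _ (open_HD_disk_ball (fun w => w) r (d / 2) (proj1 Hr) (proj2 Hr)))
    as [k [Hk [f [[Hf [e1 [He1 F]]] [Hg [e2 [He2 G]]]]]]].
  - exists (fun w => w). split; [apply holo_D_cdiff; intros; apply cdiff_id|].
    exists 0%R. split; [lra|]. intros w _. replace (w - w) with (RtoC 0) by ring. rewrite Cmod_0. lra.
  - specialize (G z (Hin z Hz (Rle_refl _))). rewrite iter_comp_op in G.
    set (w := Nat.iter k phi z) in *.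
    assert (Hw : Cmod w < 1) by now apply iter_disk.
    specialize (F w (Hin w Hw (SPn k z Hz))).
    assert (Hwz : Cmod (w - z) < d).
    { generalize (Cmod_sub_triangle w (f w) z). rewrite (Cmod_sub_comm w (f w)). lra. }
    assert (K := Cmod_adherent _ _ _ (Hcont w Hwz)). apply Rabs_lt_between in K.
    (* As [k >= 1], [w] lies on the orbit of [phi z]. Being also close to [z], it forces the
       distance of [phi z] to [a] up to that of [z], within [E]. *)
    assert (Cmod (tau a w) <= Cmod (tau a (phi z))).
    { unfold w. destruct k as [|k]; [lia|]. rewrite Nat.iter_succ_r. apply SPn. now apply Hd. }
    lra.
Qed.

(** Schwarz-Pick for [phi] gives one inequality, for its inverse the other. The inverse is written
    as the explicit linear fractional map [chi], whose differentiability is immediate. *)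
Lemma elliptic_isometry (phi : C -> C) (p : C) : self_map_D phi -> conformal_aut_D phi ->
  Cmod p < 1 -> phi p = p -> forall z, Cmod z < 1 -> Cmod (tau p (phi z)) = Cmod (tau p z).
Proof.
  intros [Hh Hd] [a [b [c [d [Hdet [Hform [_ Hsurj]]]]]]] Hp Hfix z Hz.
  assert (Hh' := proj1 (holo_D_cdiff phi) Hh).
  apply Rle_antisym.
  { rewrite <- Hfix at 1. now apply schwarz_pick. }
  set (chi := fun w => (d * w - b) / (a - c * w)).
  (* By surjectivity [w = phi u], and then [a = c * w] would make the determinant vanish. *)
  assert (Hden : forall w, Cmod w < 1 -> a - c * w <> 0).
  { intros w Hw K. destruct (Hsurj w Hw) as [u [Hu E]]. destruct (Hform u Hu) as [N Fu].
    rewrite E in Fu. apply Hdet. rewrite Fu in K.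
    replace (a * d - b * c) with ((a - c * ((a * u + b) / (c * u + d))) * (c * u + d)) by (field; easy).
    rewrite K. ring. }
  assert (Hinv : forall u, Cmod u < 1 -> chi (phi u) = u).
  { intros u Hu. destruct (Hform u Hu) as [N Fu]. assert (N2 := Hden _ (Hd u Hu)).
    unfold chi. rewrite Fu in *.
    assert (N3 : a * (c * u + d) - c * (a * u + b) <> 0).
    { replace (a * (c * u + d) - c * (a * u + b)) with (a * d - b * c) by ring. easy. }
    field. now split. }
  assert (Hchi : forall w, Cmod w < 1 -> Cmod (chi w) < 1).
  { intros w Hw. destruct (Hsurj w Hw) as [u [Hu <-]]. now rewrite Hinv. }
  rewrite <- (Hinv p Hp) at 1. rewrite <- (Hinv z Hz) at 1.
  rewrite Hfix. apply (schwarz_pick chi); auto; [|now apply Hd].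
  intros w Hw. apply cdiff_div; [now apply Hden| |].
  - apply cdiff_minus; [apply cdiff_mult; [apply cdiff_const|apply cdiff_id]|apply cdiff_const].
  - apply cdiff_minus; [apply cdiff_const|apply cdiff_mult; [apply cdiff_const|apply cdiff_id]].
Qed.

(** Two powers near a common cluster point are close to each other; dividing by the lower one is an
    isometry. *)
Lemma unit_power_return (l : C) (e : R) : Cmod l = 1%R -> 0 < e ->
  exists k, (1 <= k)%nat /\ Cmod (l ^ k - 1) < e.
Proof.
  intros Hl He. destruct (bounded_adherent (fun n => l ^ n) 1) as [p Hp].
  { intros n. rewrite Cmod_pow, Hl, pow1. lra. }
  destruct (Hp (e / 2)%R O) as [n [_ Hn]]; [lra|].
  destruct (Hp (e / 2)%R (S n)) as [m [Hm Km]]; [lra|].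
  exists (m - n)%nat. split; [lia|].
  assert (E : Cmod (l ^ m - l ^ n) = Cmod (l ^ (m - n) - 1)).
  { replace (l ^ m) with (l ^ (m - n) * l ^ n) by (rewrite <- Cpow_add_r; f_equal; lia).
    replace (l ^ (m - n) * l ^ n - l ^ n) with ((l ^ (m - n) - 1) * l ^ n) by ring.
    rewrite Cmod_mult, Cmod_pow, Hl, pow1. ring. }
  rewrite <- E. generalize (Cmod_sub_triangle (l ^ m) p (l ^ n)). rewrite (Cmod_sub_comm p). lra.
Qed.

Lemma tau_lipschitz (a u v : C) : Cmod a < 1 -> Cmod u < 1 -> Cmod v < 1 ->
  Cmod (tau a u - tau a v) <= / (1 - Cmod a) * / (1 - Cmod a) * Cmod (u - v).
Proof.
  intros Ha Hu Hv. assert (Nu := tau_denom a u Ha Hu). assert (Nv := tau_denom a v Ha Hv).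
  assert (Pa := Cmod_ge_0 a).
  replace (tau a u - tau a v) with ((Cconj a * a - 1) * (/ (1 - Cconj a * u) * / (1 - Cconj a * v)) * (u - v))
    by (unfold tau; field; now split).
  rewrite !Cmod_mult, !Cmod_inv by easy.
  apply Rmult_le_compat_r; [apply Cmod_ge_0|].
  assert (B : forall w, Cmod w < 1 -> 1 - Cmod a <= Cmod (1 - Cconj a * w)).
  { intros w Hw. assert (T := Cmod_triangle_rev 1 (Cconj a * w)).
    rewrite Cmod_1, Cmod_mult, Cmod_conj in T. assert (Pw := Cmod_ge_0 w). nra. }
  assert (Cmod (Cconj a * a - 1) <= 1).
  { rewrite Cmult_comm, <- Cmod2_conj, <- RtoC_minus, Cmod_R. apply Rabs_le. nra. }
  assert (I : forall w, Cmod w < 1 -> 0 <= / Cmod (1 - Cconj a * w) <= / (1 - Cmod a)).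
  { intros w Hw. assert (Bw := B w Hw). split; [left; apply Rinv_0_lt_compat; lra|].
    apply Rinv_le_contravar; lra. }
  destruct (I u Hu), (I v Hv).
  rewrite <- (Rmult_1_l (/ (1 - Cmod a) * / (1 - Cmod a))).
  apply Rmult_le_compat; try easy; [apply Cmod_ge_0|now apply Rmult_le_pos|].
  now apply Rmult_le_compat.
Qed.

Lemma rotation_recurrent (phi : C -> C) (a l : C) : self_map_D phi -> Cmod a < 1 -> Cmod l = 1%R ->
  (forall z, Cmod z < 1 -> phi z = tau a (l * tau a z)) -> recurrent_comp_op phi.
Proof.
  intros Hphi Ha Hl Hrot U HU [f Hf].
  destruct (HU f Hf) as [Hfh [r [eps [Hr0 [Hr1 [Heps H]]]]]].
  (* A suitable iterate moves points of [|z| <= r] by at most [dl <= (1 - r) / 2], so they stay in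
     this larger disk. With [L * dl < eps], the function [f] itself returns to [U]. *)
  destruct (holo_lipschitz f 1 (proj1 (holo_D_cdiff f) Hfh) ((1 + r) / 2)) as [L [HL Hlip]]; [lra|lra|].
  assert (Pa := Cmod_ge_0 a).
  set (K := (/ (1 - Cmod a) * / (1 - Cmod a))%R).
  assert (HK : 0 < K) by (apply Rmult_lt_0_compat; apply Rinv_0_lt_compat; lra).
  set (dl := Rmin ((1 - r) / 2) (eps / (2 * L))).
  assert (Hdl : 0 < dl) by (apply Rmin_pos; [lra|apply Rdiv_lt_0_compat; lra]).
  assert (D1 : dl <= (1 - r) / 2) by apply Rmin_l.
  assert (D2 : L * dl < eps).
  { assert (Q : dl <= eps / (2 * L)) by apply Rmin_r.
    apply Rmult_le_compat_l with (r := L) in Q; [|lra].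
    replace (L * (eps / (2 * L)))%R with (eps / 2)%R in Q by (field; lra). lra. }
  destruct (unit_power_return l (dl / K) Hl) as [k [Hk Hlk]]; [now apply Rdiv_lt_0_compat|].
  exists k. split; [easy|]. exists f. split; [easy|].
  apply H; [now apply iter_comp_op_holo|].
  intros z Hz. rewrite iter_comp_op.
  assert (Hz1 : Cmod z < 1) by lra.
  assert (Hmove : Cmod (Nat.iter k phi z - z) <= dl).
  { rewrite (rotation_iter phi a l Ha Hl Hrot k z Hz1).
    assert (Ht := tau_disk a z Ha Hz1).
    assert (Hlt : Cmod (l ^ k * tau a z) < 1) by (rewrite Cmod_mult, Cmod_pow, Hl, pow1; lra).
    rewrite <- (tau_involutive a z Ha Hz1) at 2.
    eapply Rle_trans; [now apply tau_lipschitz|]. fold K.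
    replace (l ^ k * tau a z - tau a z) with ((l ^ k - 1) * tau a z) by ring.
    rewrite Cmod_mult.
    apply Rle_trans with (K * (dl / K * 1))%R; [|right; field; lra].
    apply Rmult_le_compat_l; [lra|]. apply Rmult_le_compat; try apply Cmod_ge_0; lra. }
  assert (T := Cmod_triangle_rev (Nat.iter k phi z) z).
  eapply Rle_lt_trans; [apply Hlip; lra|].
  eapply Rle_lt_trans; [apply Rmult_le_compat_l; [lra|apply Hmove]|easy].
Qed.

Lemma elliptic_recurrent (phi : C -> C) : self_map_D phi -> elliptic_aut_D phi -> recurrent_comp_op phi.
Proof.
  intros Hphi [Hconf [a [Ha Hfix]]].
  destruct (isometry_at_fixed_point phi a) as [l [Hl H]].
  - apply holo_D_cdiff, Hphi.
  - apply Hphi.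
  - exact Ha.
  - now apply elliptic_isometry.
  - now apply (rotation_recurrent phi a l).
Qed.

Lemma recurrent_necessary (phi : C -> C) : self_map_D phi -> recurrent_comp_op phi ->
  (univalent_D phi /\ ~ has_fixed_point_D phi) \/ elliptic_aut_D phi.
Proof.
  intros Hphi Hrec. destruct (classic (has_fixed_point_D phi)) as [Hfp|Hnf].
  - right. split; [|easy]. destruct Hfp as [a [Ha Hfix]].
    destruct (isometry_at_fixed_point phi a) as [l [Hl H]].
    + apply holo_D_cdiff, Hphi.
    + apply Hphi.
    + exact Ha.
    + now apply recurrent_fixed_point_isometry.
    + now apply (rotation_conformal phi a l).
  - left. split; [now apply recurrent_injective|easy].
Qed.

(** * Escape of fixed-point-free maps *)

Lemma approximate_fixed_point (F : C -> C) (r : R) : (forall z, Cmod z <= r -> ccont F z) ->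
  (forall e, 0 < e -> exists z, Cmod z <= r /\ Cmod (F z - z) < e) ->
  exists z, Cmod z <= r /\ F z = z.
Proof.
  intros HF Happ. apply NNPP. intros Hno.
  destruct (compact_away_from_0 (fun z => Cmod z <= r) (fun z => F z - z)) as [m [Hm H]].
  - apply compact_disk.
  - intros z Hz. split; [apply cont_at_minus; [now apply HF|apply ccont_id]|].
    apply Csub_neq_0. intros E. apply Hno. now exists z.
  - destruct (Happ m Hm) as [z [Hz K]]. specialize (H z Hz). simpl in H. lra.
Qed.

Lemma pow2_le_inv (x y : R) : 0 <= y -> x ^ 2 <= y ^ 2 -> x <= y.
Proof. intros Hy H. apply Rnot_lt_le. intros K. nra. Qed.

(** Schwarz-Pick alone gives no strict contraction; here the factor is below 1 and independent of
    the points. *)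
Lemma dilation_contracts (s : R) (u v : C) : 0 < s < 1 -> Cmod u < 1 -> Cmod v < 1 ->
  Cmod (tau (s * u) (s * v)) <= 2 * s / (1 + s * s) * Cmod (tau u v).
Proof.
  intros Hs Hu Hv.
  assert (Hs1 : forall w, Cmod w < 1 -> Cmod (s * w) < 1).
  { intros w Hw. rewrite Cmod_mult, Cmod_RtoC_pos by lra. assert (P := Cmod_ge_0 w). nra. }
  rewrite !Cmod_tau by auto.
  assert (N1 : 0 < Cmod (1 - Cconj u * v)) by (apply Cmod_gt_0; now apply tau_denom).
  assert (N2 : 0 < Cmod (1 - Cconj (s * u) * (s * v))) by (apply Cmod_gt_0; apply tau_denom; auto).
  replace (s * u - s * v) with (s * (u - v)) by ring.
  rewrite Cmult_conj, Cconj_R in *.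
  replace (s * Cconj u * (s * v)) with ((s * s)%R * (Cconj u * v)) in * by (rewrite RtoC_mult; ring).
  assert (Hc := Cmod_conj_mult_lt_1 u v Hu Hv).
  set (c := Cconj u * v) in *.
  rewrite Cmod_mult, Cmod_RtoC_pos by lra.
  (* Equality holds at [c = -1], which is the source of the factor [2 s / (1 + s^2)]. The difference
     of squares is [1 - t] times an expression that is nonnegative for [|c| < 1]. *)
  assert (K : (1 + s * s) * Cmod (1 - c) <= 2 * Cmod (1 - (s * s)%R * c)).
  { apply pow2_le_inv; [apply Rmult_le_pos; [lra|apply Cmod_ge_0]|].
    rewrite !Rpow_mult_distr, !Cmod2_alt. destruct c as [p q]. unfold Re, Im. simpl.
    assert (Hm : (Cmod (p, q) ^ 2 < 1)%R) by (generalize (Cmod_ge_0 (p, q)); nra).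
    rewrite Cmod2_alt in Hm. unfold Re, Im in Hm. simpl in Hm.
    set (t := (s * s)%R). assert (Ht : 0 < t < 1) by (unfold t; nra).
    assert (Hp : -1 <= p) by nra.
    assert (0 <= (1 - t) * ((3 + t) + 2 * (1 - t) * p - (3 * t + 1) * (p * p + q * q)))%R.
    { apply Rmult_le_pos; nra. }
    nra. }
  unfold Rdiv. rewrite <- !Rmult_assoc.
  assert (P := Cmod_ge_0 (u - v)).
  apply Rmult_le_reg_r with (Cmod (1 - (s * s)%R * c)); [easy|].
  rewrite Rmult_assoc, Rinv_l, Rmult_1_r by lra.
  apply Rmult_le_reg_r with ((1 + s * s) * Cmod (1 - c))%R; [apply Rmult_lt_0_compat; nra|].
  replace (2 * s * / (1 + s * s) * Cmod (u - v) * / Cmod (1 - c) * Cmod (1 - (s * s)%R * c) * ((1 + s * s) * Cmod (1 - c)))%R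
    with (s * Cmod (u - v) * (2 * Cmod (1 - (s * s)%R * c)))%R by (field; split; nra).
  apply Rmult_le_compat_l; [apply Rmult_le_pos; lra|easy].
Qed.

(* A hyperbolic ball is a Euclidean disk, hence star-shaped about any of its points; here about the origin. *)
Lemma hyperbolic_ball_star_shaped (a x : C) (s R0 : R) : 0 <= s <= 1 -> R0 < 1 ->
  Cmod a <= R0 -> Cmod x < 1 -> Cmod (tau a x) <= R0 -> Cmod (tau a (s * x)) <= R0.
Proof.
  intros Hs HR Ha Hx H. assert (Pa := Cmod_ge_0 a). assert (Px := Cmod_ge_0 x).
  assert (Hsx : Cmod (s * x) < 1).
  { rewrite Cmod_mult, Cmod_RtoC_pos by lra. nra. }
  rewrite Cmod_tau in * by (try easy; lra).
  assert (N1 : 0 < Cmod (1 - Cconj a * x)) by (apply Cmod_gt_0; apply tau_denom; lra).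
  assert (N2 : 0 < Cmod (1 - Cconj a * (s * x))) by (apply Cmod_gt_0; apply tau_denom; lra).
  apply Rmult_le_compat_r with (r := Cmod (1 - Cconj a * x)) in H; [|lra].
  unfold Rdiv in H. rewrite Rmult_assoc, Rinv_l, Rmult_1_r in H by lra.
  apply Rmult_le_reg_r with (Cmod (1 - Cconj a * (s * x))); [easy|].
  unfold Rdiv. rewrite Rmult_assoc, Rinv_l, Rmult_1_r by lra.
  apply pow2_le_inv; [apply Rmult_le_pos; lra|].
  assert (H2 : (Cmod (a - x) ^ 2 <= (R0 * Cmod (1 - Cconj a * x)) ^ 2)%R).
  { apply pow_incr. split; [apply Cmod_ge_0|easy]. }
  assert (H3 : (Cmod a ^ 2 <= R0 ^ 2)%R) by (apply pow_incr; lra).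
  assert (H4 : (R0 ^ 2 * Cmod a ^ 2 <= 1)%R) by (assert (R0 ^ 2 <= 1)%R by nra; assert (Cmod a ^ 2 <= 1)%R by nra; nra).
  rewrite !Rpow_mult_distr, !Cmod2_alt in *. destruct a as [p q], x as [y z]. unfold Re, Im in *. simpl in *.
  set (k := (R0 * (R0 * 1))%R) in *.
  assert (Q0 : 0 <= y * (y * 1) + z * (z * 1)) by nra.
  set (m := (y * (y * 1) + z * (z * 1))%R) in *.
  set (n := (p * (p * 1) + q * (q * 1))%R) in *.
  (* With [k = R0^2], the quadratic [F(s) = k |1 - conj(a) s x|^2 - |a - s x|^2] is concave: [F(s) =
     s F(1) + (1 - s) F(0) + (s - s^2) (1 - k n) m]. [Q3], [Q2] and [Q1] are these three terms. *)
  assert (Q1 : 0 <= (s - s * s) * ((1 - k * n) * m)).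
  { apply Rmult_le_pos; [nra|]. apply Rmult_le_pos; lra. }
  assert (Q2 : 0 <= (1 - s) * (k - n)) by (apply Rmult_le_pos; lra).
  unfold m, n in *.
  match type of H2 with (?l <= ?rr)%R => assert (Q3 : 0 <= s * (rr - l)) by (apply Rmult_le_pos; lra) end.
  nra.
Qed.

Section Escape.
Variable phi : C -> C.
Hypothesis Hphi : self_map_D phi.

Let phi_disk z : Cmod z < 1 -> Cmod (phi z) < 1.
Proof. apply Hphi. Qed.
Let phi_holo z : Cmod z < 1 -> cdiff phi z.
Proof. apply holo_D_cdiff, Hphi. Qed.

Lemma schwarz_pick_iter (n : nat) (a z : C) : Cmod a < 1 -> Cmod z < 1 ->
  Cmod (tau (Nat.iter n phi a) (Nat.iter n phi z)) <= Cmod (tau a z).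
Proof.
  intros Ha Hz. apply (schwarz_pick (Nat.iter n phi)); auto.
  - intros w Hw. now apply iter_holo.
  - intros w Hw. now apply iter_disk.
Qed.

(* [s * phi] contracts the hyperbolic distance uniformly, so its orbits inside an invariant hyperbolically bounded set produce a fixed point there; then [s] tends to [1]. *)
Lemma fixed_point_of_invariant_set (B : C -> Prop) (r : R) : r < 1 -> B 0 ->
  (forall x, B x -> Cmod x <= r) -> (forall x, B x -> B (phi x)) ->
  (forall x s, 0 <= s <= 1 -> B x -> B (s * x)) ->
  exists a, Cmod a <= r /\ phi a = a.
Proof.
  intros Hr B0 HB HBphi HBstar.
  assert (Hr0 : 0 <= r) by (generalize (HB 0 B0); rewrite Cmod_0; lra).
  assert (Hs : forall s, 0 < s < 1 -> exists z, Cmod z <= r /\ s * phi z = z).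
  { intros s Hs. apply (approximate_fixed_point (fun z => s * phi z)).
    { intros z Hz. apply cont_at_mult; [apply cont_at_const|]. apply cdiff_cont, phi_holo. lra. }
    (* Consecutive points of this orbit in [B] get arbitrarily close, so they are approximate fixed
       points; compactness of the disk then gives an exact one, without summing the geometric
       series. *)
    set (y := fun n => Nat.iter n (fun z => s * phi z) 0).
    assert (By : forall n, B (y n)).
    { induction n as [|n IH]; [exact B0|]. unfold y. simpl. apply HBstar; [lra|]. now apply HBphi. }
    assert (Hy : forall n, Cmod (y n) < 1) by (intros n; generalize (HB _ (By n)); lra).
    set (k := (2 * s / (1 + s * s))%R).
    assert (Hk : 0 <= k < 1).
    { assert (0 < 1 + s * s) by nra. split.
      - apply Rmult_le_pos; [lra|left; now apply Rinv_0_lt_compat].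
      - apply Rmult_lt_reg_r with (1 + s * s)%R; [easy|]. unfold k, Rdiv.
        rewrite Rmult_assoc, Rinv_l by lra. nra. }
    assert (Hstep : forall n, Cmod (tau (y n) (y (S n))) <= k ^ n).
    { induction n as [|n IH].
      - simpl. left. apply tau_disk; [apply (Hy O)|apply (Hy 1%nat)].
      - change (Cmod (tau (s * phi (y n)) (s * phi (y (S n)))) <= k * k ^ n).
        eapply Rle_trans; [apply dilation_contracts; auto|]. fold k.
        apply Rmult_le_compat_l; [easy|]. eapply Rle_trans; [|apply IH]. apply schwarz_pick; auto. }
    (* The denominator of [tau] is at most 2, so consecutive points are within [2 * k ^ N] in the
       Euclidean distance. *)
    intros e He. destruct (pow_lt_1_zero k) with (y := (e / 2)%R) as [N HN]; [rewrite Rabs_pos_eq; lra|lra|].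
    specialize (HN N (Nat.le_refl N)). rewrite Rabs_pos_eq in HN by now apply pow_le.
    exists (y N). split; [apply HB, By|].
    change (Cmod (y (S N) - y N) < e). rewrite Cmod_sub_comm.
    specialize (Hstep N). rewrite Cmod_tau in Hstep by auto.
    assert (Nz : 0 < Cmod (1 - Cconj (y N) * y (S N))) by (apply Cmod_gt_0, tau_denom; auto).
    assert (Nz2 : Cmod (1 - Cconj (y N) * y (S N)) <= 2).
    { unfold Cminus. eapply Rle_trans; [apply Cmod_triangle|]. rewrite Cmod_1, Cmod_opp.
      generalize (Cmod_conj_mult_lt_1 (y N) (y (S N)) (Hy N) (Hy (S N))). lra. }
    apply Rmult_le_compat_r with (r := Cmod (1 - Cconj (y N) * y (S N))) in Hstep; [|lra].
    unfold Rdiv in Hstep. rewrite Rmult_assoc, Rinv_l, Rmult_1_r in Hstep by lra.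
    assert (Pk : 0 <= k ^ N) by now apply pow_le. nra. }
  apply approximate_fixed_point.
  { intros z Hz. apply cdiff_cont, phi_holo. lra. }
  intros e He. set (s := (1 - Rmin (1 / 2) (e / 2))%R).
  assert (M1 := Rmin_l (1 / 2) (e / 2)). assert (M2 := Rmin_r (1 / 2) (e / 2)).
  assert (M3 : 0 < Rmin (1 / 2) (e / 2)) by (apply Rmin_pos; lra).
  destruct (Hs s) as [z [Hz E]]; [unfold s; lra|].
  exists z. split; [easy|]. rewrite <- E at 2.
  replace (phi z - s * phi z) with ((1 - s) * phi z) by ring.
  assert (Hpz := phi_disk z ltac:(lra)). assert (P := Cmod_ge_0 (phi z)).
  rewrite <- RtoC_minus, Cmod_mult, Cmod_RtoC_pos by (unfold s; lra).
  assert (1 - s <= e / 2) by (unfold s; lra). assert (0 <= 1 - s) by (unfold s; lra). nra.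
Qed.

(** If every iterate returned some point of the disk to the disk, the orbit of [0] would stay within
    hyperbolic distance [r] of the returned points, by Schwarz-Pick, hence in a compact set. *)
Lemma escape_compact (r : R) : ~ has_fixed_point_D phi -> 0 <= r < 1 ->
  exists n, (1 <= n)%nat /\ forall z, Cmod z <= r -> r < Cmod (Nat.iter n phi z).
Proof.
  intros Hfp Hr. apply NNPP. intros Hno.
  assert (Hret : forall n, (1 <= n)%nat -> exists z, Cmod z <= r /\ Cmod (Nat.iter n phi z) <= r).
  { intros n Hn. apply NNPP. intros K. apply Hno. exists n. split; [easy|]. intros z Hz.
    apply Rnot_le_lt. intros Hle. apply K. now exists z. }
  assert (H0 : Cmod 0 < 1) by (rewrite Cmod_0; lra).
  set (x := fun n => Nat.iter n phi 0).
  assert (Hx1 : forall n, Cmod (x n) < 1) by (intros n; now apply iter_disk).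
  destruct (tau_ball_bounded r r Hr Hr) as [R0 [HR0 HR0b]].
  assert (Hx : forall n, Cmod (x n) <= R0).
  { intros n. destruct n as [|n]; [unfold x; simpl; rewrite Cmod_0; lra|].
    destruct (Hret (S n)) as [z [Hz Hw]]; [lia|]. set (w := Nat.iter (S n) phi z) in *.
    rewrite <- (tau_involutive w (x (S n))) by (try apply Hx1; lra).
    apply HR0b; [easy|]. eapply Rle_trans; [apply schwarz_pick_iter; [lra|easy]|].
    rewrite tau_0. easy. }
  destruct (tau_ball_bounded R0 R0 HR0 HR0) as [R1 [HR1 HR1b]].
  (* The lower limit of the hyperbolic balls of radius [R0] about the points [x n]. Every such ball
     contains [0], hence star-shapedness; [phi] maps the ball about [x n] into the one about
     [x (S n)], hence invariance. *)
  destruct (fixed_point_of_invariant_set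
    (fun p => Cmod p < 1 /\ exists k, forall n, (k <= n)%nat -> Cmod (tau (x n) p) <= R0) R1) as [a [Ha E]].
  - easy.
  - split; [easy|]. exists O. intros n _. rewrite tau_0. apply Hx.
  - intros p [Hp [k Hk]]. rewrite <- (tau_involutive (x k) p) by auto.
    apply HR1b; [apply Hx|]. now apply Hk.
  - intros p [Hp [k Hk]]. split; [auto|]. exists (S k). intros n Hn.
    destruct n as [|n]; [lia|].
    eapply Rle_trans; [apply (schwarz_pick phi phi_holo phi_disk (x n) p); auto|].
    apply Hk. lia.
  - intros p s Hs [Hp [k Hk]]. split.
    + rewrite Cmod_mult, Cmod_RtoC_pos by lra. generalize (Cmod_ge_0 p). nra.
    + exists k. intros n Hn. apply hyperbolic_ball_star_shaped; auto; lra.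
  - apply Hfp. exists a. split; [unfold in_disk; lra|easy].
Qed.

End Escape.

(** * Open mapping and pole pushing *)

Lemma cdiff_translate (f : C -> C) (c z : C) : cdiff f (c + z) -> cdiff (fun w => f (c + w)) z.
Proof.
  intros H. apply (cdiff_comp f (fun w => c + w)); [easy|].
  apply cdiff_plus; [apply cdiff_const|apply cdiff_id].
Qed.

(* If [w] near [chi z0] were omitted on the disk of radius [e], then [1 / (chi - w)] would violate the maximum principle; by injectivity it is omitted on a slightly larger disk as well. *)
Lemma injective_open_mapping (chi : C -> C) (z0 : C) (e : R) :
  (forall z, Cmod z < 1 -> cdiff chi z) ->
  (forall z w, Cmod z < 1 -> Cmod w < 1 -> chi z = chi w -> z = w) ->
  0 < e -> Cmod z0 + e < 1 ->
  exists m, 0 < m /\ forall w, Cmod (w - chi z0) < m -> exists z, Cmod (z - z0) <= e /\ chi z = w.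
Proof.
  intros Hchi Hinj He Hz0. assert (P0 := Cmod_ge_0 z0).
  assert (Hin : forall z, Cmod (z - z0) <= e -> Cmod z < 1).
  { intros z Hz. generalize (Cmod_triangle_rev z z0). lra. }
  destruct (compact_away_from_0 (fun z => Cmod (z - z0) = e) (fun z => chi z - chi z0)) as [m [Hm H]].
  { apply compact_circle. }
  { intros z Hz. assert (Hz1 := Hin z ltac:(lra)). split.
    - apply cont_at_minus; [now apply cdiff_cont, Hchi|apply cont_at_const].
    - apply Csub_neq_0. intros E. apply Hinj in E; [|easy|lra]. rewrite E in Hz.
      replace (z0 - z0) with (RtoC 0) in Hz by ring. rewrite Cmod_0 in Hz. lra. }
  (* On the circle [|chi - w|] is at least [m - m/2], while at the centre it is below [m/2]. *)
  exists (m / 2)%R. split; [lra|]. intros w Hw. apply NNPP. intros Hno.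
  assert (Hrho : exists rho, e < rho /\ Cmod z0 + rho <= 1 /\ forall z, Cmod (z - z0) < rho -> chi z <> w).
  { destruct (classic (exists z1, Cmod z1 < 1 /\ chi z1 = w)) as [[z1 [Hz1 E1]]|Hnone].
    - assert (Hfar : e < Cmod (z1 - z0)).
      { apply Rnot_le_lt. intros K. apply Hno. now exists z1. }
      exists (Rmin (1 - Cmod z0) (Cmod (z1 - z0))).
      split; [apply Rmin_glb_lt; lra|]. split; [generalize (Rmin_l (1 - Cmod z0) (Cmod (z1 - z0))); lra|].
      intros z Hz E. rewrite <- E1 in E. apply Hinj in E; [|generalize (Rmin_l (1 - Cmod z0) (Cmod (z1 - z0))) (Cmod_triangle_rev z z0); lra|easy].
      rewrite E in Hz. generalize (Rmin_r (1 - Cmod z0) (Cmod (z1 - z0))). lra.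
    - exists (1 - Cmod z0)%R. split; [lra|]. split; [lra|]. intros z Hz E. apply Hnone. exists z.
      split; [|easy]. generalize (Cmod_triangle_rev z z0). lra. }
  destruct Hrho as [rho [R1 [R2 R3]]].
  assert (K : Cmod (/ (chi (z0 + 0) - w)) <= / (m / 2)).
  { apply (maximum_principle (fun x => / (chi (z0 + x) - w)) rho e).
    - rewrite Cmod_0. lra.
    - easy.
    - apply Rinv_0_lt_compat. lra.
    - intros x Hx. assert (Hx1 : Cmod (z0 + x - z0) < rho) by (replace (z0 + x - z0) with x by ring; easy).
      apply cdiff_inv; [apply Csub_neq_0; now apply R3|].
      apply cdiff_minus; [|apply cdiff_const]. apply cdiff_translate, Hchi.
      generalize (Cmod_triangle z0 x). lra.
    - intros x Hx. assert (Hx1 : Cmod (z0 + x - z0) = e) by (replace (z0 + x - z0) with x by ring; easy).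
      specialize (H _ Hx1). simpl in H.
      assert (N : chi (z0 + x) - w <> 0) by (apply Csub_neq_0, R3; lra).
      rewrite Cmod_inv by easy. apply Rinv_le_contravar; [lra|].
      generalize (Cmod_sub_triangle (chi (z0 + x)) w (chi z0)). lra. }
  rewrite Cplus_0_r in K.
  assert (N : chi z0 - w <> 0).
  { apply Csub_neq_0, R3. replace (z0 - z0) with (RtoC 0) by ring. rewrite Cmod_0. lra. }
  rewrite Cmod_inv, Cmod_sub_comm in K by easy.
  apply Rinv_le_contravar in K; [|apply Rinv_0_lt_compat; rewrite Cmod_sub_comm; now apply Cmod_gt_0].
  rewrite !Rinv_inv in K. lra.
Qed.

(** Connectedness of [[0,1]]: the initial segments on which [Q] holds have a supremum, and local
    constancy carries [Q] to it and beyond. *)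
Lemma locally_constant_interval (Q : R -> Prop) :
  (forall t, 0 <= t <= 1 -> exists d, 0 < d /\ forall s, 0 <= s <= 1 -> Rabs (s - t) < d -> (Q s <-> Q t)) ->
  Q 0%R -> Q 1%R.
Proof.
  intros Hloc Q0.
  set (S := fun t => 0 <= t <= 1 /\ forall s, 0 <= s <= t -> Q s).
  assert (S0 : S 0%R) by (split; [lra|]; intros s Hs; replace s with 0%R by lra; easy).
  destruct (completeness S) as [l [Hub Hlub]].
  - exists 1. intros t [Ht _]. lra.
  - now exists 0%R.
  - assert (Hl0 : 0 <= l) by now apply Hub.
    assert (Hl1 : l <= 1) by (apply Hlub; intros t [Ht _]; lra).
    destruct (Hloc l (conj Hl0 Hl1)) as [d [Hd H]].
    assert (Hex : exists t, S t /\ l - d < t).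
    { apply NNPP. intros K. assert (l <= l - d); [|lra]. apply Hlub. intros t Ht.
      apply Rnot_lt_le. intros L. apply K. now exists t. }
    destruct Hex as [t [[Ht Hall] Htl]].
    assert (Htl2 : t <= l) by (apply Hub; now split).
    assert (Ql : Q l).
    { apply (H t); [easy|rewrite Rabs_left1; lra|]. apply Hall. lra. }
    assert (Hfar : forall s, 0 <= s <= 1 -> s < l + d -> Q s).
    { intros s Hs Hsl. destruct (Rle_dec s t) as [L|L]; [apply Hall; lra|].
      apply H; [easy|apply Rabs_lt_between'; lra|easy]. }
    destruct (Rlt_dec 1 (l + d)) as [L|L]; [apply Hfar; lra|].
    assert (S (l + d / 2)%R).
    { split; [lra|]. intros s Hs. apply Hfar; lra. }
    assert (l + d / 2 <= l) by now apply Hub. lra.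
Qed.

Lemma locally_constant_path (Q : C -> Prop) (g : R -> C) :
  (forall t, 0 <= t <= 1 -> rcont g t) ->
  (forall t, 0 <= t <= 1 -> exists d, 0 < d /\ forall w, Cmod (w - g t) < d -> (Q w <-> Q (g t))) ->
  Q (g 0%R) -> Q (g 1%R).
Proof.
  intros Hg Hloc. apply (locally_constant_interval (fun t => Q (g t))).
  intros t Ht. destruct (Hloc t Ht) as [d [Hd H]].
  destruct (Hg t Ht d Hd) as [d' [Hd' H']]. exists d'. split; [easy|].
  intros s _ Hs. apply H. now apply H'.
Qed.

Lemma rcont_RtoC (t : R) : rcont RtoC t.
Proof.
  intros e He. exists e. split; [easy|]. intros s Hs. rewrite <- RtoC_minus, Cmod_R. exact Hs.
Qed.

Lemma rcont_affine (a b t : R) : rcont (fun s => RtoC (a + b * s)) t.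
Proof.
  intros e He. destruct (cont_at_plus rdist (fun _ => RtoC a) (fun s => b * s) t
    (cont_at_const _ _ _) (cont_at_mult _ _ _ _ (cont_at_const _ _ _) (rcont_RtoC t)) e He) as [d [Hd H]].
  exists d. split; [easy|]. intros s Hs. rewrite !RtoC_plus, !RtoC_mult. now apply H.
Qed.

Lemma locally_constant_annulus (Q : C -> Prop) (r1 r2 : R) : 0 <= r1 ->
  (forall z, r1 < Cmod z < r2 -> exists d, 0 < d /\ forall w, Cmod (w - z) < d -> (Q w <-> Q z)) ->
  forall z1 z2, r1 < Cmod z1 < r2 -> r1 < Cmod z2 < r2 -> Q z1 -> Q z2.
Proof.
  intros Hr Hloc z1 z2 H1 H2.
  destruct (polar z1) as [t1 E1], (polar z2) as [t2 E2].
  set (m1 := Cmod z1) in *. set (m2 := Cmod z2) in *.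
  (* Modulus and argument are interpolated separately, which keeps the path in the annulus. *)
  set (g := fun s : R => RtoC (m1 + (m2 - m1) * s) * cis (t1 + (t2 - t1) * s)).
  replace z1 with (g 0%R) by (unfold g; rewrite !Rmult_0_r, !Rplus_0_r; easy).
  replace z2 with (g 1%R)
    by (unfold g; replace (m1 + (m2 - m1) * 1)%R with m2 by ring; replace (t1 + (t2 - t1) * 1)%R with t2 by ring; easy).
  apply locally_constant_path.
  - intros t Ht. apply cont_at_mult; [apply rcont_affine|].
    intros e He. destruct (rcont_cis (t1 + (t2 - t1) * t) e He) as [d [Hd H]].
    destruct (rcont_affine t1 (t2 - t1) t d Hd) as [d' [Hd' H']].
    exists d'. split; [easy|]. intros s Hs. apply H. unfold rdist.
    specialize (H' s Hs). now rewrite <- RtoC_minus, Cmod_R in H'.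
  - intros t Ht. apply Hloc. unfold g.
    assert (B : r1 < m1 + (m2 - m1) * t < r2).
    { fold m1 in H1. fold m2 in H2. destruct (Rle_dec m1 m2); nra. }
    rewrite Cmod_scal_cis by lra. easy.
Qed.

Lemma locally_constant_plane (Q : C -> Prop) :
  (forall z, exists d, 0 < d /\ forall w, Cmod (w - z) < d -> (Q w <-> Q z)) ->
  forall z1 z2, Q z1 -> Q z2.
Proof.
  intros Hloc z1 z2. set (g := fun s : R => z1 + (z2 - z1) * s).
  replace z1 with (g 0%R) at 1 by (unfold g; ring). replace z2 with (g 1%R) at 1 by (unfold g; ring).
  apply locally_constant_path; [|auto].
  intros t _. apply cont_at_plus; [apply cont_at_const|].
  apply cont_at_mult; [apply cont_at_const|apply rcont_RtoC].
Qed.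

Fixpoint csum (a : nat -> C) (n : nat) : C :=
  match n with O => 0 | S k => csum a k + a k end.

Section Approximation.
Variable E : C -> Prop.
Hypothesis E_disk : forall w, E w -> Cmod w < 1.

Definition approx (F : C -> C) : Prop :=
  forall e, 0 < e -> exists g, holo_D g /\ forall w, E w -> Cmod (g w - F w) <= e.

Lemma approx_holo F : holo_D F -> approx F.
Proof.
  intros HF e He. exists F. split; [easy|]. intros w _.
  replace (F w - F w) with (RtoC 0) by ring. rewrite Cmod_0. lra.
Qed.

Lemma approx_const c : approx (fun _ => c).
Proof. apply approx_holo. apply holo_D_cdiff. intros. apply cdiff_const. Qed.

Lemma approx_plus F G : approx F -> approx G -> approx (fun w => F w + G w).
Proof.
  intros HF HG e He.
  destruct (HF (e / 2)%R) as [f [Hf Kf]]; [lra|]. destruct (HG (e / 2)%R) as [g [Hg Kg]]; [lra|].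
  exists (fun w => f w + g w). split.
  - apply holo_D_cdiff. intros z Hz. apply cdiff_plus; now apply holo_D_cdiff.
  - intros w Hw. replace (f w + g w - (F w + G w)) with ((f w - F w) + (g w - G w)) by ring.
    eapply Rle_trans; [apply Cmod_triangle|]. specialize (Kf w Hw). specialize (Kg w Hw). lra.
Qed.

Lemma approx_mult F G M : (forall w, E w -> Cmod (F w) <= M) -> (forall w, E w -> Cmod (G w) <= M) ->
  approx F -> approx G -> approx (fun w => F w * G w).
Proof.
  intros HFM HGM HF HG e He.
  set (A := (1 + 2 * Rabs M)%R). assert (PM := Rabs_pos M).
  assert (HA : 1 <= A) by (unfold A; lra).
  set (d := Rmin 1 (e / A)).
  assert (D1 : d <= 1) by apply Rmin_l. assert (D2 : d <= e / A) by apply Rmin_r.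
  assert (D3 : 0 < d) by (apply Rmin_pos; [lra|apply Rdiv_lt_0_compat; lra]).
  assert (D4 : (d * A <= e)%R).
  { apply Rmult_le_compat_r with (r := A) in D2; [|lra].
    unfold Rdiv in D2. rewrite Rmult_assoc, Rinv_l, Rmult_1_r in D2 by lra. easy. }
  destruct (HF d D3) as [f [Hf Kf]]. destruct (HG d D3) as [g [Hg Kg]].
  exists (fun w => f w * g w). split.
  - apply holo_D_cdiff. intros z Hz. apply cdiff_mult; now apply holo_D_cdiff.
  - intros w Hw. replace (f w * g w - F w * G w)
      with ((f w - F w) * (g w - G w) + (F w * (g w - G w) + G w * (f w - F w))) by ring.
    eapply Rle_trans; [apply Cmod_triangle|].
    eapply Rle_trans; [apply Rplus_le_compat_l, Cmod_triangle|]. rewrite !Cmod_mult.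
    specialize (Kf w Hw). specialize (Kg w Hw). specialize (HFM w Hw). specialize (HGM w Hw).
    assert (RM := Rle_abs M).
    generalize (Cmod_ge_0 (f w - F w)) (Cmod_ge_0 (g w - G w)) (Cmod_ge_0 (F w)) (Cmod_ge_0 (G w)).
    intros P1 P2 P3 P4.
    assert (Cmod (f w - F w) * Cmod (g w - G w) <= d * 1)%R by (apply Rmult_le_compat; lra).
    assert (Cmod (F w) * Cmod (g w - G w) <= Rabs M * d)%R by (apply Rmult_le_compat; lra).
    assert (Cmod (G w) * Cmod (f w - F w) <= Rabs M * d)%R by (apply Rmult_le_compat; lra).
    replace (d * A)%R with (d * 1 + Rabs M * d + Rabs M * d)%R in D4 by (unfold A; ring). lra.
Qed.

Lemma approx_scal c F M : (forall w, E w -> Cmod (F w) <= M) -> approx F -> approx (fun w => c * F w).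
Proof.
  intros HM HF. apply approx_mult with (M := Rmax (Cmod c) M); auto.
  - intros w _. apply Rmax_l.
  - intros w Hw. eapply Rle_trans; [now apply HM|apply Rmax_r].
  - apply approx_const.
Qed.

Lemma approx_csum (F : nat -> C -> C) n : (forall k, (k < n)%nat -> approx (F k)) ->
  approx (fun w => csum (fun k => F k w) n).
Proof.
  intros H. induction n as [|n IH]; simpl; [apply approx_const|].
  apply approx_plus; [apply IH; intros; apply H; lia|apply H; lia].
Qed.

Lemma approx_lim F : (forall e, 0 < e -> exists G, approx G /\ forall w, E w -> Cmod (G w - F w) <= e) -> approx F.
Proof.
  intros H e He. destruct (H (e / 2)%R) as [G [HG K]]; [lra|].
  destruct (HG (e / 2)%R) as [g [Hg Kg]]; [lra|]. exists g. split; [easy|].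
  intros w Hw. specialize (K w Hw). specialize (Kg w Hw).
  generalize (Cmod_sub_triangle (g w) (G w) (F w)). lra.
Qed.

Lemma approx_pow F M n : (forall w, E w -> Cmod (F w) <= M) -> approx F -> approx (fun w => F w ^ n).
Proof.
  intros HM HF. induction n as [|n IH]; simpl; [apply approx_const|].
  apply approx_mult with (M := Rmax M (M ^ n)); auto.
  - intros w Hw. eapply Rle_trans; [now apply HM|apply Rmax_l].
  - intros w Hw. rewrite Cmod_pow. eapply Rle_trans; [|apply Rmax_r].
    apply pow_incr. split; [apply Cmod_ge_0|now apply HM].
Qed.

(** Runge's pole pushing in the form of a predicate: it holds outside the unit disk and is locally
    constant at positive distance from [E]. *)
Definition pole_approx (p : C) : Prop := approx (fun w => / (p - w)).

Lemma csum_geom (q : C) n : csum (fun k => q ^ k) n * (1 - q) = 1 - q ^ n.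
Proof.
  induction n as [|n IH]; simpl; [ring|]. rewrite Cmult_plus_distr_r, IH. ring.
Qed.

(* Expand [1 / (p' - w)] as a geometric series in [(p - p') / (p - w)]. *)
Lemma pole_push (p p' : C) (d : R) : 0 < d -> (forall w, E w -> d <= Cmod (p - w)) ->
  Cmod (p' - p) <= d / 2 -> pole_approx p -> pole_approx p'.
Proof.
  intros Hd Hfar Hpp Hp.
  assert (Hinv : forall w, E w -> Cmod (/ (p - w)) <= / d).
  { intros w Hw. specialize (Hfar w Hw). rewrite Cmod_inv by (apply Cmod_gt_0; lra).
    now apply Rinv_le_contravar. }
  set (q := fun w => (p - p') * / (p - w)).
  assert (Hq : forall w, E w -> Cmod (q w) <= / 2).
  { intros w Hw. unfold q. rewrite Cmod_mult, Cmod_sub_comm.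
    apply Rle_trans with (d / 2 * / d)%R; [|right; field; lra].
    apply Rmult_le_compat; auto; apply Cmod_ge_0. }
  assert (Hqa : approx q) by now apply approx_scal with (M := (/ d)%R).
  apply approx_lim. intros e He.
  (* The tail of the series is [q^n / (p' - w)], of modulus at most [(1/2)^n * 2 / d]. *)
  destruct (half_pow_small (e * d / 2)) as [n Hn].
  { apply Rdiv_lt_0_compat; [now apply Rmult_lt_0_compat|lra]. }
  exists (fun w => / (p - w) * csum (fun k => q w ^ k) n). split.
  - assert (Hqk : forall k w, E w -> Cmod (q w ^ k) <= 1).
    { intros k w Hw. rewrite Cmod_pow. rewrite <- (pow1 k). apply pow_incr.
      split; [apply Cmod_ge_0|]. specialize (Hq w Hw). lra. }
    apply approx_mult with (M := Rmax (/ d) (INR n)); auto.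
    + intros w Hw. eapply Rle_trans; [now apply Hinv|apply Rmax_l].
    + intros w Hw. eapply Rle_trans; [|apply Rmax_r]. clear Hn.
      induction n as [|n IH]; [simpl; rewrite Cmod_0; lra|].
      rewrite S_INR. simpl. eapply Rle_trans; [apply Cmod_triangle|].
      apply Rplus_le_compat; [apply IH|now apply Hqk].
    + apply approx_csum. intros k _. now apply approx_pow with (M := (/ 2)%R).
  - intros w Hw. specialize (Hfar w Hw). specialize (Hq w Hw).
    assert (N1 : p - w <> 0) by (apply Cmod_gt_0; lra).
    assert (N2 : 1 - q w <> 0) by (apply Cmod_lt_1_sub; lra).
    assert (N3 : p' - w <> 0).
    { replace (p' - w) with ((p - w) * (1 - q w)) by (unfold q; field; easy). now apply Cmult_neq_0. }
    assert (E1 : / (p - w) * csum (fun k => q w ^ k) n - / (p' - w) = - (q w ^ n * / (p' - w))).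
    { replace (/ (p' - w)) with (/ (p - w) * / (1 - q w)).
      - replace (csum (fun k => q w ^ k) n) with ((1 - q w ^ n) / (1 - q w))
          by (rewrite <- csum_geom; field; easy).
        field. now split.
      - replace (p' - w) with ((p - w) * (1 - q w)) by (unfold q; field; easy).
        field. now split. }
    rewrite E1, Cmod_opp, Cmod_mult, Cmod_pow, Cmod_inv by easy.
    assert (F : d / 2 <= Cmod (p' - w)).
    { generalize (Cmod_sub_triangle p p' w). rewrite (Cmod_sub_comm p p'). lra. }
    apply Rle_trans with (e * d / 2 * / (d / 2))%R; [|right; field; lra].
    apply Rmult_le_compat.
    + apply pow_le, Cmod_ge_0.
    + left. apply Rinv_0_lt_compat. lra.
    + left. eapply Rle_lt_trans; [|apply Hn]. apply pow_incr. split; [apply Cmod_ge_0|easy].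
    + apply Rinv_le_contravar; lra.
Qed.

(** The radius [d / 3] makes pushing reversible: [p'] is still at distance at least [2 d / 3] from
    [E], and half of that is [d / 3]. *)
Lemma pole_locally_constant (p : C) (d : R) : 0 < d -> (forall w, E w -> d <= Cmod (p - w)) ->
  forall p', Cmod (p' - p) < d / 3 -> (pole_approx p' <-> pole_approx p).
Proof.
  intros Hd Hfar p' Hp. split.
  - apply pole_push with (d := (2 * d / 3)%R); [lra| |rewrite Cmod_sub_comm; lra].
    intros w Hw. specialize (Hfar w Hw). generalize (Cmod_sub_triangle p p' w).
    rewrite (Cmod_sub_comm p p'). lra.
  - apply pole_push with (d := d); [easy|easy|lra].
Qed.

Lemma pole_approx_outside (p : C) : 1 <= Cmod p -> pole_approx p.
Proof.
  intros Hp. apply approx_holo. apply holo_D_cdiff. intros z Hz.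
  apply cdiff_inv; [apply Csub_neq_0, Cmod_neq; lra|].
  apply cdiff_minus; [apply cdiff_const|apply cdiff_id].
Qed.

End Approximation.

(** * Riemann sums *)

Lemma cis_lipschitz (s t : R) : Cmod (cis s - cis t) <= 2 * Rabs (s - t).
Proof.
  assert (H : forall f df : R -> R, (forall x, is_derive f x (df x)) -> (forall x, Rabs (df x) <= 1) ->
    Rabs (f s - f t) <= Rabs (s - t)).
  { intros f df Hf Hb. destruct (MVT_gen f t s df) as [c [_ E]].
    - intros x _. apply Hf.
    - intros x _. apply derivable_continuous_pt. exists (df x). apply is_derive_Reals, Hf.
    - rewrite E, Rabs_mult. rewrite <- (Rmult_1_l (Rabs (s - t))) at 2.
      apply Rmult_le_compat_r; [apply Rabs_pos|apply Hb]. }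
  eapply Rle_trans; [apply Cmod_le_Rabs|]. simpl.
  assert (H1 := H cos (fun x => - sin x)%R
    (fun x => proj2 (is_derive_Reals _ _ _) (derivable_pt_lim_cos x))
    (fun x => ltac:(cbv beta; rewrite Rabs_Ropp; apply Rabs_le, SIN_bound))).
  assert (H2 := H sin cos
    (fun x => proj2 (is_derive_Reals _ _ _) (derivable_pt_lim_sin x))
    (fun x => ltac:(apply Rabs_le, COS_bound))).
  unfold Rminus in *. lra.
Qed.

Lemma riemann_sum_bound (F : R -> C) (h e : R) (n : nat) : 0 <= h ->
  (forall t, 0 <= t <= INR n * h -> rcont F t) ->
  (forall j t, (j < n)%nat -> INR j * h <= t <= INR (S j) * h -> Cmod (F t - F (INR j * h)%R) <= e) ->
  Cmod (cint F 0 (INR n * h) - csum (fun j => h * F (INR j * h)%R) n) <= 2 * e * (INR n * h).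
Proof.
  intros Hh. induction n as [|n IH]; intros HF Hosc.
  - simpl. rewrite Rmult_0_l, Rmult_0_r. unfold cint. rewrite !RInt_point.
    change (Cmod (RtoC 0 - 0) <= 0). rewrite Cminus_0_r, Cmod_0. lra.
  - assert (P := pos_INR n). assert (Hnh : 0 <= INR n * h) by now apply Rmult_le_pos.
    rewrite S_INR in *.
    assert (Hle : INR n * h <= (INR n + 1) * h) by lra.
    simpl csum. rewrite (cint_chasles F 0 (INR n * h)) by auto.
    assert (I1 : Cmod (cint F 0 (INR n * h) - csum (fun j => h * F (INR j * h)%R) n) <= 2 * e * (INR n * h)).
    { apply IH; [intros; apply HF; lra|]. intros j t Hj Ht. apply Hosc; [lia|easy]. }
    assert (I2 : Cmod (cint F (INR n * h) ((INR n + 1) * h) - h * F (INR n * h)%R) <= 2 * e * h).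
    { replace (h * F (INR n * h)%R) with (cint (fun _ => F (INR n * h)%R) (INR n * h) ((INR n + 1) * h)).
      - rewrite <- cint_minus; [|easy|intros; apply HF; lra|intros; apply cont_at_const].
        replace (2 * e * h)%R with (2 * e * ((INR n + 1) * h - INR n * h))%R by ring.
        apply cint_bound; [easy| |].
        + intros t Ht. apply cont_at_minus; [apply HF; lra|apply cont_at_const].
        + intros t Ht. apply Hosc; [lia|]. now rewrite S_INR.
      - rewrite cint_const by easy. rewrite <- RtoC_minus.
        replace ((INR n + 1) * h - INR n * h)%R with h by ring. ring. }
    set (S1 := csum _ n) in *.
    replace (cint F 0 (INR n * h) + cint F (INR n * h) ((INR n + 1) * h) - (S1 + h * F (INR n * h)%R))
      with ((cint F 0 (INR n * h) - S1) + (cint F (INR n * h) ((INR n + 1) * h) - h * F (INR n * h)%R)) by ring.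
    eapply Rle_trans; [apply Cmod_triangle|].
    replace (2 * e * ((INR n + 1) * h))%R with (2 * e * (INR n * h) + 2 * e * h)%R by ring. lra.
Qed.

(** The Riemann sums are finite combinations of [1 / (p - w)] with [p] on the image of the circle.
    They converge uniformly in [w] because [E] keeps distance [d] from these poles. *)
Lemma approx_cauchy_integral (E : C -> Prop) (r d : R) (u chi : C -> C) : 0 < r -> 0 < d ->
  circ_cont r u -> circ_cont r chi ->
  (forall x w, Cmod x = r -> E w -> d <= Cmod (chi x - w)) ->
  (forall x, Cmod x = r -> pole_approx E (chi x)) ->
  approx E (fun w => avg r (fun x => u x / (chi x - w))).
Proof.
  intros Hr Hd Hu Hchi Hfar Hpole. assert (T := two_PI_pos).
  assert (Hcirc : forall h, circ_cont r h -> forall z, Cmod (z - 0) = r -> ccont h z).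
  { intros h Hh z Hz. apply Hh. now rewrite Cminus_0_r in Hz. }
  destruct (compact_bounded _ u (compact_circle 0 r) (Hcirc u Hu)) as [M [HM HMb]].
  apply approx_lim. intros e He.
  (* If [u] and [chi] each vary by at most [e'], then [u / (chi - w)] varies by at most
     [k * e' = e / 2]; [riemann_sum_bound] doubles this. *)
  set (k := (/ d + M * / d * / d)%R).
  assert (Hid : 0 < / d) by now apply Rinv_0_lt_compat.
  assert (Hk : 0 < k).
  { unfold k. apply Rplus_lt_0_compat; [easy|]. repeat apply Rmult_lt_0_compat; lra. }
  set (e' := (e / (2 * k))%R). assert (He' : 0 < e') by (apply Rdiv_lt_0_compat; lra).
  destruct (compact_uniform_cont _ u (compact_circle 0 r) (Hcirc u Hu) e' He') as [d1 [Hd1 U1]].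
  destruct (compact_uniform_cont _ chi (compact_circle 0 r) (Hcirc chi Hchi) e' He') as [d2 [Hd2 U2]].
  assert (Hden : 0 < 2 * r * (2 * PI)) by (apply Rmult_lt_0_compat; lra).
  destruct (inv_INR_small (Rmin d1 d2 / (2 * r * (2 * PI)))) as [N HN].
  { apply Rdiv_lt_0_compat; [now apply Rmin_pos|easy]. }
  specialize (HN N (Nat.le_refl N)). rewrite <- S_INR in HN.
  set (n := S N) in *. assert (Pn : 0 < INR n) by (apply lt_0_INR; unfold n; lia).
  clearbody n.
  set (h := (2 * PI / INR n)%R). assert (Hh : 0 < h) by now apply Rdiv_lt_0_compat.
  assert (Hnh : (INR n * h = 2 * PI)%R) by (unfold h; field; lra).
  assert (Hmesh : 2 * r * h < Rmin d1 d2).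
  { apply Rmult_lt_compat_r with (r := (2 * r * (2 * PI))%R) in HN; [|easy].
    unfold Rdiv in HN. rewrite (Rmult_assoc (Rmin d1 d2)), Rinv_l, Rmult_1_r in HN
      by lra.
    unfold h, Rdiv. lra. }
  set (G := fun w x => u x / (chi x - w)).
  assert (HG : forall w, E w -> circ_cont r (G w)).
  { intros w Hw x Hx. apply cont_at_div; [|now apply Hu|].
    - apply Cmod_gt_0. specialize (Hfar x w Hx Hw). lra.
    - apply cont_at_minus; [now apply Hchi|apply cont_at_const]. }
  exists (fun w => / (2 * PI)%R * csum (fun j => (h * u (r * cis (INR j * h))) * / (chi (r * cis (INR j * h)) - w)) n).
  assert (Hbd : forall j w, E w -> Cmod (/ (chi (r * cis (INR j * h)) - w)) <= / d).
  { intros j w Hw. assert (F := Hfar (r * cis (INR j * h)) w (Cmod_scal_cis r _ (Rlt_le _ _ Hr)) Hw).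
    rewrite Cmod_inv by (apply Cmod_gt_0; lra). now apply Rinv_le_contravar. }
  split.
  - apply approx_scal with (M := (INR n * (h * M * / d))%R).
    + intros w Hw. clear - Hw Hbd HMb Hh HM Hid Hr. generalize n. intros m. induction m as [|m IH].
      * simpl. rewrite Cmod_0. lra.
      * rewrite S_INR. simpl. eapply Rle_trans; [apply Cmod_triangle|].
        rewrite Rmult_plus_distr_r, Rmult_1_l. apply Rplus_le_compat; [easy|].
        rewrite !Cmod_mult, Cmod_RtoC_pos by lra.
        apply Rmult_le_compat; [apply Rmult_le_pos; [lra|apply Cmod_ge_0]|apply Cmod_ge_0| |now apply Hbd].
        apply Rmult_le_compat_l; [lra|]. apply HMb. rewrite Cminus_0_r. apply Cmod_scal_cis. lra.
    + apply approx_csum. intros j _. apply approx_scal with (M := (/ d)%R); [now apply Hbd|].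
      apply Hpole. apply Cmod_scal_cis. lra.
  - intros w Hw. unfold avg.
    change (fun t => u (r * cis t) / (chi (r * cis t) - w)) with (fun t => G w (r * cis t)).
    replace (csum (fun j => h * u (r * cis (INR j * h)) * / (chi (r * cis (INR j * h)) - w)) n)
      with (csum (fun j => h * G w (r * cis (INR j * h)%R)) n).
    2:{ generalize n. intros m. induction m as [|m IH]; [easy|]. simpl. rewrite IH. unfold G, Cdiv. ring. }
    assert (B := riemann_sum_bound (fun t => G w (r * cis t)) h (e / 2) n (Rlt_le _ _ Hh)).
    rewrite Hnh in B. cbv beta in B.
    set (S1 := csum _ n) in *. set (I1 := cint _ _ _) in *.
    replace (/ (2 * PI)%R * S1 - / (2 * PI)%R * I1) with (- (/ (2 * PI)%R * (I1 - S1))) by ring.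
    rewrite Cmod_opp, Cmod_mult, Cmod_inv, Cmod_RtoC_pos;
      [|lra|intros K; apply RtoC_inj in K; lra].
    apply Rmult_le_reg_l with (2 * PI)%R; [easy|].
    rewrite <- Rmult_assoc, Rinv_r, Rmult_1_l by lra.
    eapply Rle_trans; [apply B|right; field].
    + intros t _. apply rcont_circle; [lra|now apply HG].
    + intros j t _ Ht.
      set (x := r * cis t). set (y := r * cis (INR j * h)).
      assert (Hx : Cmod x = r) by (apply Cmod_scal_cis; lra).
      assert (Hy : Cmod y = r) by (apply Cmod_scal_cis; lra).
      assert (Hxy : Cmod (x - y) < Rmin d1 d2).
      { eapply Rle_lt_trans; [|apply Hmesh].
        unfold x, y. replace (r * cis t - r * cis (INR j * h)) with (r * (cis t - cis (INR j * h))) by ring.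
        rewrite Cmod_mult, Cmod_RtoC_pos by lra.
        replace (2 * r * h)%R with (r * (2 * h))%R by ring. apply Rmult_le_compat_l; [lra|].
        eapply Rle_trans; [apply cis_lipschitz|]. apply Rmult_le_compat_l; [lra|].
        rewrite S_INR in Ht. rewrite Rabs_pos_eq; lra. }
      assert (V1 : Cmod (u x - u y) < e').
      { apply U1; [now rewrite Cminus_0_r|]. eapply Rlt_le_trans; [apply Hxy|apply Rmin_l]. }
      assert (V2 : Cmod (chi x - chi y) < e').
      { apply U2; [now rewrite Cminus_0_r|]. eapply Rlt_le_trans; [apply Hxy|apply Rmin_r]. }
      assert (Fx := Hfar x w Hx Hw). assert (Fy := Hfar y w Hy Hw).
      assert (Nx : chi x - w <> 0) by (apply Cmod_gt_0; lra).
      assert (Ny : chi y - w <> 0) by (apply Cmod_gt_0; lra).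
      unfold G.
      replace (u x / (chi x - w) - u y / (chi y - w))
        with ((u x - u y) * / (chi x - w) + - (u y * / (chi x - w) * / (chi y - w) * (chi x - chi y)))
        by (field; now split).
      eapply Rle_trans; [apply Cmod_triangle|]. rewrite Cmod_opp, !Cmod_mult, !Cmod_inv by easy.
      assert (Ix : / Cmod (chi x - w) <= / d) by now apply Rinv_le_contravar.
      assert (Iy : / Cmod (chi y - w) <= / d) by now apply Rinv_le_contravar.
      assert (0 <= / Cmod (chi x - w)) by (left; apply Rinv_0_lt_compat; lra).
      assert (0 <= / Cmod (chi y - w)) by (left; apply Rinv_0_lt_compat; lra).
      assert (Cmod (u y) <= M) by (apply HMb; now rewrite Cminus_0_r).
      assert (0 <= Cmod (u y)) by apply Cmod_ge_0.
      apply Rle_trans with (e' * / d + M * / d * / d * e')%R.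
      * apply Rplus_le_compat.
        -- apply Rmult_le_compat; try easy; [apply Cmod_ge_0|lra].
        -- repeat apply Rmult_le_compat; try easy; try apply Cmod_ge_0; repeat apply Rmult_le_pos; try easy. lra.
      * right. replace (e' * / d + M * / d * / d * e')%R with (k * e')%R by (unfold k; ring).
        unfold e'. field. lra.
Qed.

(** An injective holomorphic map has no critical points at all, but density of the noncritical ones
    suffices and is elementary: otherwise the real mean value theorem, applied to both coordinates,
    makes [chi] equal at the ends of a segment. *)
Lemma derivative_not_locally_zero (chi : C -> C) (z0 : C) (e : R) : 0 < e -> Cmod z0 + e <= 1 ->
  (forall z, Cmod z < 1 -> cdiff chi z) ->
  (forall z w, Cmod z < 1 -> Cmod w < 1 -> chi z = chi w -> z = w) ->
  exists z, Cmod (z - z0) < e /\ C_derive chi z <> 0.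
Proof.
  intros He Hz0 Hchi Hinj. apply NNPP. intros Hno.
  assert (Hzero : forall z, Cmod (z - z0) < e -> cderiv chi z 0).
  { intros z Hz. destruct (classic (C_derive chi z = 0)) as [E|E].
    - rewrite <- E. apply cderiv_C_derive, Hchi. generalize (Cmod_triangle_rev z z0). lra.
    - exfalso. apply Hno. now exists z. }
  assert (Hpt : forall t : R, 0 <= t < e -> Cmod (z0 + t - z0) < e).
  { intros t Ht. replace (z0 + t - z0) with (RtoC t) by ring. rewrite Cmod_RtoC_pos; lra. }
  assert (Hlip : forall t : R, 0 <= t < e -> forall k, 0 < k -> exists d, 0 < d /\ forall s : R,
    Rabs s < d -> Cmod (chi (z0 + (t + s)%R) - chi (z0 + t)) <= k * Rabs s).
  { intros t Ht k Hk. destruct (Hzero _ (Hpt t Ht)) as [q [Hq0 [Hqc Hq]]].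
    destruct (Hqc k Hk) as [d [Hd K]]. exists d. split; [easy|]. intros s Hs.
    rewrite (Hq (z0 + (t + s)%R)).
    replace (chi (z0 + t) + q (z0 + (t + s)%R) * (z0 + (t + s)%R - (z0 + t)) - chi (z0 + t))
      with (q (z0 + (t + s)%R) * s) by (rewrite RtoC_plus; ring).
    rewrite Cmod_mult, Cmod_R. apply Rmult_le_compat_r; [apply Rabs_pos|]. left.
    replace (q (z0 + (t + s)%R)) with (q (z0 + (t + s)%R) - q (z0 + t)) by (rewrite Hq0; ring).
    apply K. unfold cdist. rewrite RtoC_plus.
    replace (z0 + (t + s) - (z0 + t)) with (RtoC s) by ring. now rewrite Cmod_R. }
  assert (Hcst : forall pr : C -> R, (forall z w : C, pr (z - w)%C = pr z - pr w)%R -> (forall z, Rabs (pr z) <= Cmod z) ->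
    pr (chi (z0 + 0)) = pr (chi (z0 + (e / 2)%R))).
  { intros pr Hpr Hpb.
    assert (Hd : forall t, 0 <= t < e -> derivable_pt_lim (fun t => pr (chi (z0 + t))) t 0).
    { intros t Ht k Hk. destruct (Hlip t Ht (k / 2)%R) as [d [Hd K]]; [lra|].
      exists (mkposreal d Hd). intros s Hs0 Hs. simpl in Hs. specialize (K s Hs). cbv beta.
      rewrite Rminus_0_r, <- Hpr. unfold Rdiv. rewrite Rabs_mult, Rabs_inv.
      assert (Ps : 0 < Rabs s) by now apply Rabs_pos_lt.
      apply Rmult_lt_reg_r with (Rabs s); [easy|]. rewrite Rmult_assoc, Rinv_l, Rmult_1_r by lra.
      eapply Rle_lt_trans; [apply Hpb|]. nra. }
    destruct (MVT_gen (fun t => pr (chi (z0 + t))) 0 (e / 2) (fun _ => 0%R)) as [c [_ K]].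
    - intros t Ht. rewrite Rmin_left, Rmax_right in Ht by lra. apply is_derive_Reals, Hd. lra.
    - intros t Ht. rewrite Rmin_left, Rmax_right in Ht by lra.
      apply derivable_continuous_pt. exists 0%R. apply Hd. lra.
    - rewrite Rmult_0_l in K. lra. }
  assert (E : chi (z0 + 0) = chi (z0 + (e / 2)%R)).
  { rewrite (surjective_pairing (chi (z0 + 0))), (surjective_pairing (chi (z0 + (e / 2)%R))).
    f_equal; [apply (Hcst fst)|apply (Hcst snd)]; try easy; [apply Rabs_fst_le|apply Rabs_snd_le]. }
  apply Hinj in E.
  - assert (K : RtoC (e / 2) = 0).
    { replace (RtoC (e / 2)) with (z0 + (e / 2)%R - z0) by ring. rewrite <- E. ring. }
    apply RtoC_inj in K. lra.
  - rewrite Cplus_0_r. lra.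
  - eapply Rle_lt_trans; [apply Cmod_triangle|]. rewrite Cmod_RtoC_pos; lra.
Qed.

(** * Approximation on two disjoint images of a disk *)

Section RungeTwoDisks.
Variables (chi : bool -> C -> C) (r1 r2 : R).
Hypothesis (Hr1 : 0 <= r1) (Hr12 : r1 < r2) (Hr2 : r2 < 1).
Hypothesis chi_holo : forall b z, Cmod z < 1 -> cdiff (chi b) z.
Hypothesis chi_disk : forall b z, Cmod z < 1 -> Cmod (chi b z) < 1.
Hypothesis chi_inj : forall b z w, Cmod z < 1 -> Cmod w < 1 -> chi b z = chi b w -> z = w.
Hypothesis chi_disjoint : forall b z w, Cmod z < r2 -> Cmod w < r2 -> chi b z <> chi (negb b) w.

(** The union of the two compact images; the index [b] lets one argument treat both. Disjointness is
    assumed up to the larger radius [r2], so an annulus around each compact disk is mapped off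
    [E]. *)
Let E (w : C) : Prop := exists b z, Cmod z <= r1 /\ chi b z = w.

Local Lemma chi_eq_in (b b' : bool) (z w : C) : Cmod z < r2 -> Cmod w < r2 -> chi b z = chi b' w -> b = b' /\ z = w.
Proof.
  intros Hz Hw H. destruct (Bool.bool_dec b' b) as [->|Hb].
  - split; [easy|]. apply (chi_inj b); auto; lra.
  - exfalso. apply (chi_disjoint b z w Hz Hw). rewrite H. f_equal. destruct b, b'; easy.
Qed.

Local Lemma images_in_disk (w : C) : E w -> Cmod w < 1.
Proof. intros [b [z [Hz <-]]]. apply chi_disk. lra. Qed.

Local Lemma images_far (p : C) : ~ E p -> exists d, 0 < d /\ forall w, E w -> d <= Cmod (p - w).
Proof.
  intros Hp.
  assert (Hb : forall b, exists d, 0 < d /\ forall z, Cmod z <= r1 -> d <= Cmod (chi b z - p)).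
  { intros b. apply (compact_away_from_0 (fun z => Cmod z <= r1) (fun z => chi b z - p) (compact_disk r1)).
    intros z Hz. split.
    - apply cont_at_minus; [apply cdiff_cont, chi_holo; lra|apply cont_at_const].
    - apply Csub_neq_0. intros K. apply Hp. now exists b, z. }
  destruct (Hb true) as [d1 [Hd1 H1]], (Hb false) as [d2 [Hd2 H2]].
  exists (Rmin d1 d2). split; [now apply Rmin_pos|].
  intros w [b [z [Hz <-]]]. rewrite Cmod_sub_comm. destruct b.
  - eapply Rle_trans; [apply Rmin_l|auto].
  - eapply Rle_trans; [apply Rmin_r|auto].
Qed.

Local Lemma annulus_not_image (b : bool) (z : C) : r1 < Cmod z < r2 -> ~ E (chi b z).
Proof.
  intros Hz [b' [w [Hw K]]]. apply chi_eq_in in K; [|lra|lra]. destruct K as [_ ->]. lra.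
Qed.

Local Lemma pole_annulus_constant (b : bool) (z1 z2 : C) : r1 < Cmod z1 < r2 -> r1 < Cmod z2 < r2 ->
  pole_approx E (chi b z1) -> pole_approx E (chi b z2).
Proof.
  apply (locally_constant_annulus (fun z => pole_approx E (chi b z))); [easy|].
  intros z Hz. destruct (images_far _ (annulus_not_image b z Hz)) as [d [Hd Hfar]].
  assert (Hd3 : 0 < d / 3) by lra.
  destruct (cdiff_cont _ _ (chi_holo b z ltac:(lra)) (d / 3)%R Hd3) as [d' [Hd' K]].
  exists d'. split; [easy|]. intros w Hw. apply (pole_locally_constant E _ d); auto.
Qed.

(* Giving each compact disk the constant truth value found on the annulus around it extends [pole_approx] to a locally constant predicate on the whole plane, which is true near infinity. *)
Local Lemma pole_annulus (b : bool) (z : C) : r1 < Cmod z < r2 -> pole_approx E (chi b z).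
Proof.
  intros Hz.
  set (c := RtoC ((r1 + r2) / 2)).
  assert (Hc : r1 < Cmod c < r2) by (unfold c; rewrite Cmod_RtoC_pos; lra).
  set (Q := fun p => (~ E p /\ pole_approx E p) \/
    exists b z, Cmod z <= r1 /\ chi b z = p /\ pole_approx E (chi b c)).
  assert (Qin : forall b z, Cmod z < r2 -> (Q (chi b z) <-> pole_approx E (chi b c))).
  { intros b' w Hw. destruct (Rle_dec (Cmod w) r1) as [L|L].
    - split.
      + intros [[K _]|[b2 [w2 [Hw2 [Ew2 K]]]]].
        * exfalso. apply K. now exists b', w.
        * apply chi_eq_in in Ew2; [|lra|lra]. now destruct Ew2 as [<- _].
      + intros K. right. now exists b', w.
    - assert (Hw' : r1 < Cmod w < r2) by lra. split.
      + intros [[_ K]|[b2 [w2 [Hw2 [Ew2 K]]]]].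
        * now apply (pole_annulus_constant b' w c).
        * exfalso. apply (annulus_not_image b' w Hw'). now exists b2, w2.
      + intros K. left. split; [now apply annulus_not_image|]. now apply (pole_annulus_constant b' c w). }
  assert (Hloc : forall p, exists d, 0 < d /\ forall p', Cmod (p' - p) < d -> (Q p' <-> Q p)).
  { intros p. destruct (classic (E p)) as [[b' [w [Hw <-]]]|Hp].
    - assert (Pw := Cmod_ge_0 w).
      (* Near a point of [E], all points are images of points of modulus below [r2], where [Qin]
         gives [Q] the same truth value. *)
      destruct (injective_open_mapping (chi b') w ((r2 - r1) / 2)) as [m [Hm H]]; auto; [|lra|lra|].
      + intros; now apply (chi_inj b').
      + exists m. split; [easy|]. intros p' Hp'. destruct (H p' Hp') as [w' [Hw' <-]].
        rewrite !Qin; [easy|lra|]. generalize (Cmod_triangle_rev w' w). lra.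
    - destruct (images_far p Hp) as [d [Hd Hfar]]. exists (d / 3)%R. split; [lra|].
      intros p' Hp'.
      assert (Hp'E : ~ E p').
      { intros K. specialize (Hfar p' K). rewrite Cmod_sub_comm in Hfar. lra. }
      assert (Heq := pole_locally_constant E p d Hd Hfar p' Hp').
      assert (HQ : forall q, ~ E q -> (Q q <-> pole_approx E q)).
      { intros q Hq. split.
        - intros [[_ K]|[b2 [w2 [Hw2 [Ew2 _]]]]]; [easy|]. exfalso. apply Hq. now exists b2, w2.
        - intros K. now left. }
      rewrite !HQ by easy. easy. }
  (* The base point lies off the open disk, so its pole function is already holomorphic there. *)
  assert (Q1 : Q 1).
  { left. split; [|apply pole_approx_outside; rewrite Cmod_1; lra].
    intros K. apply images_in_disk in K. rewrite Cmod_1 in K. lra. }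
  apply (pole_annulus_constant b c z Hc Hz). apply (Qin b c); [lra|].
  now apply (locally_constant_plane Q Hloc 1).
Qed.

Variable f : C -> C.
Hypothesis f_holo : forall z, Cmod z < 1 -> cdiff f z.

Let r := ((r1 + r2) / 2)%R.
(** The density obtained by substituting [zeta = chi b x] in the Cauchy integral of [f] composed
    with the inverse of [chi b]; the last factor [x] comes from the normalisation of [avg]. *)
Let u (b : bool) (x : C) : C := f x * C_derive (chi b) x * x.

Let u_holo b z : Cmod z < 1 -> cdiff (u b) z.
Proof.
  intros Hz. apply cdiff_mult; [|apply cdiff_id]. apply cdiff_mult; [now apply f_holo|].
  now apply (cdiff_C_derive (chi b) 1 (chi_holo b)).
Qed.

(** Factor [chi b x - chi b z = q x * (x - z)]. Injectivity and the noncritical value at [z] make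
    [q] zero-free, and Cauchy's formula for [f * chi' / q] at [z] returns [f z], since
    [q z = chi' z]. *)
Local Lemma transported_cauchy (b : bool) (z : C) : Cmod z <= r1 -> C_derive (chi b) z <> 0 ->
  avg r (fun x => u b x / (chi b x - chi b z)) = f z.
Proof.
  intros Hz Hcrit. assert (P := Cmod_ge_0 z). assert (Hzr : Cmod z < r) by (unfold r; lra).
  set (q := slope (chi b) z (C_derive (chi b) z)).
  assert (Hq : forall x, Cmod x < 1 -> q x <> 0).
  { intros x Hx. unfold q. destruct (classic (x = z)) as [->|Hxz]; [now rewrite slope_same|].
    rewrite slope_other by easy. intros K. apply Hxz. apply (chi_inj b); [easy|lra|].
    apply Cmod_sub_zero.
    replace (chi b x - chi b z) with ((chi b x - chi b z) / (x - z) * (x - z)) by (field; now apply Csub_neq_0).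
    rewrite K, Cmult_0_l. apply Cmod_0. }
  replace (f z) with (f z * C_derive (chi b) z / q z)
    by (unfold q; rewrite slope_same; field; easy).
  rewrite <- (cauchy_formula (fun x => f x * C_derive (chi b) x / q x) 1 r z); [|easy|unfold r; lra|].
  - apply avg_ext; [unfold r; lra|]. intros x Hx.
    assert (Hx1 : Cmod x < 1) by (rewrite Hx; unfold r; lra).
    assert (N1 := circle_sub_neq r x z Hx Hzr). assert (N2 := Hq x Hx1).
    replace (chi b x - chi b z) with (q x * (x - z)).
    + unfold u. field. now split.
    + rewrite (slope_spec (chi b) z (C_derive (chi b) z) x). fold q. ring.
  - intros x Hx. apply cdiff_div; [now apply Hq| |].
    + apply cdiff_mult; [now apply f_holo|]. now apply (cdiff_C_derive (chi b) 1 (chi_holo b)).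
    + apply (cdiff_slope (chi b) 1 (chi_holo b)); lra.
Qed.

(** The two images are disjoint, so the integrand is holomorphic on [|x| < r2]; its average is its
    value at [0], which the factor [x] in [u] makes [0]. *)
Local Lemma transported_cauchy_other (b : bool) (z : C) : Cmod z <= r1 ->
  avg r (fun x => u (negb b) x / (chi (negb b) x - chi b z)) = 0.
Proof.
  intros Hz. rewrite (mean_value_holo _ r2 r); [|unfold r; lra|unfold r; lra|].
  - unfold u, Cdiv. ring.
  - intros x Hx. assert (N : chi (negb b) x - chi b z <> 0).
    { apply Csub_neq_0. intros K. apply (chi_disjoint b z x); [lra|easy|now symmetry]. }
    apply cdiff_div; [easy|apply u_holo; lra|].
    apply cdiff_minus; [apply chi_holo; lra|apply cdiff_const].
Qed.

Local Lemma transported_cauchy_approx (b : bool) : approx E (fun w => avg r (fun x => u b x / (chi b x - w))).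
Proof.
  assert (Hcirc : forall x, Cmod x = r -> r1 < Cmod x < r2) by (intros x ->; unfold r; lra).
  destruct (compact_uniform (fun x => Cmod (x - 0) = r) (fun d x => forall w, E w -> d <= Cmod (chi b x - w)))
    as [d [Hd Hfar]].
  - apply compact_circle.
  - intros d1 d2 x Hle K w Hw. specialize (K w Hw). lra.
  - intros x Hx. rewrite Cminus_0_r in Hx.
    destruct (images_far _ (annulus_not_image b x (Hcirc x Hx))) as [d [Hd K]].
    destruct (cdiff_cont _ _ (chi_holo b x ltac:(specialize (Hcirc x Hx); lra)) (d / 2)%R) as [d' [Hd' K']]; [lra|].
    exists (Rmin (d / 2) d'). split; [apply Rmin_pos; lra|].
    intros y _ Hy w Hw. specialize (K w Hw).
    assert (Cmod (chi b y - chi b x) < d / 2).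
    { apply K'. eapply Rlt_le_trans; [apply Hy|apply Rmin_r]. }
    generalize (Cmod_sub_triangle (chi b x) (chi b y) w) (Rmin_l (d / 2) d').
    rewrite (Cmod_sub_comm (chi b x) (chi b y)). lra.
  - apply (approx_cauchy_integral E r d); [unfold r; lra|easy| | | |].
    + intros x Hx. apply cdiff_cont, u_holo. specialize (Hcirc x Hx). lra.
    + intros x Hx. apply cdiff_cont, chi_holo. specialize (Hcirc x Hx). lra.
    + intros x w Hx Hw. apply Hfar; [now rewrite Cminus_0_r|easy].
    + intros x Hx. apply pole_annulus, Hcirc, Hx.
Qed.

Lemma runge_two_disks (r0 e : R) : 0 < e -> r0 < r1 ->
  exists g, holo_D g /\ forall b z, Cmod z <= r0 -> Cmod (g (chi b z) - f z) <= e.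
Proof.
  intros He Hr0.
  destruct (approx_plus E _ _ (transported_cauchy_approx true) (transported_cauchy_approx false) e He) as [g [Hg H]].
  assert (Hg' := proj1 (holo_D_cdiff g) Hg).
  exists g. split; [easy|]. intros b z Hz.
  assert (Hreg : forall w, Cmod w <= r1 -> C_derive (chi b) w <> 0 -> Cmod (g (chi b w) - f w) <= e).
  { intros w Hw Hc. assert (Ew : E (chi b w)) by now exists b, w.
    specialize (H _ Ew). simpl in H.
    assert (K1 := transported_cauchy b w Hw Hc). assert (K2 := transported_cauchy_other b w Hw).
    destruct b; simpl in K1, K2; rewrite K1, K2 in H.
    - now rewrite Cplus_0_r in H.
    - now rewrite Cplus_0_l in H. }
  assert (Pz := Cmod_ge_0 z).
  apply le_epsilon. intros k Hk.
  assert (Hcont : ccont (fun w => g (chi b w) - f w) z).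
  { apply cont_at_minus; [|apply cdiff_cont, f_holo; lra].
    apply cdiff_cont. apply (cdiff_comp g (chi b)); [apply Hg', chi_disk|apply chi_holo]; lra. }
  destruct (Hcont k Hk) as [d [Hd K]].
  (* The exact values of the two averages are available at noncritical points only; one is taken so
     near to [z] that it stays in [|w| <= r1], and continuity transfers the bound. *)
  destruct (derivative_not_locally_zero (chi b) z (Rmin d (r1 - r0))) as [w [Hw Hc]].
  - apply Rmin_pos; lra.
  - generalize (Rmin_r d (r1 - r0)). lra.
  - apply chi_holo.
  - apply chi_inj.
  - assert (Hw1 := Rlt_le_trans _ _ _ Hw (Rmin_l _ _)). assert (Hw2 := Rlt_le_trans _ _ _ Hw (Rmin_r _ _)).
    assert (Cmod w <= r1) by (generalize (Cmod_triangle_rev w z); lra).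
    specialize (Hreg w H0 Hc). specialize (K w Hw1). simpl in K.
    apply Cmod_adherent, Rabs_lt_between in K. lra.
Qed.

End RungeTwoDisks.

Lemma fixed_point_free_univalent_recurrent (phi : C -> C) : self_map_D phi ->
  univalent_D phi -> ~ has_fixed_point_D phi -> recurrent_comp_op phi.
Proof.
  intros Hphi [_ Hinj] Hfp U HU [f Hf].
  destruct (HU f Hf) as [Hfh [r0 [eps [Hr0 [Hr01 [Heps H]]]]]].
  (* Approximation is wanted on [r0], the compact disks have radius [r1], and the iterate must carry
     the disk of radius [r2] off itself. *)
  set (r1 := ((1 + r0) / 2)%R). set (r2 := ((1 + r1) / 2)%R).
  destruct (escape_compact phi Hphi r2 Hfp) as [n [Hn Hesc]]; [unfold r2, r1; lra|].
  assert (Hinj_n : forall k z w, Cmod z < 1 -> Cmod w < 1 ->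
    Nat.iter k phi z = Nat.iter k phi w -> z = w).
  { induction k as [|k IH]; intros z w Hz Hw E; [exact E|].
    apply IH; [easy|easy|]. apply Hinj; [now apply iter_disk|now apply iter_disk|exact E]. }
  destruct (runge_two_disks (fun b : bool => if b then fun z => z else Nat.iter n phi) r1 r2) with (f := f) (r0 := r0) (e := (eps / 2)%R)
    as [g [Hg Happ]]; try (unfold r2, r1; lra).
  - intros [|] z Hz; [apply cdiff_id|now apply iter_holo].
  - intros [|] z Hz; [easy|now apply iter_disk].
  - intros [|] z w Hz Hw E; [easy|now apply (Hinj_n n)].
  - intros b z w Hz Hw.
    assert (K : forall z w, Cmod z < r2 -> Cmod w < r2 -> z <> Nat.iter n phi w).
    { intros z' w' Hz' Hw' E. specialize (Hesc w' ltac:(lra)). rewrite <- E in Hesc. lra. }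
    destruct b; simpl; [now apply K|]. intros E. now apply (K w z).
  - now apply holo_D_cdiff.
  (* The branch [true] (the identity) puts [g] in [U]; the branch [false] (the iterate) puts its
     image under the operator there. *)
  - exists n. split; [easy|]. exists g. split.
    + apply H; [easy|]. intros z Hz. specialize (Happ true z Hz). simpl in Happ. lra.
    + apply H; [now apply iter_comp_op_holo|]. intros z Hz. rewrite iter_comp_op.
      specialize (Happ false z Hz). simpl in Happ. lra.
Qed.

Theorem theorem6p9 (phi : C -> C) (Hphi : self_map_D phi) :
  recurrent_comp_op phi <->
  ((univalent_D phi /\ ~ has_fixed_point_D phi) \/ elliptic_aut_D phi).
Proof.
  split; [now apply recurrent_necessary|].
  intros [[Huni Hfp]|Hell].
  - now apply fixed_point_free_univalent_recurrent.
  - now apply elliptic_recurrent.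
Qed.
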